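(* Let $\mathbb{R}^d=\overline{D}_+\cup D_-$, where $D_+,D_-$ are two disjoint open connected sets separated by $\Gamma=\overline{D}_+\cap\overline{D}_-$, with $\Gamma$ compact and of class $C^2$, $D_+$ being the interior (bounded) domain delimited by $\Gamma$. Let $\varepsilon_+\ne\varepsilon_-$ be positive real numbers, $\varepsilon(x)=\varepsilon_+\mathbf{1}_{\overline{D}_+}(x)+\varepsilon_-\mathbf{1}_{D_-}(x)$, and $a(x)=\varepsilon(x)I_d$. Consider the Hunt process $X$, with laws $(P^x)_{x\in\mathbb{R}^d}$, associated to the Dirichlet form of $a$. For each starting point $x\in\mathbb{R}^d$ let $\mathbb{P}^x$ be the law on $(C,\mathcal{C})$ of $X$ under $P^x$. Then the family $(\mathbb{P}^x)_{x\in\mathbb{R}^d}$ is a solution to the martingale problem for $\mathcal{L}$ (as defined in the context).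
   Context: Dirichlet form of $a$: $\mathcal{D}[\mathcal{E}]=H^1(\mathbb{R}^d)$, $\mathcal{E}(u,v)=\sum_{i,j}\int_{\mathbb{R}^d}a_{ij}D_ju\,D_iv$. Its $L^2$-semigroup has a transition density $p\in C((0,\infty)\times\mathbb{R}^d\times\mathbb{R}^d)$ satisfying Aronson's two-sided Gaussian estimates, and $X$ is the Hunt process with transition function $p(t,x,y)dy$ (for every $x\in\mathbb{R}^d$); $X$ has continuous paths. $C=C([0,\infty);\mathbb{R}^d)$, $\mathcal{C}=\mathcal{B}(C)$ is its Borel $\sigma$-field, $\omega=(\omega_t)_{t\ge0}$ is the canonical process and $(\mathcal{C}_t)_{t\ge0}$ the canonical filtration. $f\in C^p(\overline{D}_+)\cap C^p(\overline{D}_-)$ means that the restriction $f_\pm$ of $f$ to $D_\pm$ coincides on $D_\pm$ with a function of class $C^p(\mathbb{R}^d)$; the subscript $b$ means bounded with bounded derivatives up to order $p$. For $y\in\Gamma$, $\nu(y)$ is the unit normal to $\Gamma$ pointing into $D_+$, and $\nabla\varphi_\pm(y)$ is the limit of $\nabla\varphi$ from $D_\pm$. The transmission operator $\mathcal{L}$ acts on $\varphi\in C(\mathbb{R}^d)\cap C^2(\overline{D}_+)\cap C^2(\overline{D}_-)$ by $\mathcal{L}\varphi(x)=\sum_{i=1}^d\varepsilon(x)\partial^2_{ii}\varphi(x)$ for $x\in\mathbb{R}^d\setminus\Gamma$ and $\mathcal{L}\varphi(x)=\delta(x)$ for $x\in\Gamma$, where $\delta(x)\in\mathbb{R}$ is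 an arbitrary value of no importance (one may take $\delta$ to be any bounded Borel function on $\Gamma$, e.g. $\delta=0$). A family of probability measures $(\mathbb{P}^x)_{x\in\mathbb{R}^d}$ on $(C,\mathcal{C})$ solves the martingale problem for $\mathcal{L}$ if for all $x\in\mathbb{R}^d$ one has $\mathbb{P}^x(\omega(0)=x)=1$ and, for all $\varphi\in C_b(\mathbb{R}^d)\cap C^2_b(\overline{D}_+)\cap C^2_b(\overline{D}_-)$ satisfying $\langle\varepsilon_+\nabla\varphi_+(y)-\varepsilon_-\nabla\varphi_-(y),\nu(y)\rangle=0$ for all $y\in\Gamma$, the process $\varphi(\omega_t)-\varphi(\omega_0)-\int_0^t\mathcal{L}\varphi(\omega_s)\,ds$, $t\ge0$, is a $(\mathcal{C}_t)$-martingale under $\mathbb{P}^x$. *)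

(* Defs.v *)
From HB Require Import structures.
From mathcomp Require Import all_boot all_order all_algebra.
From mathcomp Require Import all_classical all_reals all_analysis.
From mathcomp Require Import measurable_realfun.

Set Implicit Arguments.
Unset Strict Implicit.
Unset Printing Implicit Defensive.

Import Order.TTheory GRing.Theory Num.Theory.
Import numFieldNormedType.Exports.
Local Open Scope classical_set_scope.
Local Open Scope ring_scope.

(* R^d is 'rV[R]_d with its normed topology and its Borel sigma-algebra. *)
HB.instance Definition _ (R : realType) (d : nat) :=
  @isMeasurable.Build (sigma_display (@open 'rV[R]_d)) 'rV[R]_d
    <<s @open 'rV[R]_d >> (@sigma_algebra0 _ setT _) (@sigma_algebraC _ _)
    (@sigma_algebra_bigcup _ setT _).

(* The library has no Lebesgue measure on R^d: it is identified as the Borel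
   measure giving to every box the product of the lengths of its sides. *)
Definition is_lebesgue (R : realType) (d : nat)
    (mu : {measure set 'rV[R]_d -> \bar R}) : Prop :=
  forall l r : 'rV[R]_d, (forall i, l ord0 i <= r ord0 i) ->
    mu [set x | forall i, l ord0 i < x ord0 i <= r ord0 i] =
    (\prod_i (r ord0 i - l ord0 i))%:E.

Section calculus.
Context {R : realType} {d : nat}.
Implicit Types (f g u v w : 'rV[R]_d -> R) (D G : set 'rV[R]_d).

Definition dotrv (x y : 'rV[R]_d) : R := \sum_i x ord0 i * y ord0 i.
(* [`|x|] is the sup norm on row vectors. *)
Definition enorm (x : 'rV[R]_d) : R := Num.sqrt (dotrv x x).

Definition basis_vec (i : 'I_d) : 'rV[R]_d := delta_mx ord0 i.
Definition partial (i : 'I_d) f : 'rV[R]_d -> R :=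
  fun x => 'D_(basis_vec i) f x.
Definition grad f (x : 'rV[R]_d) : 'rV[R]_d := \row_i partial i f x.

Fixpoint classC (n : nat) f : Prop :=
  continuous f /\
  (if n is m.+1 then
     forall i, (forall x, derivable f x (basis_vec i)) /\ classC m (partial i f)
   else True).

Definition bounded_on D f : Prop := exists M : R, forall x, D x -> `|f x| <= M.

Fixpoint derivs_bounded_on D (n : nat) f : Prop :=
  bounded_on D f /\
  (if n is m.+1 then forall i, derivs_bounded_on D m (partial i f) else True).

(* f belongs to C^n_b(closure D): its restriction to D extends to a function of
   class C^n on R^d, and is bounded on D with its derivatives up to order n. *)
Definition classCb_closure D (n : nat) f : Prop :=
  exists g, [/\ classC n g, derivs_bounded_on D n g & forall x, D x -> f x = g x].

Definition grad_from D f (y : 'rV[R]_d) : 'rV[R]_d :=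
  \row_i lim (partial i f @ within D (nbhs y)).

Definition local_equation G (y : 'rV[R]_d) (U : set 'rV[R]_d) g : Prop :=
  [/\ open U, U y, classC 2 g,
      forall z, U z -> grad g z != 0
    & G `&` U = [set z | U z /\ g z = 0]].

Definition C2_hypersurface G : Prop :=
  forall y, G y -> exists U g, local_equation G y U g.

Definition unit_normal_into D G (y n : 'rV[R]_d) : Prop :=
  [/\ enorm n = 1,
      exists U g (c : R), local_equation G y U g /\ n = c *: grad g y
    & exists2 e : R, 0 < e & forall s : R, 0 < s < e -> D (y + s *: n)].

End calculus.

Section geometry.
Context {R : realType} {d : nat}.

Definition interface (Dp Dm : set 'rV[R]_d) : set 'rV[R]_d :=
  closure Dp `&` closure Dm.

Record transmission_domains (Dp Dm : set 'rV[R]_d) : Prop := {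
  td_openp : open Dp;
  td_openm : open Dm;
  td_connectedp : connected Dp;
  td_connectedm : connected Dm;
  td_disjoint : Dp `&` Dm = set0;
  td_cover : closure Dp `|` Dm = setT;
  td_compact : compact (interface Dp Dm);
  td_C2 : C2_hypersurface (interface Dp Dm);
  td_bounded : bounded_set Dp;
  (* Dp is the domain delimited by the interface (this excludes slits) *)
  td_boundary : closure Dp `\` Dp = interface Dp Dm }.

Definition diffusivity (ep em : R) (Dp Dm : set 'rV[R]_d) (x : 'rV[R]_d) : R :=
  ep * \1_(closure Dp) x + em * \1_Dm x.

End geometry.

Section dirichlet_form.
Context {R : realType} {d : nat}.
Variable mu : {measure set 'rV[R]_d -> \bar R}.
Implicit Types u v w : 'rV[R]_d -> R.

Definition test_function (f : 'rV[R]_d -> R) : Prop :=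
  (forall n, classC n f) /\
  exists2 K : set 'rV[R]_d, compact K & forall x, ~ K x -> f x = 0.

Definition weak_partial (i : 'I_d) u w : Prop :=
  forall f, test_function f ->
    \int[mu]_x (u x * partial i f x) = - \int[mu]_x (w x * f x).

(* Elements of L^2 and H^1 are represented by functions; a weak derivative is
   only determined almost everywhere, [weakD] selects one of its versions. *)
Definition in_L2 u : Prop := u \in Lfun mu 2%:E.

Definition in_H1 u : Prop :=
  in_L2 u /\ forall i, exists w, in_L2 w /\ weak_partial i u w.

Definition weakD (i : 'I_d) u : 'rV[R]_d -> R :=
  get [set w | in_L2 w /\ weak_partial i u w].

Definition energy (a : 'rV[R]_d -> 'M[R]_d) u v : R :=
  \sum_i \sum_j \int[mu]_x (a x i j * weakD j u x * weakD i v x).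

Definition norm2 u : \bar R := 'N[mu]_2%:E [EFin \o u]%E.

Definition inner2 u v : R := \int[mu]_x (u x * v x).

Record L2_semigroup (T : R -> ('rV[R]_d -> R) -> 'rV[R]_d -> R) : Prop := {
  sg_L2 : forall t u, 0 < t -> in_L2 u -> in_L2 (T t u);
  sg_linear : forall t (c : R) u v, 0 < t -> in_L2 u -> in_L2 v ->
    {ae mu, forall x, T t (fun z => c * u z + v z) x = c * T t u x + T t v x};
  sg_symmetric : forall t u v, 0 < t -> in_L2 u -> in_L2 v ->
    inner2 (T t u) v = inner2 u (T t v);
  sg_contraction : forall t u, 0 < t -> in_L2 u ->
    (norm2 (T t u) <= norm2 u)%E;
  sg_semigroup : forall s t u, 0 < s -> 0 < t -> in_L2 u ->
    {ae mu, forall x, T (s + t) u x = T s (T t u) x};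
  sg_continuous : forall u, in_L2 u ->
    norm2 (fun x => T t u x - u x) @[t --> 0^'+] --> 0%E }.

(* u is in the domain of the generator of T, with image f *)
Definition generator (T : R -> ('rV[R]_d -> R) -> 'rV[R]_d -> R) u f : Prop :=
  [/\ in_L2 u, in_L2 f &
      norm2 (fun x => t^-1 * (T t u x - u x) - f x) @[t --> 0^'+] --> 0%E].

Definition semigroup_of_form (a : 'rV[R]_d -> 'M[R]_d)
    (T : R -> ('rV[R]_d -> R) -> 'rV[R]_d -> R) : Prop :=
  L2_semigroup T /\
  forall u f, generator T u f ->
    in_H1 u /\ forall v, in_H1 v -> energy a u v = - inner2 f v.

Definition aronson (p : R -> 'rV[R]_d -> 'rV[R]_d -> R) : Prop :=
  exists c1 c2 c3 c4 : R, [/\ 0 < c1, 0 < c2, 0 < c3, 0 < c4 &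
    forall t x y, 0 < t ->
      c1 * t `^ (- (d%:R / 2)) * expR (- c2 * enorm (x - y) ^+ 2 / t) <= p t x y
      <= c3 * t `^ (- (d%:R / 2)) * expR (- c4 * enorm (x - y) ^+ 2 / t)].

Record transition_density (a : 'rV[R]_d -> 'M[R]_d)
    (p : R -> 'rV[R]_d -> 'rV[R]_d -> R) : Prop := {
  tdens_continuous : {within [set q : R * 'rV[R]_d * 'rV[R]_d | 0 < q.1.1],
    continuous (fun q : R * 'rV[R]_d * 'rV[R]_d => p q.1.1 q.1.2 q.2)};
  tdens_aronson : aronson p;
  tdens_kernel : semigroup_of_form a (fun t u x => \int[mu]_y (p t x y * u y)) }.

End dirichlet_form.

Section filtrations.
Context {R : realType} {dO : measure_display} {Omega : measurableType dO}.
Implicit Type F : R -> set (set Omega).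

Record filtration F : Prop := {
  filt_sigma : forall t : R, 0 <= t -> sigma_algebra setT (F t);
  filt_measurable : forall t : R, 0 <= t -> F t `<=` measurable;
  filt_mono : forall s t : R, 0 <= s -> s <= t -> F s `<=` F t }.

Definition adapted {d'} {E : measurableType d'} F (X : R -> Omega -> E) : Prop :=
  forall (t : R) (B : set E), 0 <= t -> measurable B -> F t (X t @^-1` B).

Definition stopping_time F (tau : Omega -> \bar R) : Prop :=
  (forall w, (0 <= tau w)%E) /\
  forall t : R, 0 <= t -> F t [set w | (tau w <= t%:E)%E].

Definition stopped_event F (tau : Omega -> \bar R) (A : set Omega) : Prop :=
  measurable A /\
  forall t : R, 0 <= t -> F t (A `&` [set w | (tau w <= t%:E)%E]).

Definition martingale F (Q : probability Omega R) (M : R -> Omega -> R) : Prop :=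
  [/\ adapted F M,
      forall t : R, 0 <= t -> Q.-integrable setT (EFin \o M t)
    & forall (s t : R) A, 0 <= s -> s <= t -> F s A ->
        \int[Q]_(w in A) M t w = \int[Q]_(w in A) M s w].

End filtrations.

Section hunt.
Context {R : realType} {d : nat}.
Context {dO : measure_display} {Omega : measurableType dO}.
Variables (P : 'rV[R]_d -> probability Omega R) (X : R -> Omega -> 'rV[R]_d).

Definition at_time (tau : Omega -> \bar R) (w : Omega) : 'rV[R]_d :=
  X (fine (tau w)) w.

(* strong Markov property; integrating in x against an arbitrary probability
   gives it for every initial distribution *)
Definition strong_markov (F : R -> set (set Omega)) : Prop :=
  forall x tau (s : R) A (B : set 'rV[R]_d), stopping_time F tau -> 0 <= s -> stopped_event F tau A ->
    measurable B ->
    P x (A `&` [set w | (tau w < +oo)%E /\ B (X (fine (tau w) + s) w)]) =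
    (\int[P x]_(w in A `&` [set w | (tau w < +oo)%E])
       P (at_time tau w) (X s @^-1` B))%E.

Definition quasi_left_continuous (F : R -> set (set Omega)) : Prop :=
  forall x (taus : nat -> Omega -> \bar R),
    (forall n, stopping_time F (taus n)) ->
    (forall n w, (taus n w <= taus n.+1 w)%E) ->
    let tau w := ereal_sup (range (taus^~ w)) in
    P x [set w | (tau w < +oo)%E /\ at_time (taus n) w @[n --> \oo] --> at_time tau w]
    = P x [set w | (tau w < +oo)%E].

(* Hunt process with state space R^d and infinite lifetime (no cemetery);
   only times t >= 0 are relevant. *)
Record hunt_process : Prop := {
  hunt_measurable : forall t : R, 0 <= t -> measurable_fun setT (X t);
  hunt_kernel : forall (t : R) (B : set 'rV[R]_d), 0 <= t -> measurable B ->
    measurable_fun setT (fun x : 'rV[R]_d => P x (X t @^-1` B));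
  hunt_normal : forall x, P x [set w | X 0 w = x] = 1%E;
  hunt_shift : exists theta : R -> Omega -> Omega,
    forall (s t : R) w, 0 <= s -> 0 <= t -> X s (theta t w) = X (s + t) w;
  hunt_right_continuous : forall w (t : R), 0 <= t -> X^~ w s @[s --> t^'+] --> X t w;
  hunt_left_limits : forall w (t : R), 0 < t -> cvg (X^~ w s @[s --> t^'-]);
  hunt_filtration : exists F : R -> set (set Omega),
    [/\ filtration F,
        forall t : R, 0 <= t -> F t = \bigcap_(s in [set s | t < s]) F s,
        adapted F X, strong_markov F & quasi_left_continuous F] }.

Definition has_transition_function (mu : {measure set 'rV[R]_d -> \bar R})
    (p : R -> 'rV[R]_d -> 'rV[R]_d -> R) : Prop :=
  forall (t : R) x (B : set 'rV[R]_d), 0 < t -> measurable B ->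
    P x (X t @^-1` B) = (\int[mu]_(y in B) (p t x y)%:E)%E.

End hunt.

Definition halfline (R : realType) : set R := [set t | 0 <= t].
Arguments halfline : clear implicits.

Definition path_space (R : realType) (d : nat) : Type :=
  continuousType (halfline R : Type) 'rV[R]_d.
Arguments path_space : clear implicits.

Section path_space_instances.
Context (R : realType) (d : nat).

HB.instance Definition _ := Choice.on (path_space R d).
(* topology of locally uniform convergence *)
HB.instance Definition _ := Topological.copy (path_space R d)
  (@initial_topology (path_space R d)
     {compact-open, (halfline R : Type) -> 'rV[R]_d} (fun w => w : _ -> _)).

Definition zero_path : path_space R d :=
  mkcts (fun x : (halfline R : Type) => @cvg_cst 'rV[R]_d 0 _ (nbhs x) _).
HB.instance Definition _ := isPointed.Build (path_space R d) zero_path.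
HB.instance Definition _ :=
  @isMeasurable.Build (sigma_display (@open (path_space R d))) (path_space R d)
    <<s @open (path_space R d) >> (@sigma_algebra0 _ setT _)
    (@sigma_algebraC _ _) (@sigma_algebra_bigcup _ setT _).

End path_space_instances.

Section canonical_process.
Context {R : realType} {d : nat}.

Lemma halfline_max (t : R) : Num.max 0 t \in halfline R.
Proof. by rewrite inE /halfline /= le_max lexx. Qed.

(* Times are real numbers; negative ones, never used, are sent to 0. *)
Definition to_halfline (t : R) : (halfline R : Type) :=
  exist _ (Num.max 0 t) (halfline_max t).

Definition evaluation (t : R) (w : path_space R d) : 'rV[R]_d :=
  (w : continuousType _ _) (to_halfline t).

Definition canonical_filtration (t : R) : set (set (path_space R d)) :=
  <<s [set A | exists (s : R) (B : set 'rV[R]_d), [/\ 0 <= s, s <= t, measurable B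
                             & A = evaluation s @^-1` B]] >>.

End canonical_process.

Section martingale_problem.
Context {R : realType} {d : nat}.
Variables (Dp Dm : set 'rV[R]_d) (ep em : R).

(* [delta] is the irrelevant value of L phi on the interface *)
Definition transmission_operator (delta phi : 'rV[R]_d -> R) (x : 'rV[R]_d) : R :=
  if x \in interface Dp Dm then delta x
  else \sum_i diffusivity ep em Dp Dm x * partial i (partial i phi) x.

Definition transmission_domain (phi : 'rV[R]_d -> R) : Prop :=
  [/\ continuous phi, bounded_on setT phi,
      classCb_closure Dp 2 phi, classCb_closure Dm 2 phi
    & forall y n, interface Dp Dm y -> unit_normal_into Dp (interface Dp Dm) y n ->
        dotrv (ep *: grad_from Dp phi y - em *: grad_from Dm phi y) n = 0].

Definition solves_martingale_problem (delta : 'rV[R]_d -> R)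
    (PP : 'rV[R]_d -> probability (path_space R d) R) : Prop :=
  forall x,
    PP x [set w | evaluation 0 w = x] = 1%E /\
    forall phi, transmission_domain phi ->
      martingale canonical_filtration (PP x) (fun t w =>
        phi (evaluation t w) - phi (evaluation 0 w)
        - \int[lebesgue_measure]_(s in `[0, t])
            transmission_operator delta phi (evaluation s w)).

End martingale_problem.

(* Main.v *)
Require Import Defs.
From HB Require Import structures.
From mathcomp Require Import all_boot all_order all_algebra.
From mathcomp Require Import all_classical all_reals all_analysis.
From mathcomp Require Import measurable_realfun.
From mathcomp Require Import ring lra.

Set Implicit Arguments.
Unset Strict Implicit.
Unset Printing Implicit Defensive.

Import Order.TTheory GRing.Theory Num.Theory.
Import numFieldNormedType.Exports.
Local Open Scope classical_set_scope.
Local Open Scope ring_scope.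

(** Let T_t be the semigroup of the form and L the transmission operator. For the
    indicator u of a box, w = int_0^t T_s u ds is in the domain of the generator,
    with image T_t u - u. If psi is compactly supported in the transmission domain,
    the divergence theorem on the two sides of the interface, where the flux
    condition cancels the boundary terms, gives E(w, psi) = - <w, L psi>, hence
    <T_t u - u, psi> = <w, L psi>. By symmetry of T_t, and since boxes separate
    functions, T_t psi - psi = int_0^t T_s (L psi) ds almost everywhere; a cutoff
    extends this to bounded phi in the transmission domain. The laws at positive
    times have a density, so applying T_r removes the exceptional set, and right
    continuity of the paths lets r tend to 0: Dynkin's formula for phi holds from
    every starting point. The martingale property follows by the Markov property,
    and is transported to path space through cylinder sets, for which the
    realization of the paths is measurable. *)

(** * Borel sets and Lebesgue measure on row vectors *)

(** The form is exploited in one direction only: an element of the domain of the generator lies in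
    H^1 and satisfies the energy identity. Placing psi itself in that domain would require a
    regularity theory for the transmission problem. So psi serves only as a test element of H^1, and
    the domain element is a time integral of the semigroup, whose membership follows from strong
    continuity alone. The divergence theorem is obtained without a surface measure. The two
    one-sided fields extend to the whole space; subtracting one of them everywhere leaves on D_+ a
    field tangent to the interface, and the only fact about the boundary is that the divergence of
    such a field has integral 0. This is local, and near the interface it follows from a cutoff that
    is a rational function of a local equation. The local structure of the interface is used through
    a single coordinate direction along which the local equation is strictly monotone. This
    direction gives the position of the two sides and the distance to the interface, and the
    interface is null because small pieces of it have infinitely many disjoint translates along
    it. *)

Section borel_rV.
Context {R : realType} {d : nat}.
Implicit Types x y l r : 'rV[R]_d.

Lemma coord_le_norm x i : `|x ord0 i| <= `|x|.
Proof.
rewrite [leRHS]/Num.norm /= mx_normrE; apply/bigmax_geP; right => /=.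
by exists (ord0, i).
Qed.

Lemma rV_norm_le x (e : R) : 0 <= e -> (forall i, `|x ord0 i| <= e) -> `|x| <= e.
Proof.
move=> e0 h; rewrite [leLHS]/Num.norm /= mx_normrE; apply/bigmax_leP; split => //.
by move=> [j i] _ /=; rewrite ord1.
Qed.

Lemma rV_norm_lt x (e : R) : 0 < e -> (forall i, `|x ord0 i| < e) -> `|x| < e.
Proof.
move=> e0 h; rewrite [ltLHS]/Num.norm /= mx_normrE; apply/bigmax_ltP; split => //.
by move=> [j i] _ /=; rewrite ord1.
Qed.

Definition box l r : set 'rV[R]_d :=
  [set x | forall i, l ord0 i < x ord0 i <= r ord0 i].

Lemma continuous_coord i : continuous (fun x => x ord0 i).
Proof. exact: coord_continuous. Qed.

Lemma open_measurable_rV (U : set 'rV[R]_d) : open U -> measurable U.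
Proof. by move=> oU; apply: sub_sigma_algebra. Qed.

Lemma closed_measurable_rV (U : set 'rV[R]_d) : closed U -> measurable U.
Proof.
move=> cU; rewrite -(setCK U); apply: measurableC.
by apply: open_measurable_rV; exact: closed_openC.
Qed.

Lemma continuous_measurable_rV (f : 'rV[R]_d -> R) :
  continuous f -> measurable_fun setT f.
Proof.
move=> /continuousP cf; apply: (measurability _ (RGenOpens.measurableE R)).
move=> _ [_ [a [b ->] <-]]; rewrite setTI; apply: open_measurable_rV.
exact/cf/interval_open.
Qed.

Lemma measurable_coord i : measurable_fun setT (fun x => x ord0 i).
Proof. by apply: continuous_measurable_rV; exact: continuous_coord. Qed.

Lemma measurable_box l r : measurable (box l r).
Proof.
rewrite (_ : box l r = \bigcap_(i in [set: 'I_d])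
   ((fun x => x ord0 i) @^-1` `](l ord0 i), (r ord0 i)]%classic)); last first.
  apply/seteqP; split => x /=.
    by move=> h i _ /=; rewrite in_itv/=.
  by move=> h i; have := h i I; rewrite /= in_itv/=.
apply: fin_bigcap_measurable => [|i _]; first exact: finite_finset.
rewrite -[X in measurable X]setTI.
exact: measurable_coord.
Qed.

Definition grid_cell (n : nat) (k : 'rV[int]_d) : set 'rV[R]_d :=
  box (\row_i ((k ord0 i)%:~R / n.+1%:R)) (\row_i (((k ord0 i)%:~R + 1) / n.+1%:R)).

(** Cells are open on the left and closed on the right, hence [ceil - 1] and not [floor]. *)
Definition grid_index (n : nat) x : 'rV[int]_d :=
  \row_i (Num.ceil (n.+1%:R * x ord0 i) - 1).

Lemma grid_cell_index n x : grid_cell n (grid_index n x) x.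
Proof.
move=> i; rewrite !mxE intrB subrK ltr_pdivrMr ?ltr0n// ler_pdivlMr ?ltr0n//.
rewrite [x _ _ * _]mulrC ceil_ge andbT.
by have := ceilB1_lt (n.+1%:R * x ord0 i); rewrite intrB.
Qed.

Lemma grid_cell_near n k x y : grid_cell n k x -> grid_cell n k y ->
  `|x - y| <= n.+1%:R^-1.
Proof.
move=> kx ky; apply: rV_norm_le => // i.
move: (kx i) (ky i); rewrite !mxE !mulrDl mul1r => /andP[a b] /andP[a' b'].
move: a b a' b'; move: (n.+1%:R^-1) => c; move: ((k ord0 i)%:~R * c) => e.
by move=> *; rewrite ler_norml; apply/andP; split; lra.
Qed.

Lemma invnS_cvg0 : (n.+1%:R^-1 : R) @[n --> \oo] --> (0 : R).
Proof. exact: cvg_harmonic. Qed.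

Lemma invnS_lt (e : R) : 0 < e -> exists n : nat, n.+1%:R^-1 < e.
Proof.
move=> e0; have /cvgrPdist_lt /(_ _ e0) [N _ h] := invnS_cvg0.
by exists N; have := h N (leqnn N); rewrite /= sub0r normrN ger0_norm.
Qed.

(** The cell of mesh [1/(n+1)] around a point fits in [U] once the mesh is below the radius of a
    ball around that point. Pairs of a mesh and an index are countable, so this is a countable
    union. *)
Lemma open_rV_boxes (U : set 'rV[R]_d) : open U ->
  U = \bigcup_(c : nat * 'rV[int]_d)
        (if `[< grid_cell c.1 c.2 `<=` U >] then grid_cell c.1 c.2 else set0).
Proof.
move=> oU; apply/seteqP; split => x; last first.
  by move=> [[n k]] _ /=; case: asboolP => // h; exact: h.
move=> Ux; have /nbhs_ballP[e /= e0 eU] := open_nbhs_nbhs (conj oU Ux).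
have [n ne] := invnS_lt e0.
exists (n, grid_index n x) => //=; case: asboolP => [_|]; first exact: grid_cell_index.
move=> h; exfalso; apply: h => y ky; apply: eU; rewrite -ball_normE /ball_/=.
by apply: le_lt_trans ne; apply: grid_cell_near ky; exact: grid_cell_index.
Qed.

Definition boxes : set (set 'rV[R]_d) := [set A | exists l r, A = box l r].

Lemma measurable_rV_boxes : @measurable _ 'rV[R]_d = <<s boxes >>.
Proof.
apply/seteqP; split.
  apply: smallest_sub; first exact: smallest_sigma_algebra.
  move=> U /open_rV_boxes ->.
  have H : forall c : nat * 'rV[int]_d, boxes.-sigma.-measurable
     ((if `[< grid_cell c.1 c.2 `<=` U >] then grid_cell c.1 c.2 else set0) : set (g_sigma_algebraType boxes)).
    move=> c; case: ifP => _; last exact: measurable0.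
    by apply: sub_sigma_algebra; do 2 eexists.
  by have := countable_bigcupT_measurable (countableP _) H.
apply: smallest_sub; first exact: (@sigma_algebra_measurable _ 'rV[R]_d).
by move=> _ [l [r ->]]; exact: measurable_box.
Qed.

Lemma box_setI l r l' r' : box l r `&` box l' r' =
  box (\row_i Num.max (l ord0 i) (l' ord0 i)) (\row_i Num.min (r ord0 i) (r' ord0 i)).
Proof.
apply/seteqP; split => x /=.
  move=> [h h'] i; rewrite !mxE gt_max le_min.
  by move: (h i) (h' i) => /andP[? ?] /andP[? ?]; apply/andP; split; apply/andP.
by move=> h; split => i; have := h i; rewrite !mxE gt_max le_min;
  move=> /andP[/andP[? ?] /andP[? ?]]; apply/andP.
Qed.

Lemma boxes_setI_closed : setI_closed boxes.
Proof. by move=> _ _ [l [r ->]] [l' [r' ->]]; rewrite box_setI; do 2 eexists. Qed.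

Definition cube_box (n : nat) : set 'rV[R]_d := box (const_mx (- n%:R)) (const_mx n%:R).

Lemma cube_box_cover : \bigcup_n cube_box n = setT.
Proof.
apply/seteqP; split => // x _; exists (Num.trunc `|x|).+1 => // i; rewrite !mxE.
have h : `|x ord0 i| < (Num.trunc `|x|).+1%:R.
  by apply: le_lt_trans (coord_le_norm x i) _; apply: truncnS_gt.
by move: h; rewrite ltr_norml => /andP[-> /ltW ->].
Qed.

Lemma measurable_funTs_rV d' (Y : measurableType d') (f : Y -> 'rV[R]_d) :
  (forall i, measurable_fun setT (fun w => f w ord0 i)) -> measurable_fun setT f.
Proof.
move=> mf; apply: (measurability _ measurable_rV_boxes).
move=> _ [_ [l [r ->]] <-]; rewrite setTI.
rewrite (_ : f @^-1` box l r = \bigcap_(i in [set: 'I_d])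
   ((fun w => f w ord0 i) @^-1` `](l ord0 i), (r ord0 i)]%classic)); last first.
  apply/seteqP; split => x /=.
    by move=> h i _ /=; rewrite in_itv/=.
  by move=> h i; have := h i I; rewrite /= in_itv/=.
apply: fin_bigcap_measurable => [|i _]; first exact: finite_finset.
rewrite -[X in measurable X]setTI.
exact: mf.
Qed.

End borel_rV.

(** * Integration with respect to an image measure *)

Section image_measure.
Context d1 d2 (X : measurableType d1) (Y : measurableType d2) (R : realType).
Variables (phi : X -> Y) (mphi : measurable_fun setT phi).
Variables (mu : {measure set X -> \bar R}) (nu : {measure set Y -> \bar R}).
Hypothesis nuE : forall A, measurable A -> nu A = mu (phi @^-1` A).

Lemma ge0_integral_image (f : Y -> \bar R) : measurable_fun setT f ->
  (forall y, 0 <= f y)%E -> (\int[nu]_y f y = \int[mu]_x f (phi x))%E.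
Proof.
move=> mf f0.
rewrite -[RHS](@ge0_integral_pushforward _ _ _ _ _ phi mphi mu setT f)//.
by apply: eq_measure_integral => A mA _; rewrite nuE.
Qed.

Lemma integral_image (f : Y -> \bar R) : measurable_fun setT f ->
  (\int[nu]_y f y = \int[mu]_x f (phi x))%E.
Proof.
move=> mf; rewrite [LHS]integralE [RHS]integralE; congr (_ - _)%E.
  rewrite (ge0_integral_image (measurable_funepos mf) (fun y => funepos_ge0 f y)).
  by apply: eq_integral => x _; rewrite !funeposE.
rewrite (ge0_integral_image (measurable_funeneg mf) (fun y => funeneg_ge0 f y)).
by apply: eq_integral => x _; rewrite !funenegE.
Qed.

Lemma Rintegral_image (f : Y -> R) : measurable_fun setT f ->
  \int[nu]_y f y = \int[mu]_x f (phi x).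
Proof.
move=> mf; rewrite /Rintegral (integral_image (f := EFin \o f))//.
exact/measurable_EFinP.
Qed.

Lemma integrable_image (f : Y -> \bar R) : measurable_fun setT f ->
  nu.-integrable setT f <-> mu.-integrable setT (f \o phi).
Proof.
move=> mf; have E : (\int[nu]_y `|f y| = \int[mu]_x `|f (phi x)|)%E.
  apply: (ge0_integral_image (f := fun y => `|f y|%E)) => //.
  by apply: measurableT_comp mf; exact: abse_measurable.
split => /integrableP[_ h]; apply/integrableP; split => //=.
- exact: measurableT_comp.
- by rewrite -E.
- by rewrite E.
Qed.

End image_measure.

Section lebesgue_rV.
Context {R : realType} {d : nat}.
Variable mu : {measure set 'rV[R]_d -> \bar R}.
Hypothesis hmu : is_lebesgue mu.

Lemma lebesgue_boxE (l r : 'rV[R]_d) : mu (box l r) =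
  if `[< forall i, l ord0 i <= r ord0 i >]
  then (\prod_i (r ord0 i - l ord0 i))%:E else 0%E.
Proof.
case: asboolP => [/hmu //|]; move/existsNP => [i /negP]; rewrite -ltNge => h.
rewrite (_ : box l r = set0) ?measure0// -subset0 => x /(_ i) /andP[a b].
by have := lt_trans h (lt_le_trans a b); rewrite ltxx.
Qed.

Lemma lebesgue_cube_lty n : (mu (cube_box n) < +oo)%E.
Proof. by rewrite /cube_box lebesgue_boxE; case: asboolP; rewrite ?ltry. Qed.

Lemma lebesgue_rV_sigma_finite : sigma_finite setT mu.
Proof.
exists (@cube_box R d); first by rewrite cube_box_cover.
by move=> i; split; [exact: measurable_box|exact: lebesgue_cube_lty].
Qed.

Lemma lebesgue_bounded_lty (A : set 'rV[R]_d) (M : R) : measurable A ->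
  (forall x, A x -> `|x| <= M) -> (mu A < +oo)%E.
Proof.
move=> mA AM; apply: le_lt_trans (lebesgue_cube_lty (Num.trunc `|M|).+1).
apply: le_measure; rewrite ?inE//; first exact: measurable_box.
move=> x /AM xM i; rewrite !mxE.
have h : `|x ord0 i| < (Num.trunc `|M|).+1%:R.
  apply: le_lt_trans (coord_le_norm x i) _; apply: (le_lt_trans xM).
  by apply: le_lt_trans (ler_norm M) _; exact: truncnS_gt.
by move: h; rewrite ltr_norml => /andP[-> /ltW ->].
Qed.

(** Half-open boxes are stable under intersection and generate the Borel sets, and cubes of finite
    mass exhaust the space: this is uniqueness of measures on a pi-system. *)
Lemma box_measure_unique (m1 m2 : {measure set 'rV[R]_d -> \bar R}) :
  (forall l r, m1 (box l r) = m2 (box l r)) ->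
  (forall n, m1 (cube_box n) < +oo)%E ->
  forall A, measurable A -> m1 A = m2 A.
Proof.
move=> m12 m1oo A mA; apply: (measure_unique boxes (@cube_box R d)) => //.
- exact: measurable_rV_boxes.
- exact: boxes_setI_closed.
- by move=> i; do 2 eexists.
- exact: cube_box_cover.
- by move=> _ [l [r ->]].
Qed.

Lemma measurable_shift (v : 'rV[R]_d) : measurable_fun setT (fun x : 'rV[R]_d => x + v).
Proof.
apply: measurable_funTs_rV => i.
rewrite (_ : (fun _ => _) = (fun w : 'rV[R]_d => w ord0 i + v ord0 i)); last first.
  by apply/funext => x; rewrite mxE.
by apply: measurable_funD => //; exact: measurable_coord.
Qed.

(** The translated measure gives to a box the mass of a translated box, which has the same sides;
    uniqueness on boxes concludes. *)
Lemma lebesgue_shift (v : 'rV[R]_d) (A : set 'rV[R]_d) : measurable A ->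
  mu A = mu ((fun x => x + v) @^-1` A).
Proof.
move=> mA; pose nu0 : {measure set 'rV[R]_d -> \bar R} :=
  pushforward mu (fun x : 'rV[R]_d => x + v).
pose nu := nu0 (measurable_shift v).
rewrite -[RHS]/(nu A); apply: box_measure_unique => //; last exact: lebesgue_cube_lty.
move=> l r; rewrite /nu /nu0 /= /pushforward.
rewrite (_ : _ @^-1` _ = box (l - v) (r - v)); last first.
  by apply/seteqP; split => x /= h i; have := h i; rewrite !mxE ltrBlDr lerBrDr.
rewrite !lebesgue_boxE.
have -> : (forall i, (l - v) ord0 i <= (r - v) ord0 i) = (forall i, l ord0 i <= r ord0 i).
  by apply/propext; split => h i; have := h i; rewrite !mxE lerD2r.
case: asboolP => // _; congr EFin; apply: eq_bigr => i _.
by rewrite !mxE opprB addrA subrK.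
Qed.

Lemma Rintegral_shift (v : 'rV[R]_d) (f : 'rV[R]_d -> R) :
  measurable_fun setT f -> \int[mu]_x f (x + v) = \int[mu]_x f x.
Proof.
move=> mf; apply/esym/Rintegral_image => //; first exact: measurable_shift.
by move=> A mA; exact: lebesgue_shift.
Qed.

Lemma integrable_bounded_support (f : 'rV[R]_d -> R) (M N : R) :
  measurable_fun setT f -> (forall x, `|f x| <= M) ->
  (forall x, N < `|x| -> f x = 0) -> mu.-integrable setT (EFin \o f).
Proof.
move=> mf fM fN; pose A : set 'rV[R]_d := [set x | `|x| <= N].
have mA : measurable A.
  apply: closed_measurable_rV; rewrite (_ : A = (fun x => `|x|) @^-1` [set r | r <= N])//.
  by apply: closed_comp; [move=> x _; exact: norm_continuous|exact: closed_le].
rewrite (_ : f = f \_ A).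
  rewrite -restrict_EFin; apply/(integrable_mkcond _ mA).1.
  apply: measurable_bounded_integrable => //.
  - exact: (@lebesgue_bounded_lty _ N).
  - exact: measurable_funTS.
  - exists M; split; first by rewrite num_real.
    by move=> x Mx y _; apply: le_trans (fM y) (ltW Mx).
apply/funext => x; rewrite /patch; case: ifPn => //; rewrite notin_setE /A /=.
by move/negP; rewrite -ltNge => /fN.
Qed.

Lemma integral_box_indic l r (h : 'rV[R]_d -> R) :
  \int[mu]_x (\1_(box l r) x * h x) = \int[mu]_(x in box l r) h x.
Proof.
rewrite [RHS]Rintegral_mkcond; apply: eq_Rintegral => x _.
by rewrite /patch indicE; case: ifP => _; rewrite ?mul1r ?mul0r.
Qed.

(* The positive and negative parts of h define measures which agree on boxes. *)
Lemma ae_eq0_boxes (h : 'rV[R]_d -> R) : measurable_fun setT h ->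
  (forall l r, mu.-integrable (box l r) (EFin \o h)) ->
  (forall l r, \int[mu]_(x in box l r) h x = 0) ->
  {ae mu, forall x, h x = 0}.
Proof.
move=> mh ih h0; set f := EFin \o h.
have mf : measurable_fun setT f by exact/measurable_EFinP.
have mfp : measurable_fun setT f^\+%E by exact: measurable_funepos.
have mfn : measurable_fun setT f^\-%E by exact: measurable_funeneg.
have P0 A : (0 <= \int[mu]_(x in A) (f^\+ x)%E)%E.
  by apply: integral_ge0 => x _; exact: funepos_ge0.
have N0 A : (0 <= \int[mu]_(x in A) (f^\- x)%E)%E.
  by apply: integral_ge0 => x _; exact: funeneg_ge0.
pose m1 : {measure set 'rV[R]_d -> \bar R} :=
  HB.pack (fun A => \int[mu]_(x in A) (f^\+ x)%E)%E
   (isMeasure.Build _ _ _ (fun A => \int[mu]_(x in A) (f^\+ x)%E)%E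
      (integral_set0 _ _) P0
      (semi_sigma_additive_nng_induced mfp (fun x => funepos_ge0 f x))).
pose m2 : {measure set 'rV[R]_d -> \bar R} :=
  HB.pack (fun A => \int[mu]_(x in A) (f^\- x)%E)%E
   (isMeasure.Build _ _ _ (fun A => \int[mu]_(x in A) (f^\- x)%E)%E
      (integral_set0 _ _) N0
      (semi_sigma_additive_nng_induced mfn (fun x => funeneg_ge0 f x))).
have m12 : forall A, measurable A -> m1 A = m2 A.
  apply: box_measure_unique => [l r|n].
    have := ih l r => /[dup] /integrable_funepos ip /integrable_funeneg iq.
    have fp := integrable_fin_num (measurable_box l r) (ip (measurable_box l r)).
    have fq := integrable_fin_num (measurable_box l r) (iq (measurable_box l r)).
    have /eqP : (\int[mu]_(x in box l r) f x)%E = 0%E.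
      by rewrite -[LHS]fineK ?(integrable_fin_num (measurable_box l r))//
           [fine _](h0 l r).
    by rewrite integralE sube_eq ?add0e// ?fin_num_adde_defl// => /eqP.
  rewrite /= ltey_eq; apply/orP; left.
  apply: integrable_fin_num; first exact: measurable_box.
  have K := integrable_funepos (measurable_box _ _) (ih (const_mx (- n%:R)) (const_mx n%:R)). exact: K.
have mB : measurable [set x | 0 < h x].
  rewrite -[X in measurable X]setTI; have := mh measurableT `]0, +oo[%classic (measurable_itv _).
  by rewrite preimage_itvoy.
(* The negative part vanishes where [h > 0], so [m2], and hence [m1], gives no mass to this set; but
   [m1] is carried by it. *)
have m20 : m2 [set x | 0 < h x] = 0%E.
  apply: integral0_eq => x /= hx; rewrite funenegE /f /= max_r// lee_fin oppr_le0.
  exact: ltW.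
have m1T : m1 setT = 0%E.
  rewrite -m20 -m12//=; rewrite [RHS]integral_mkcond.
  apply: eq_integral => x _; rewrite /patch; case: ifPn => //.
  rewrite notin_setE /= => /negP; rewrite -leNgt => hx.
  by rewrite funeposE /f /= max_r ?lee_fin.
have /(ae_eq_integral_abs mu measurableT mf) : (\int[mu]_x `|f x|)%E = 0%E.
  rewrite (eq_integral (fun x => f^\+ x + f^\- x)%E); last first.
    by move=> x _; rewrite -/((abse \o f) x) fune_abse.
  rewrite ge0_integralD//.
  by rewrite [X in (X + _)%E]m1T add0e; have := m12 setT measurableT; rewrite m1T.
by apply: filterS => x /(_ I) [].
Qed.

End lebesgue_rV.

(** [e n (q n x)] takes countably many values, so the discretized function is measurable piece by
    piece; the limit is pointwise. This gives joint measurability of functions continuous in the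
    first variable and measurable in the second. *)
Lemma measurable_fun_discretization d1 d2 (T1 : measurableType d1)
    (T2 : measurableType d2) (R : realType) (C : countType) (D : set T1)
    (q : nat -> T1 -> C) (e : nat -> C -> T1) (F : T1 -> T2 -> R) :
  measurable D ->
  (forall n c, measurable (D `&` [set x | q n x = c])) ->
  (forall n x, D x -> measurable_fun setT (F (e n (q n x)))) ->
  (forall x y, D x -> F (e n (q n x)) y @[n --> \oo] --> F x y) ->
  measurable_fun (D `*` setT) (fun z : T1 * T2 => F z.1 z.2).
Proof.
move=> mD mq mF cF.
apply: (@measurable_fun_cvg _ _ _ _ (fun n z => F (e n (q n z.1)) z.2)); last first.
  by move=> [x y] /= [Dx _]; exact: cF.
move=> n _ B mB.
rewrite (_ : _ `&` _ = \bigcup_c ((D `&` [set x | q n x = c]) `*`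
    (if `[< exists x, D x /\ q n x = c >] then F (e n c) @^-1` B else set0))).
  apply: countable_bigcupT_measurable => [|c]; first exact: countableP.
  apply: measurableX; first exact: mq.
  case: asboolP => [[x [Dx <-]]|_]; last exact: measurable0.
  by rewrite -[X in measurable X]setTI; exact: mF.
apply/seteqP; split => [[x y] /= [[Dx _] By]|[x y] /= [c _ /= [[Dx qc]]]].
  by exists (q n x) => //=; split => //; case: asboolP => // -[]; exists x.
by case: asboolP => [_ By|//]; split => //; rewrite qc.
Qed.

(** * Dominated convergence and Fubini's theorem for real-valued integrals *)

Section real_integrals.
Context d (T : measurableType d) (R : realType).
Variable mu : {measure set T -> \bar R}.
Implicit Types (D : set T) (f g : T -> R).

Lemma integrable_le D f g : measurable D -> measurable_fun D f ->
  mu.-integrable D (EFin \o g) -> (forall x, D x -> `|f x| <= g x) ->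
  mu.-integrable D (EFin \o f).
Proof.
move=> mD mf ig fg; apply: le_integrable ig => //; first exact/measurable_EFinP.
move=> x Dx /=; rewrite lee_fin; apply: le_trans (fg _ Dx) _; exact: ler_norm.
Qed.

Lemma integrable_bounded D f (M : R) : measurable D -> (mu D < +oo)%E ->
  measurable_fun D f -> (forall x, D x -> `|f x| <= M) ->
  mu.-integrable D (EFin \o f).
Proof.
move=> mD Doo mf fM; apply: measurable_bounded_integrable => //.
exists M; split; first by rewrite num_real.
by move=> N MN x Dx; apply: le_trans (fM _ Dx) (ltW MN).
Qed.

Lemma Rintegral_dominated D (f_ : nat -> T -> R) f g : measurable D ->
  (forall n, measurable_fun D (f_ n)) -> measurable_fun D f ->
  {ae mu, forall x, D x -> f_ n x @[n --> \oo] --> f x} ->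
  mu.-integrable D (EFin \o g) ->
  (forall n x, D x -> `|f_ n x| <= g x) ->
  \int[mu]_(x in D) f_ n x @[n --> \oo] --> \int[mu]_(x in D) f x.
Proof.
move=> mD mf_ mf cf ig fg; apply: fine_cvg.
have [] := @dominated_convergence _ _ _ mu D mD (fun n => EFin \o f_ n)
   (EFin \o f) (EFin \o g) _ _ _ ig _.
- by move=> n; exact/measurable_EFinP.
- exact/measurable_EFinP.
- apply: filterS cf => x cfx Dx; have := cfx Dx.
  by move=> h; apply: cvg_EFin => //; exact: nearW.
- by apply: aeW => x n Dx /=; rewrite lee_fin fg.
move=> /integrable_fin_num fin _ h; move: h; rewrite /=.
by rewrite /Rintegral fineK//; exact: fin.
Qed.

Lemma Rintegral_le_bound D f (M : R) : measurable D -> (mu D < +oo)%E ->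
  measurable_fun D f -> (forall x, D x -> `|f x| <= M) ->
  `|\int[mu]_(x in D) f x| <= M * fine (mu D).
Proof.
move=> mD Doo mf fM; have If := integrable_bounded mD Doo mf fM.
apply: le_trans (le_normr_Rintegral mD If) _.
rewrite -Rintegral_cst//; apply: le_Rintegral => //.
- exact: (integrable_norm If).
- by apply: (@integrable_bounded _ _ `|M|) => //; exact: measurable_cst.
Qed.

Lemma ae_eq_Rintegral D f g : measurable D -> measurable_fun D f ->
  measurable_fun D g -> {ae mu, forall x, D x -> f x = g x} ->
  \int[mu]_(x in D) f x = \int[mu]_(x in D) g x.
Proof.
move=> mD mf mg fg; congr fine; apply: ae_eq_integral => //.
- exact/measurable_EFinP.
- exact/measurable_EFinP.
- by apply: filterS fg => x h Dx; rewrite h.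
Qed.

Lemma ae_eq_integrable D f g : measurable D -> measurable_fun D f ->
  measurable_fun D g -> {ae mu, forall x, D x -> f x = g x} ->
  mu.-integrable D (EFin \o g) -> mu.-integrable D (EFin \o f).
Proof.
move=> mD mf mg fg /integrableP[_ ig]; apply/integrableP; split; first exact/measurable_EFinP.
rewrite (@ae_eq_integral _ _ _ mu D (fun x => `|(EFin \o g) x|%E))//.
- by apply: measurableT_comp => //; exact/measurable_EFinP.
- by apply: measurableT_comp => //; exact/measurable_EFinP.
- by apply: filterS fg => x h Dx /=; rewrite h.
Qed.

End real_integrals.

Section sigma_finite_wrapper.
Context d (T : measurableType d) (R : realType) (m : {measure set T -> \bar R}).
Hypothesis sf : sigma_finite setT m.

(** A copy of [m] under a name to which the hypothesis of sigma-finiteness can be attached as an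
    instance; Fubini's theorem is stated for bundled sigma-finite measures. *)
Definition bundle_sigma_finite of sigma_finite setT m : set T -> \bar R := m.
Local Notation n := (bundle_sigma_finite sf).

HB.instance Definition _ := isMeasure.Build _ _ _ n (measure0 m)
  (measure_ge0 m) (@measure_semi_sigma_additive _ _ _ m).
HB.instance Definition _ := Measure_isSigmaFinite.Build _ _ _ n sf.

End sigma_finite_wrapper.

Section fubini_real.
Context d1 d2 (T1 : measurableType d1) (T2 : measurableType d2) (R : realType).
Variables (m1 : {measure set T1 -> \bar R}) (m2 : {measure set T2 -> \bar R}).
Hypotheses (sf1 : sigma_finite setT m1) (sf2 : sigma_finite setT m2).

Let n1 : {sigma_finite_measure set T1 -> \bar R} := bundle_sigma_finite sf1.
Let n2 : {sigma_finite_measure set T2 -> \bar R} := bundle_sigma_finite sf2.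

Lemma tonelli_measure (f : T1 * T2 -> \bar R) : measurable_fun setT f ->
  (forall z, 0 <= f z)%E ->
  (\int[m1]_x \int[m2]_y f (x, y) = \int[m2]_y \int[m1]_x f (x, y))%E.
Proof. by move=> mf f0; exact: (@fubini_tonelli _ _ _ _ _ n1 n2). Qed.

Lemma tonelli_measurable (f : T1 * T2 -> \bar R) : measurable_fun setT f ->
  (forall z, 0 <= f z)%E -> measurable_fun setT (fun x => \int[m2]_y f (x, y))%E.
Proof. by move=> mf f0; exact: (@measurable_fun_fubini_tonelli_F _ _ _ _ _ n2). Qed.

Variables (f : T1 -> T2 -> R) (a : T1 -> R) (b : T2 -> R).
Hypotheses (mf : measurable_fun setT (fun z => f z.1 z.2))
  (ia : m1.-integrable setT (EFin \o a)) (ib : m2.-integrable setT (EFin \o b))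
  (fab : forall x y, `|f x y| <= a x * b y).

Lemma fubini_section x : m2.-integrable setT (EFin \o f x).
Proof.
apply: (@integrable_le _ _ _ _ _ _ (fun y => a x * b y)) => //.
- by have /= := measurableT_comp mf (pair1_measurable x).
- have := integrableZl measurableT (a x) ib; exact: eq_integrable.
Qed.

Let if12 : (n1 \x n2)%E.-integrable setT (fun z => (f z.1 z.2)%:E).
Proof.
apply/integrable12ltyP; first exact/measurable_EFinP.
have /integrableP[ma ia'] := ia; have /integrableP[mb ib'] := ib.
apply: (@le_lt_trans _ _ (\int[m1]_x (`|a x|%:E * \int[m2]_y `|b y|%:E))%E).
  apply: ge0_le_integral => //.
  - by move=> x _; exact: integral_ge0.
  - apply: (@tonelli_measurable (fun z => `|f z.1 z.2|%:E)) => //.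
    by apply/measurable_EFinP; exact: measurableT_comp.
  - apply: emeasurable_funM => //; apply/measurable_EFinP.
    by apply: measurableT_comp => //; exact/measurable_EFinP.
  - move=> x _ /=; rewrite -ge0_integralZl//; last first.
      by apply/measurable_EFinP; apply: measurableT_comp => //; exact/measurable_EFinP.
    apply: ge0_le_integral => //.
    + by apply/measurable_EFinP; apply: measurableT_comp => //; have := measurableT_comp mf (pair1_measurable x).
    + apply: emeasurable_funM => //; apply/measurable_EFinP.
      by apply: measurableT_comp => //; exact/measurable_EFinP.
    + move=> y _; rewrite -EFinM lee_fin; apply: le_trans (fab x y) _.
      by rewrite -normrM ler_norm.
rewrite ge0_integralZr//.
- by apply: lte_mul_pinfty => //; [exact: integral_ge0|rewrite ge0_fin_numE//; exact: integral_ge0].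
- by apply/measurable_EFinP; apply: measurableT_comp => //; exact/measurable_EFinP.
- exact: integral_ge0.
Qed.

(** The inner integral on the right stays extended, since at this point only the sections [f x] are
    known to be integrable; [fubini_Rintegral] treats the other sections by exchanging the roles of
    the variables. *)
Lemma fubini_swap :
  \int[m1]_x (\int[m2]_y f x y) =
  fine (\int[m2]_y \int[m1]_x (f x y)%:E)%E.
Proof.
rewrite -(@Fubini _ _ _ _ _ n1 n2 _ if12); congr fine.
apply: eq_integral => x _ /=; rewrite /Rintegral fineK//.
by apply: integrable_fin_num => //; exact: fubini_section.
Qed.

End fubini_real.

Lemma fubini_Rintegral d1 d2 (T1 : measurableType d1) (T2 : measurableType d2)
    (R : realType) (m1 : {measure set T1 -> \bar R}) (m2 : {measure set T2 -> \bar R})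
    (f : T1 -> T2 -> R) (a : T1 -> R) (b : T2 -> R) :
  sigma_finite setT m1 -> sigma_finite setT m2 ->
  measurable_fun setT (fun z => f z.1 z.2) ->
  m1.-integrable setT (EFin \o a) -> m2.-integrable setT (EFin \o b) ->
  (forall x y, `|f x y| <= a x * b y) ->
  \int[m1]_x (\int[m2]_y f x y) = \int[m2]_y (\int[m1]_x f x y).
Proof.
move=> s1 s2 mf ia ib fab; rewrite (fubini_swap s1 s2 mf ia ib fab); congr fine.
apply: eq_integral => y _ /=; rewrite /Rintegral fineK//.
apply: integrable_fin_num => //.
apply: (@fubini_section _ _ _ _ _ m1 (fun y x => f x y) b a) => //.
- have h : measurable_fun setT (fun z : T2 * T1 => (z.2, z.1)).
    by apply/measurable_fun_pairP; split; [exact: measurable_snd|exact: measurable_fst].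
  exact: measurableT_comp mf h.
- by move=> y' x; rewrite mulrC.
Qed.

(** * Functions of class C^n *)

Section lines.
Context {R : realType} {V : normedModType R}.
Implicit Types (f g : V -> R) (x v : V).

Lemma is_derive_line f x v (t df : R) : is_derive (x + t *: v) v f df ->
  is_derive t (1:R) (fun s : R => f (x + s *: v)) df.
Proof.
move=> [dx dE]; have E : (fun h : R => h^-1 *: (((fun s : R => f (x + s *: v)) \o shift t) (h *: 1)
     - f (x + t *: v))) =
   (fun h => h^-1 *: ((f \o shift (x + t *: v)) (h *: v) - f (x + t *: v))).
  by apply/funext => h /=; rewrite [h *: 1]mulr1 scalerDl [in RHS]addrCA.
by split; [rewrite /derivable E|rewrite /derive E].
Qed.

Lemma is_derive_along f x v (df : R) :
  is_derive (0:R) (1:R) (fun s : R => f (x + s *: v)) df -> is_derive x v f df.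
Proof.
move=> [dx dE]; have E : (fun h : R => h^-1 *: (((fun s : R => f (x + s *: v)) \o shift 0) (h *: 1)
     - f (x + 0 *: v))) =
   (fun h => h^-1 *: ((f \o shift x) (h *: v) - f x)).
  by apply/funext => h /=; rewrite [h *: 1]mulr1 addr0 scale0r addr0 [x + _]addrC.
by move: dx dE; rewrite /derivable /derive E.
Qed.

Lemma derivable_line_continuous f x v : (forall z, derivable f z v) ->
  continuous (fun s : R => f (x + s *: v)).
Proof.
move=> df s; apply/differentiable_continuous/derivable1_diffP.
by have [] := is_derive_line (derivableP (df (x + s *: v))).
Qed.

(** The segment is parametrized over [0, 1] with velocity [t *: v], so that [t] may have either
    sign. *)
Lemma MVT_line f x v (t : R) : (forall z, derivable f z v) ->
  exists2 c, 0 <= c <= 1 & f (x + t *: v) - f x = t * 'D_v f (x + (c * t) *: v).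
Proof.
move=> df; pose g (s : R) := f (x + s *: (t *: v)).
have D (s : R) : is_derive s (1:R) g (t * 'D_v f (x + (s * t) *: v)).
  rewrite (_ : g = (fun s : R => f (x + s *: v)) \o (fun s => s * t)); last first.
    by apply/funext => z; rewrite /g scalerA.
  rewrite mulrC; apply: is_derive1_comp.
    by apply: is_derive_line; exact: derivableP.
  rewrite (_ : (fun s => s * t) = t *: (id : R -> R)); last first.
    by apply/funext => z; rewrite mulrC.
  by rewrite -[X in is_derive _ _ _ X]mulr1; exact: is_deriveZ.
have C : continuous g.
  move=> s; apply/differentiable_continuous/derivable1_diffP.
  by have [] := D s.
have [c + E] := @MVT_segment R _ _ 0 1 ler01 (fun s _ => D s) (continuous_subspaceT C).
rewrite in_itv/= => c01; exists c => //.
by move: E; rewrite /g scale1r scale0r addr0 subr0 mulr1.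
Qed.

Lemma line_lipschitz f v (M : R) : (forall z, derivable f z v) ->
  (forall z, `|'D_v f z| <= M) ->
  forall x t, `|f (x + t *: v) - f x| <= M * `|t|.
Proof.
move=> df dM x t; have [c _ ->] := MVT_line x t df.
by rewrite normrM mulrC ler_wpM2r.
Qed.

End lines.

Section classC_theory.
Context {R : realType} {d : nat}.
Implicit Types (f g : 'rV[R]_d -> R) (x v : 'rV[R]_d) (i : 'I_d) (n : nat).

Lemma classC_continuous n f : classC n f -> continuous f.
Proof. by case: n => [|n] []. Qed.

Lemma classC_derivable n f i x : classC n.+1 f -> derivable f x (basis_vec i).
Proof. by case=> _ /(_ i) []. Qed.

Lemma classC_partial n f i : classC n.+1 f -> classC n (partial i f).
Proof. by case=> _ /(_ i) []. Qed.

Lemma classCS n f : classC n.+1 f -> classC n f.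
Proof.
elim: n f => [|n ih] f; first by case.
move=> [cf h]; split => // i; have [df cdf] := h i.
by split => //; exact: ih.
Qed.

Lemma partial_cst (c : R) i : partial i (fun _ : 'rV[R]_d => c) = fun=> 0.
Proof. by apply/funext => x; rewrite /partial derive_cst. Qed.

Lemma classC_cst n (c : R) : classC n (fun _ : 'rV[R]_d => c).
Proof.
elim: n c => [|n ih] c; split => //; try exact: cst_continuous.
by move=> i; split; [move=> x; exact: derivable_cst|rewrite partial_cst].
Qed.

Lemma partialD f g i : (forall x, derivable f x (basis_vec i)) ->
  (forall x, derivable g x (basis_vec i)) ->
  partial i (fun x => f x + g x) = fun x => partial i f x + partial i g x.
Proof. by move=> df dg; apply/funext => x; rewrite /partial -deriveD. Qed.

Lemma classC_add n f g : classC n f -> classC n g -> classC n (fun x => f x + g x).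
Proof.
elim: n f g => [|n ih] f g [cf df] [cg dg]; split => //;
  try by (move=> x; apply: continuousD; [exact: cf|exact: cg]).
move=> i; have [Df Cf] := df i; have [Dg Cg] := dg i.
split; first by move=> x; exact: derivableD.
by rewrite (partialD Df Dg); exact: ih.
Qed.

Lemma partialM f g i : (forall x, derivable f x (basis_vec i)) ->
  (forall x, derivable g x (basis_vec i)) ->
  partial i (fun x => f x * g x) = fun x => f x * partial i g x + g x * partial i f x.
Proof. by move=> df dg; apply/funext => x; rewrite /partial; exact: deriveM. Qed.

Lemma classC_mul n f g : classC n f -> classC n g -> classC n (fun x => f x * g x).
Proof.
elim: n f g => [|n ih] f g hf hg; split => //;
  try by (move=> x; apply: continuousM; [exact: (classC_continuous hf)|exact: (classC_continuous hg)]).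
have hf' := classCS hf; have hg' := classCS hg.
case: hf hg => [cf df] [cg dg].
move=> i; have [Df Cf] := df i; have [Dg Cg] := dg i.
split; first by move=> x; exact: derivableM.
rewrite (partialM Df Dg).
exact: (classC_add (ih _ _ hf' Cg) (ih _ _ hg' Cf)).
Qed.

Lemma classC_scale n f (c : R) : classC n f -> classC n (fun x => c * f x).
Proof. by apply: classC_mul; exact: classC_cst. Qed.

Lemma partialZ f i (c : R) : (forall x, derivable f x (basis_vec i)) ->
  partial i (fun x => c * f x) = fun x => c * partial i f x.
Proof.
move=> df; have dc z : derivable (fun _ : 'rV[R]_d => c) z (basis_vec i) by exact: derivable_cst.
rewrite (partialM dc df); apply/funext => x.
by rewrite partial_cst mulr0 addr0.
Qed.

Lemma classC_opp n f : classC n f -> classC n (fun x => - f x).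
Proof.
move=> /(classC_scale (-1)); rewrite (_ : (fun _ => _) = (fun x => - f x))//.
by apply/funext => x; rewrite mulN1r.
Qed.

Lemma classC_sub n f g : classC n f -> classC n g -> classC n (fun x => f x - g x).
Proof. by move=> hf hg; apply: classC_add => //; exact: classC_opp. Qed.

Lemma partialB f g i : (forall x, derivable f x (basis_vec i)) ->
  (forall x, derivable g x (basis_vec i)) ->
  partial i (fun x => f x - g x) = fun x => partial i f x - partial i g x.
Proof. by move=> df dg; apply/funext => x; rewrite /partial -deriveB. Qed.

Lemma classC_sum n (I : Type) (r : seq I) (P : pred I) (F : I -> 'rV[R]_d -> R) :
  (forall j, classC n (F j)) -> classC n (fun x => \sum_(j <- r | P j) F j x).
Proof.
move=> hF; elim: r => [|j r ih].
  rewrite (_ : (fun _ => _) = fun=> 0); first exact: classC_cst.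
  by apply/funext => x; rewrite big_nil.
rewrite (_ : (fun _ => _) = if P j then (fun x => F j x + \sum_(j <- r | P j) F j x)
   else (fun x => \sum_(j <- r | P j) F j x)).
  by case: ifP => _ //; exact: classC_add.
by apply/funext => x; rewrite big_cons; case: ifP.
Qed.

Lemma classC_prod n (I : Type) (r : seq I) (P : pred I) (F : I -> 'rV[R]_d -> R) :
  (forall j, classC n (F j)) -> classC n (fun x => \prod_(j <- r | P j) F j x).
Proof.
move=> hF; elim: r => [|j r ih].
  rewrite (_ : (fun _ => _) = fun=> 1); first exact: classC_cst.
  by apply/funext => x; rewrite big_nil.
rewrite (_ : (fun _ => _) = if P j then (fun x => F j x * \prod_(j <- r | P j) F j x)
   else (fun x => \prod_(j <- r | P j) F j x)).
  by case: ifP => _ //; exact: classC_mul.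
by apply/funext => x; rewrite big_cons; case: ifP.
Qed.

Lemma is_derive_affine f (a : R) (w : 'rV[R]_d) x v (df : R) : is_derive (a *: x + w) v f df ->
  is_derive x v (fun z : 'rV[R]_d => f (a *: z + w)) (a * df).
Proof.
move=> h; apply: is_derive_along.
rewrite (_ : (fun _ => _) = (fun s => f ((a *: x + w) + s *: v)) \o (fun s : R => s * a)); last first.
  apply/funext => s /=; congr f; rewrite scalerDr scalerA mulrC.
  by rewrite -!addrA; congr (_ + _); rewrite addrC.
rewrite mulrC; apply: is_derive1_comp.
  by rewrite mul0r; apply: is_derive_line; rewrite scale0r addr0.
rewrite (_ : (fun s => s * a) = a *: (id : R -> R)); last first.
  by apply/funext => s; rewrite mulrC.
rewrite -[X in is_derive _ _ _ X]mulr1; exact: is_deriveZ.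
Qed.

Lemma partial_affine f (a : R) (w : 'rV[R]_d) i : (forall x, derivable f x (basis_vec i)) ->
  partial i (fun z : 'rV[R]_d => f (a *: z + w)) = fun z => a * partial i f (a *: z + w).
Proof.
move=> df; apply/funext => x.
by have [] := is_derive_affine (derivableP (df (a *: x + w))).
Qed.

Lemma continuous_affine f (a : R) (w : 'rV[R]_d) : continuous f -> continuous (fun z : 'rV[R]_d => f (a *: z + w)).
Proof.
move=> cf x; apply: (@continuous_comp _ _ _ (fun z : 'rV[R]_d => a *: z + w) f); last exact: cf.
by apply: continuousD; [exact: scaler_continuous|exact: cst_continuous].
Qed.

Lemma classC_affine n f (a : R) (w : 'rV[R]_d) : classC n f -> classC n (fun z : 'rV[R]_d => f (a *: z + w)).
Proof.
elim: n f => [|n ih] f [cf df]; split => //; try exact: continuous_affine.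
move=> i; have [Df Cf] := df i; split.
  by move=> x; have [] := is_derive_affine (derivableP (Df (a *: x + w))).
by rewrite partial_affine//; apply: classC_scale; exact: ih.
Qed.

Lemma classC_shift n f (w : 'rV[R]_d) : classC n f -> classC n (fun z : 'rV[R]_d => f (z + w)).
Proof.
move=> /(classC_affine 1 w); rewrite (_ : (fun _ => _) = (fun z : 'rV[R]_d => f (z + w)))//.
by apply/funext => z; rewrite scale1r.
Qed.

Lemma partial_shift f (w : 'rV[R]_d) i : (forall x, derivable f x (basis_vec i)) ->
  partial i (fun z : 'rV[R]_d => f (z + w)) = fun z => partial i f (z + w).
Proof.
move=> df; have := @partial_affine f 1 w i df.
under eq_fun do rewrite scale1r; move=> ->.
by apply/funext => z; rewrite scale1r mul1r.
Qed.

Lemma partial_near f g x i : {near x, f =1 g} -> partial i f x = partial i g x.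
Proof. by move=> fg; apply: near_eq_derive. Qed.

Lemma partial_in_open (U : set 'rV[R]_d) f g x i : open U -> U x ->
  (forall z, U z -> f z = g z) -> partial i f x = partial i g x.
Proof.
move=> oU Ux fg; apply: partial_near.
by apply: filterS (open_nbhs_nbhs (conj oU Ux)) => z /fg.
Qed.

Lemma partial_support f (N : R) i : (forall x, N < `|x| -> f x = 0) ->
  forall x, N < `|x| -> partial i f x = 0.
Proof.
move=> fN x Nx; rewrite (@partial_in_open [set z | N < `|z|] f (fun=> 0)) ?partial_cst//.
rewrite (_ : [set z | N < `|z|] = (fun z => `|z|) @^-1` [set r | N < r])//.
by apply: open_comp; [move=> z _; exact: norm_continuous|exact: open_gt].
Qed.

Lemma compact_closed_ball (N : R) : compact [set x : 'rV[R]_d | `|x| <= N].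
Proof.
apply: bounded_closed_compact.
  exists N; split; first by rewrite num_real.
  by move=> M NM x /= xN; exact: le_trans xN (ltW NM).
rewrite (_ : [set x | `|x| <= N] = (fun x : 'rV[R]_d => `|x|) @^-1` [set r | r <= N])//.
by apply: closed_comp; [move=> z _; exact: norm_continuous|exact: closed_le].
Qed.

Lemma continuous_bounded_ball f (N : R) : continuous f ->
  exists2 K : R, 0 < K & forall x, `|x| <= N -> `|f x| <= K.
Proof.
move=> cf; have /compact_bounded [K [_ hK]] :=
  continuous_compact (continuous_subspaceT cf) (@compact_closed_ball N).
exists (`|K| + 1) => [|x xN]; first by rewrite ltr_wpDl.
apply: (hK (`|K| + 1)); first by apply: le_lt_trans (ler_norm K) _; rewrite ltrDl.
by exists x.
Qed.

Lemma continuous_bounded_support f (N : R) : continuous f ->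
  (forall x, N < `|x| -> f x = 0) ->
  exists2 K : R, 0 < K & forall x, `|f x| <= K.
Proof.
move=> cf fN; have [K K0 hK] := continuous_bounded_ball N cf.
exists K => // x; have [/hK//|/fN ->] := leP `|x| N.
by rewrite normr0 ltW.
Qed.

Lemma norm_basis_vec i : `|basis_vec i : 'rV[R]_d| <= 1.
Proof.
apply: rV_norm_le => // j; rewrite mxE eqxx /=.
by case: eqP => _; rewrite ?normr1 ?normr0.
Qed.

(** Vertices of the path from 0 to [v] that changes one coordinate at a time. *)
Definition truncate (k : nat) v : 'rV[R]_d :=
  \row_i (if (i < k)%N then v ord0 i else 0).

Lemma norm_truncateD k v i (s : R) : k = i -> `|s| <= `|v ord0 i| ->
  `|truncate k v + s *: basis_vec i| <= `|v|.
Proof.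
move=> -> sv; apply: rV_norm_le => // j; rewrite !mxE eqxx /=.
case: ltnP => ji; last first.
  rewrite add0r; case: eqP => [_|_]; last by rewrite mulr0 normr0.
  by rewrite mulr1; apply: le_trans sv _; exact: coord_le_norm.
by rewrite (_ : (j == i) = false) ?mulr0 ?addr0 ?coord_le_norm// -val_eqE /= ltn_eqF.
Qed.

(** Mean value theorem along each edge of the coordinate path, then a telescoping sum. Only partial
    derivatives enter, so total differentials never have to be considered. *)
Lemma increment_partial f x v : (forall i z, derivable f z (basis_vec i)) ->
  exists xi : 'I_d -> 'rV[R]_d, (forall i, `|xi i - x| <= `|v|) /\
    f (x + v) - f x = \sum_i v ord0 i * partial i f (xi i).
Proof.
move=> df.
have H i : exists z, `|z - x| <= `|v| /\
  f (x + truncate i.+1 v) - f (x + truncate i v) = v ord0 i * partial i f z.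
  have [c /andP[c0 c1] E] := MVT_line (x + truncate i v) (v ord0 i) (df i).
  have sv : `|c * v ord0 i| <= `|v ord0 i|.
    by rewrite normrM ger0_norm// ler_piMl.
  exists (x + truncate i v + (c * v ord0 i) *: basis_vec i); split.
    rewrite [x + _]addrC -[_ + x + _]addrA [x + _]addrC addrA addrK.
    exact: norm_truncateD.
  rewrite -E; congr (f _ - _); rewrite -addrA; congr (_ + _).
  apply/rowP => j; rewrite !mxE eqxx /= ltnS leq_eqVlt.
  have [->|/eqP ij] := eqVneq j i; first by rewrite eqxx /= ltnn mulr1 add0r.
  rewrite (_ : (val j == val i) = false) /=; last by apply/eqP => /val_inj.
  by rewrite mulr0 addr0.
have [xi hxi] := choice H; exists xi; split; first by move=> i; have [] := hxi i.
rewrite -(eq_bigr _ (fun i _ => (hxi i).2)).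
rewrite -(big_mkord xpredT (fun k => f (x + truncate k.+1 v) - f (x + truncate k v))).
rewrite telescope_sumr//; congr (f _ - f _).
  by congr (_ + _); apply/rowP => i; rewrite mxE ltn_ord.
by rewrite -[LHS]addr0; congr (_ + _); apply/rowP => i; rewrite !mxE ltn0.
Qed.

End classC_theory.

(** * Integrals of partial derivatives *)

Section integral_of_derivative.
Context {R : realType} {d : nat}.
Variable mu : {measure set 'rV[R]_d -> \bar R}.
Hypothesis hmu : is_lebesgue mu.
Implicit Types (f : 'rV[R]_d -> R).

Lemma measurable_closed_ball (N : R) : measurable [set x : 'rV[R]_d | `|x| <= N].
Proof.
apply: closed_measurable_rV; apply: compact_closed; first exact: norm_hausdorff.
exact: compact_closed_ball.
Qed.

Lemma integrable_ball_indic (N M : R) :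
  mu.-integrable setT (EFin \o (fun x => M * \1_[set x : 'rV[R]_d | `|x| <= N] x)).
Proof.
apply: (@integrable_bounded_support _ _ _ hmu _ `|M| N).
- apply: measurable_funM => //; apply: measurable_indic; exact: measurable_closed_ball.
- by move=> x; rewrite normrM ler_piMr// indicE; case: (_ \in _); rewrite ?normr1 ?normr0.
- move=> x Nx; rewrite indicE memNset ?mulr0//= => h.
  by have := le_lt_trans h Nx; rewrite ltxx.
Qed.

(* Difference quotients have integral 0 by translation invariance. *)
Lemma integral_partial_eq0 f i (M N K : R) : measurable_fun setT f ->
  (forall x, `|f x| <= K) -> (forall x, N < `|x| -> f x = 0) ->
  (forall x, derivable f x (basis_vec i)) -> (forall x, `|partial i f x| <= M) ->
  \int[mu]_x partial i f x = 0.
Proof.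
move=> mf fK fN df dM.
pose h n : R := n.+1%:R^-1.
have h0 n : 0 < h n by rewrite invr_gt0.
have hle n : h n <= 1 by rewrite invf_le1// ler1n.
pose D n x := (h n)^-1 * (f (x + h n *: basis_vec i) - f x).
have mD n : measurable_fun setT (D n).
  apply: measurable_funM => //; apply: measurable_funB => //.
  by apply: (measurableT_comp mf); exact: measurable_shift.
have cD x : D n x @[n --> \oo] --> partial i f x.
  have /cvg_ex[l hl] := df x.
  have E : partial i f x = l by exact/cvg_lim.
  rewrite E; have /cvgr_dnbhsP /(_ h) := hl.
  rewrite (_ : D^~ x = fun n => (h n)^-1 *: (f (h n *: basis_vec i + x) - f x)).
    apply.
    by split; [move=> n; exact: lt0r_neq0|exact: cvg_harmonic].
  by apply/funext => n; rewrite /D [x + _]addrC.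
(* Since [h n <= 1], all quotients vanish outside the ball of radius [|N| + 1]; inside, the mean
   value theorem bounds them by [M]. *)
have dom n x : `|D n x| <= `|M| * \1_[set x : 'rV[R]_d | `|x| <= `|N| + 1] x.
  rewrite indicE; case: (boolP (x \in _)) => [_|].
    rewrite mulr1 /D normrM gtr0_norm ?invr_gt0// ler_pdivrMl// mulrC.
    apply: le_trans (line_lipschitz df dM _ _) _.
    by rewrite [X in _ * X]gtr0_norm// ler_wpM2r ?ler_norm// ltW.
  rewrite notin_setE /= => /negP; rewrite -ltNge => Nx.
  rewrite mulr0 normr_le0 /D fN; last first.
    have := ler_distD 0 (x + h n *: basis_vec i) x; rewrite subr0 sub0r normrN.
    rewrite addrAC subrr add0r => X.
    have Y : `|x| <= `|x + h n *: basis_vec i| + 1.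
      rewrite -{1}(addrK (h n *: basis_vec i) x); apply: le_trans (ler_normB _ _) _.
      rewrite lerD2l normrZ gtr0_norm//.
      by apply: le_trans (ler_wpM2l (ltW (h0 n)) (norm_basis_vec i)) _; rewrite mulr1.
    by apply: le_lt_trans (ler_norm N) _; rewrite -(ltrD2r 1); exact: lt_le_trans Nx Y.
  rewrite fN ?subrr ?mulr0//; apply: le_lt_trans (ler_norm N) _.
  by apply: le_lt_trans Nx; rewrite lerDl.
have int_f : mu.-integrable setT (EFin \o f) by exact: integrable_bounded_support hmu _ _ _ mf fK fN.
have mfs n : measurable_fun setT (fun x : 'rV[R]_d => f (x + h n *: basis_vec i)).
  by apply: (measurableT_comp mf); exact: measurable_shift.
have int_fs n : mu.-integrable setT (EFin \o (fun x : 'rV[R]_d => f (x + h n *: basis_vec i))).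
  have [H _] := @integrable_image _ _ _ _ R _ (@measurable_shift R d (h n *: basis_vec i)) mu mu
    (fun A mA => lebesgue_shift hmu (h n *: basis_vec i) mA) (EFin \o f) ltac:(exact/measurable_EFinP).
  exact: H.
have int0 n : \int[mu]_x D n x = 0.
  rewrite /D RintegralZl//; last first.
    by have := integrableB measurableT (int_fs n) int_f; exact: eq_integrable.
  by rewrite RintegralB// (Rintegral_shift hmu _ mf) subrr mulr0.
have := @Rintegral_dominated _ _ _ mu setT D (partial i f)
   (fun x => `|M| * \1_[set x : 'rV[R]_d | `|x| <= `|N| + 1] x) measurableT mD.
have mp : measurable_fun setT (partial i f).
  by apply: (measurable_fun_cvg mD) => x _; exact: cD.
move=> /(_ mp (aeW _ (fun x _ => cD x)) (integrable_ball_indic _ _) (fun n x _ => dom n x)).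
under eq_fun do rewrite int0.
by move=> H; have := cvg_unique _ H (cvg_cst _); exact.
Qed.

End integral_of_derivative.

(** * Mollification *)

(** Serves at points where a function is pasted from two formulas: for [flat] at 0, and on the
    interface for a function multiplied by an indicator. *)
Lemma is_derive0_dominated (R : realType) (V : normedModType R) (f g : V -> R) (x v : V) :
  (forall z, `|f z - f x| <= `|g z - g x|) -> is_derive x v g 0 -> is_derive x v f 0.
Proof.
move=> fg [dg g0].
have c0 : (fun h : R => h^-1 *: ((f \o shift x) (h *: v) - f x)) @ 0^' --> (0 : R).
  have /cvg_ex[l hl] := dg.
  have l0 : l = 0 by rewrite -g0; apply/esym/cvg_lim.
  rewrite l0 in hl; move/cvgrPdist_le : hl => hl; apply/cvgrPdist_le => e e0.
  apply: filterS (hl e e0) => h; rewrite !sub0r !normrN; apply: le_trans.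
  by rewrite !normrZ; apply: ler_wpM2l => //; exact: fg.
by split; [apply/cvg_ex; exists 0|apply/cvg_lim].
Qed.

Section flat_function.
Context {R : realType}.
Implicit Types (x : R) (k : nat).

(** The function [x^-k exp(-1/x)], extended by 0. The whole family in [k] is considered because its
    linear span is stable under differentiation, which makes smoothness an induction on the order
    for all [k] at once. *)
Definition flat k x : R := if 0 < x then x^-1 ^+ k * expR (- x^-1) else 0.

Lemma flat_ge0 k x : 0 <= flat k x.
Proof.
rewrite /flat; case: ifP => // x0; rewrite mulr_ge0 ?expR_ge0// exprn_ge0//.
by rewrite invr_ge0 ltW.
Qed.

Lemma flat0_gt0 x : 0 < x -> 0 < flat 0 x.
Proof. by move=> x0; rewrite /flat x0 expr0 mul1r expR_gt0. Qed.

Lemma flat_le0 k x : x <= 0 -> flat k x = 0.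
Proof. by move=> x0; rewrite /flat ltNge x0. Qed.

(** From [exp y >= y^(k+2) / (k+2)!] at [y = 1/x]. A quadratic bound forces the derivative at 0 to
    vanish. *)
Lemma flat_bound k x : flat k x <= k.+2`!%:R * x ^+ 2.
Proof.
rewrite /flat; case: ifP => [x0|_]; last by rewrite mulr_ge0 ?sqr_ge0.
have y0 : 0 < x^-1 by rewrite invr_gt0.
have := @expR_ge1Dxn R _ k.+1 (ltW y0).
rewrite expRN ler_pdivrMr ?expR_gt0// => H.
have : x^-1 ^+ k.+2 / k.+2`!%:R <= expR x^-1 by apply: le_trans H; rewrite lerDr.
rewrite ler_pdivrMr ?ltr0n ?fact_gt0// => H'.
have -> : x^-1 ^+ k = x^-1 ^+ k.+2 * x ^+ 2.
  by rewrite -addn2 exprD -mulrA -exprMn mulVf ?gt_eqF// expr1n mulr1.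
by rewrite [leRHS]mulrAC ler_wpM2r ?sqr_ge0// mulrC.
Qed.

Lemma is_derive_line1 (a b t : R) : is_derive t (1:R) (fun s : R => b + a * s) a.
Proof.
have hZ : is_derive t (1:R) (a *: (id : R -> R)) (a *: 1) by exact: is_deriveZ.
have := is_deriveD (is_derive_cst b t (1:R)) hZ.
by rewrite add0r [_ *: 1]mulr1.
Qed.

Lemma is_derive_flat k x :
  is_derive x 1 (flat k) (flat k.+2 x - k%:R * flat k.+1 x).
Proof.
have [x0|x0|<-] := ltgtP 0 x; last first.
- rewrite !flat_le0// mulr0 subr0.
  apply: (@is_derive0_dominated _ _ _ (fun z : R => k.+2`!%:R * z ^+ 2)).
    have H (z : R) : `|flat k z - flat k 0| <= `|k.+2`!%:R * z ^+ 2 - k.+2`!%:R * 0 ^+ 2|.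
      rewrite [flat k 0]flat_le0// expr0n mulr0 !subr0 ger0_norm ?flat_ge0//.
      by apply: le_trans (flat_bound k z) (ler_norm _).
    exact: H.
  rewrite (_ : (fun z => _) = k.+2`!%:R *: (id ^+ 2)); last by apply/funext.
  apply: is_derive_eq; rewrite /= expr1 mulr0 scale0r scaler0//.
- rewrite !flat_le0 ?ltW// mulr0 subr0.
  have E : {near x, cst 0 =1 flat k}.
    near=> z; rewrite /= flat_le0// ltW//.
    by near: z; exact: lt_nbhsl.
  exact: near_eq_is_derive E (is_derive_cst _ _ _).
have E : {near x, (fun z => z^-1 ^+ k * expR (- z^-1)) =1 flat k}.
  near=> z; rewrite /flat ifT//.
  by near: z; exact: lt_nbhsr.
apply: near_eq_is_derive E _.
rewrite /flat x0.
have xn0 : x != 0 by rewrite gt_eqF.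
have dV : is_derive x 1 (fun z : R => z^-1) (- x ^- 2).
  split; first exact: derivableV (@derivable_id _ _ x 1).
  by rewrite (deriveV xn0 (@derivable_id _ _ x 1)) derive_id [_ *: 1]mulr1.
have dE : is_derive x 1 (fun z : R => expR (- z^-1)) (expR (- x^-1) * x ^- 2).
  apply: (@is_derive1_comp _ expR (fun z => - z^-1)).
  by rewrite -[X in is_derive _ _ _ X]opprK; exact: is_deriveN.
have dX : is_derive x 1 (fun z : R => z^-1 ^+ k) (k%:R * x^-1 ^+ k.-1 * - x ^- 2).
  rewrite (_ : (fun _ => _) = (fun z => z^-1) ^+ k); first exact: is_deriveX.
  by apply/funext => z; rewrite fctE.
have := is_deriveM dX dE.
rewrite (_ : (fun z => z^-1 ^+ k) * (fun z => expR (- z^-1)) =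
  (fun z => z^-1 ^+ k * expR (- z^-1)))//.
move=> /is_derive_eq; apply; rewrite /GRing.scale /=; case: k {dX} => [|k].
  by rewrite !mul0r !mulr0 addr0 subr0 !expr0 mul1r exprVn mulrC.
by rewrite succnK !exprS; field.
Unshelve. all: by end_near. Qed.

Lemma continuous_flat k : continuous (flat k).
Proof.
move=> x; apply/differentiable_continuous/derivable1_diffP.
by have [] := is_derive_flat k x.
Qed.

End flat_function.

Section bump.
Context {R : realType} {d : nat}.
Implicit Types (x y v : 'rV[R]_d) (i j : 'I_d).

Lemma is_derive_flat_coord k (a b : R) i j x :
  is_derive x (basis_vec i) (fun z : 'rV[R]_d => flat k (a * z ord0 j + b))
   (a * (i == j)%:R *
     (flat k.+2 (a * x ord0 j + b) - k%:R * flat k.+1 (a * x ord0 j + b))).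
Proof.
apply: is_derive_along.
rewrite (_ : (fun _ => _) = flat k \o (fun s : R => (a * x ord0 j + b) + a * (i == j)%:R * s)); last first.
  by apply/funext => s; rewrite /= !mxE eqxx /= eq_sym; congr flat; ring.
rewrite [X in is_derive _ _ _ X]mulrC; apply: is_derive1_comp.
  by rewrite mulr0 addr0; exact: is_derive_flat.
exact: is_derive_line1.
Qed.

Lemma classC_flat_coord n k (a b : R) j :
  classC n (fun z : 'rV[R]_d => flat k (a * z ord0 j + b)).
Proof.
elim: n k => [|n ih] k; split => //;
  try by move=> x; apply: (@continuous_comp _ _ _ (fun z : 'rV[R]_d => a * z ord0 j + b) (flat k));
    [apply: continuousD; [apply: continuousM; [exact: cst_continuous|exact: continuous_coord]|exact: cst_continuous]
    |exact: continuous_flat].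
move=> i; split; first by move=> x; have [] := is_derive_flat_coord k a b i j x.
rewrite (_ : partial i _ = fun x => a * (i == j)%:R *
     (flat k.+2 (a * x ord0 j + b) - k%:R * flat k.+1 (a * x ord0 j + b))).
  by apply: classC_scale; apply: classC_sub => //; exact: classC_scale.
by apply/funext => x; have [] := is_derive_flat_coord k a b i j x.
Qed.

(** A product over the coordinates: smoothness is that of products, and the support is the unit ball
    of the sup norm, the norm of row vectors. *)
Definition bump x : R :=
  \prod_(i < d) (flat 0 (1 * x ord0 i + 1) * flat 0 (- 1 * x ord0 i + 1)).

Lemma classC_bump n : classC n bump.
Proof. by apply: classC_prod => i; apply: classC_mul; exact: classC_flat_coord. Qed.

Lemma bump_ge0 x : 0 <= bump x.
Proof. by apply: prodr_ge0 => i _; rewrite mulr_ge0// flat_ge0. Qed.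

Lemma bump_gt0 x : `|x| < 1 -> 0 < bump x.
Proof.
move=> x1; apply: prodr_gt0 => i _.
have := le_lt_trans (coord_le_norm x i) x1; rewrite ltr_norml => /andP[a b].
by rewrite mulr_gt0// flat0_gt0//; lra.
Qed.

Lemma bump_support x : 1 <= `|x| -> bump x = 0.
Proof.
move=> x1; have [i] : exists i, 1 <= `|x ord0 i|.
  apply: contrapT => /forallNP h; have : `|x| < 1; last by rewrite ltNge x1.
  by apply: rV_norm_lt => // i; rewrite ltNge; apply/negP/h.
rewrite ler_normr => xi; rewrite /bump (bigD1 i)//=.
case/orP: xi => xi; first by rewrite [flat 0 (- 1 * _ + 1)]flat_le0 ?mulr0 ?mul0r//; lra.
by rewrite [flat 0 (1 * _ + 1)]flat_le0 ?mulr0 ?mul0r//; lra.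
Qed.

End bump.

Section mollification.
Context {R : realType} {d : nat}.
Variable mu : {measure set 'rV[R]_d -> \bar R}.
Hypothesis hmu : is_lebesgue mu.
Implicit Types (x y v : 'rV[R]_d) (i j : 'I_d) (V phi : 'rV[R]_d -> R).

Lemma test_functionP phi : test_function phi <->
  (forall n, classC n phi) /\ exists N, forall x, N < `|x| -> phi x = 0.
Proof.
split=> -[hphi].
  move=> [K /compact_bounded [N [_ hN]] hK]; split => //.
  exists (`|N| + 1) => x Nx; apply: hK => Kx.
  have : `|x| <= `|N| + 1.
    by apply: (hN (`|N| + 1)) => //; apply: le_lt_trans (ler_norm N) _; rewrite ltrDl.
  by rewrite leNgt Nx.
move=> [N hN]; split => //; exists [set x | `|x| <= N].
  exact: compact_closed_ball.
by move=> x /= /negP; rewrite -ltNge; exact: hN.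
Qed.

(** A correlation rather than a convolution: at fixed [x] the kernel is a translate of [phi], and
    each derivative in [x] falls on [phi] with a minus sign. *)
Definition smear V phi x : R := \int[mu]_y (V y * phi (y - x)).

Section smear_theory.
Variables (V : 'rV[R]_d -> R) (N M : R).
Hypotheses (mV : measurable_fun setT V) (VM : forall x, `|V x| <= M)
  (VN : forall x, N < `|x| -> V x = 0).

Lemma smear_integrand_measurable phi x : continuous phi ->
  measurable_fun setT (fun y => V y * phi (y - x)).
Proof.
move=> cphi; apply: measurable_funM => //.
apply: (measurableT_comp (continuous_measurable_rV cphi)); exact: measurable_shift.
Qed.

Lemma smear_integrable phi (K : R) x : continuous phi -> (forall z, `|phi z| <= K) ->
  mu.-integrable setT (EFin \o (fun y => V y * phi (y - x))).
Proof.
move=> cphi phiK; apply: (@integrable_bounded_support _ _ _ hmu _ (M * K) N).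
- exact: smear_integrand_measurable.
- by move=> y; rewrite normrM ler_pM.
- by move=> y /VN ->; rewrite mul0r.
Qed.

Lemma smear_V_integrable : mu.-integrable setT (EFin \o V).
Proof. exact: integrable_bounded_support hmu _ _ _ mV VM VN. Qed.

Lemma lipschitz_partial phi (K : R) : (forall i z, derivable phi z (basis_vec i)) ->
  (forall i z, `|partial i phi z| <= K) ->
  forall x v, `|phi (x + v) - phi x| <= d%:R * K * `|v|.
Proof.
move=> dphi phiK x v; have [xi [_ ->]] := increment_partial x v dphi.
apply: le_trans (ler_norm_sum _ _ _) _.
apply: (@le_trans _ _ (\sum_(i < d) (K * `|v|))).
  by apply: ler_sum => i _; rewrite normrM mulrC ler_pM// coord_le_norm.
by rewrite sumr_const card_ord -mulrA mulr_natl.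
Qed.

Lemma smear_continuous phi (K K1 : R) : continuous phi -> (forall z, `|phi z| <= K) ->
  (forall i z, derivable phi z (basis_vec i)) ->
  (forall i z, `|partial i phi z| <= K1) -> continuous (smear V phi).
Proof.
move=> cphi phiK dphi phiK1 x.
apply/(@cvgrPdist_le _ _ _ (nbhs (x : 'rV[R]_d)) _ (smear V phi)) => e e0.
pose C := d%:R * K1 * \int[mu]_y `|V y|.
have iV : mu.-integrable setT (EFin \o (fun y => `|V y|)).
  exact: (integrable_norm smear_V_integrable).
have H z : `|smear V phi x - smear V phi z| <= C * `|x - z|.
  rewrite /smear -RintegralB//; [|exact: smear_integrable cphi phiK..].
  apply: le_trans (le_normr_Rintegral _ _) _ => //.
    have := integrableB measurableT (smear_integrable x cphi phiK) (smear_integrable z cphi phiK).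
    exact: eq_integrable.
  have -> : C * `|x - z| = \int[mu]_y (d%:R * K1 * `|x - z| * `|V y|).
    by rewrite RintegralZl// /C mulrAC.
  apply: le_Rintegral => //.
  - apply: (integrable_norm (f := fun y => V y * phi (y - x) - V y * phi (y - z))).
    have := integrableB measurableT (smear_integrable x cphi phiK) (smear_integrable z cphi phiK).
    exact: eq_integrable.
  - have := integrableZl measurableT (d%:R * K1 * `|x - z|) iV; exact: eq_integrable.
  move=> y _; rewrite -mulrBr normrM mulrC ler_wpM2r//.
  have -> : y - x = (y - z) + (z - x) by rewrite addrA subrK.
  apply: le_trans (lipschitz_partial dphi phiK1 _ _) _.
  by rewrite distrC.
have C0 : `|C| + 1 > 0 by rewrite ltr_wpDl.
have r0 : 0 < e / (`|C| + 1) by rewrite divr_gt0.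
apply: filterS (nbhsx_ballx x _ r0) => z; rewrite -ball_normE /ball_/= => xz.
apply: le_trans (H z) _.
apply: (@le_trans _ _ ((`|C| + 1) * `|x - z|)).
  by rewrite ler_wpM2r// (le_trans (ler_norm C))// lerDl.
by rewrite mulrC -ler_pdivlMr// ltW.
Qed.

(** Differentiation under the integral along the line through [x], dominated by [K1 |V|]; []-1, 1[]
    is just a neighbourhood of the parameter 0. *)
Lemma smear_is_derive phi (K K1 : R) i x : continuous phi -> (forall z, `|phi z| <= K) ->
  (forall z, derivable phi z (basis_vec i)) ->
  (forall z, `|partial i phi z| <= K1) ->
  is_derive x (basis_vec i) (smear V phi) (smear V (fun z => - partial i phi z) x).
Proof.
move=> cphi phiK dphi phiK1; apply: is_derive_along.
pose f (s : R) y := V y * phi (y - (x + s *: basis_vec i)).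
have df (s : R) y : is_derive s (1:R) (f^~ y) (V y * - partial i phi (y - (x + s *: basis_vec i))).
  have h : is_derive s (1:R) (fun s : R => phi (y - (x + s *: basis_vec i)))
      (- partial i phi (y - (x + s *: basis_vec i))).
    have h1 : is_derive (-1 *: (x + s *: basis_vec i) + y) (basis_vec i) phi
       (partial i phi (y - (x + s *: basis_vec i))).
      by rewrite scaleN1r addrC; exact: derivableP.
    have := is_derive_line (is_derive_affine h1); rewrite mulN1r.
    rewrite (_ : (fun s => phi (-1 *: (x + s *: basis_vec i) + y)) =
      (fun s => phi (y - (x + s *: basis_vec i))))//.
    by apply/funext => t; rewrite scaleN1r addrC.
  by have := is_deriveM (is_derive_cst (V y) s (1:R)) h; rewrite scaler0 addr0.
have E s y : partial1of2 f s y = V y * - partial i phi (y - (x + s *: basis_vec i)).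
  by rewrite partial1of2E; have [] := df s y.
have I0 : (`]-1, 1[%classic : set R) 0 by rewrite /= in_itv/=; apply/andP; split; lra.
have intf (s : R) : `]-1, 1[%classic s -> mu.-integrable setT (EFin \o f s).
  by move=> _; exact: smear_integrable cphi phiK.
have derf (s : R) y : `]-1, 1[%classic s -> setT y -> derivable (f^~ y) s 1.
  by move=> _ _; have [] := df s y.
pose G y := K1 * `|V y|.
have intG : mu.-integrable setT (EFin \o G).
  have := integrableZl measurableT K1 (integrable_norm smear_V_integrable).
  exact: eq_integrable.
have K10 : 0 <= K1 by apply: le_trans (phiK1 0).
have G0 y : 0 <= G y by rewrite mulr_ge0.
have Gub (s : R) y : `]-1, 1[%classic s -> setT y -> `|partial1of2 f s y| <= G y.
  by move=> _ _; rewrite E normrM normrN /G mulrC ler_wpM2r.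
have D1 := derivable_under_integral measurableT I0 intf derf G0 intG Gub.
have D2 := differentiation_under_integral measurableT I0 intf derf G0 intG Gub.
split; first exact: D1.
rewrite -derive1E [LHS]D2; apply: eq_Rintegral => y _.
by rewrite E scale0r addr0.
Qed.

(** The induction replaces [phi] by [- partial i phi], which is again smooth with compact support;
    this is why [phi] is taken of class C^n for all [n]. *)
Lemma smear_classC n phi : (forall n, classC n phi) ->
  (exists N', forall x, N' < `|x| -> phi x = 0) -> classC n (smear V phi).
Proof.
elim: n phi => [|n ih] phi hphi [N' phiN].
  have [K _ phiK] := continuous_bounded_support (classC_continuous (hphi 0%N)) phiN.
  have H i : exists K1 : R, forall z, `|partial i phi z| <= K1.
    have [K1 _ h] := continuous_bounded_support
       (classC_continuous (classC_partial i (hphi 1%N))) (partial_support i phiN).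
    by exists K1.
  have [K1 hK1] := choice H.
  split => //; apply: (@smear_continuous _ K (\sum_i `|K1 i|)) => //.
  - exact: (classC_continuous (hphi 0%N)).
  - by move=> i z; exact: classC_derivable (hphi 1%N).
  - move=> i z; apply: le_trans (hK1 i z) _; rewrite (bigD1 i)//=.
    by apply: le_trans (ler_norm _) _; rewrite lerDl sumr_ge0.
split; first exact: (classC_continuous (ih phi hphi (ex_intro _ N' phiN))).
move=> i.
have [K _ phiK] := continuous_bounded_support (classC_continuous (hphi 0%N)) phiN.
have [K1 _ phiK1] := continuous_bounded_support
       (classC_continuous (classC_partial i (hphi 1%N))) (partial_support i phiN).
have D x : is_derive x (basis_vec i) (smear V phi) (smear V (fun z => - partial i phi z) x).
  apply: (smear_is_derive x _ phiK _ phiK1).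
  - exact: (classC_continuous (hphi 0%N)).
  - by move=> z; exact: classC_derivable (hphi 1%N).
split; first by move=> x; have [] := D x.
rewrite (_ : partial i _ = smear V (fun z => - partial i phi z)); last first.
  by apply/funext => x; have [] := D x.
apply: ih.
  by move=> m; apply: classC_opp; exact: classC_partial.
by exists N' => x Nx; rewrite (partial_support i phiN Nx) oppr0.
Qed.

Lemma smear_support phi N' : (forall x, N' < `|x| -> phi x = 0) ->
  forall x, N + N' < `|x| -> smear V phi x = 0.
Proof.
move=> phiN x Nx; rewrite /smear (_ : (fun _ => _) = cst 0); last first.
  apply/funext => y /=; have [yN|/VN ->] := leP `|y| N; last by rewrite mul0r.
  rewrite phiN ?mulr0//; rewrite -(ltrD2l N); apply: lt_le_trans Nx _.
  rewrite -(lerD2l (- `|y|)) addrA.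
  apply: (@le_trans _ _ `|y - x|).
    by rewrite addrC distrC; exact: lerB_dist.
  by rewrite lerDr addrC subr_ge0.
by rewrite Rintegral_cst// mul0r.
Qed.

Lemma smear_test_function phi : test_function phi -> test_function (smear V phi).
Proof.
move=> /test_functionP [hphi [N' phiN]]; apply/test_functionP; split.
  by move=> n; apply: smear_classC => //; exists N'.
by exists (N + N'); exact: smear_support.
Qed.

Lemma partial_smear phi i : test_function phi ->
  partial i (smear V phi) = smear V (fun z => - partial i phi z).
Proof.
move=> /test_functionP [hphi [N' phiN]].
have [K _ phiK] := continuous_bounded_support (classC_continuous (hphi 0%N)) phiN.
have [K1 _ phiK1] := continuous_bounded_support
       (classC_continuous (classC_partial i (hphi 1%N))) (partial_support i phiN).
apply/funext => x; have [] // := smear_is_derive x _ phiK _ phiK1.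
- exact: (classC_continuous (hphi 0%N)).
- by move=> z; exact: classC_derivable (hphi 1%N).
Qed.

End smear_theory.

Definition mollifier_mass (n : nat) : R := \int[mu]_x bump (n.+1%:R *: x).

Definition mollifier (n : nat) x : R := (mollifier_mass n)^-1 * bump (n.+1%:R *: x).

Lemma mollifier_argument_ge1 n x : n.+1%:R^-1 <= `|x| -> 1 <= `|n.+1%:R *: x|.
Proof. by move=> h; rewrite normrZ ger0_norm// mulrC -ler_pdivrMr// div1r. Qed.

Lemma bump_scale_classC k n : classC k (fun x : 'rV[R]_d => bump (n.+1%:R *: x)).
Proof.
have := @classC_affine R d k bump n.+1%:R 0 (classC_bump k).
by under eq_fun do rewrite addr0.
Qed.

Lemma bump_scale_integrable n : mu.-integrable setT (EFin \o (fun x : 'rV[R]_d => bump (n.+1%:R *: x))).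
Proof.
have c := classC_continuous (bump_scale_classC 0 n).
have s x : n.+1%:R^-1 < `|x| -> bump (n.+1%:R *: x) = 0.
  by move=> h; rewrite bump_support//; apply: mollifier_argument_ge1; exact: ltW.
have [K _ h] := continuous_bounded_support c s.
by apply: (integrable_bounded_support hmu _ h s); exact: continuous_measurable_rV.
Qed.

(** With mass 0 the scaled bump would vanish almost everywhere, whereas it is positive on a box of
    positive volume. *)
Lemma mollifier_mass_gt0 n : 0 < mollifier_mass n.
Proof.
rewrite lt_neqAle Rintegral_ge0 ?andbT; last by move=> x _; exact: bump_ge0.
apply/eqP => /esym m0.
have mb := continuous_measurable_rV (classC_continuous (bump_scale_classC 0 n)).
have i0 : (\int[mu]_x `|(bump (n.+1%:R *: x))%:E| = 0)%E.
  have := EFin_normr_Rintegral measurableT (bump_scale_integrable n).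
  rewrite [X in `|X|%:E]m0 normr0 => /esym /eqP; rewrite abse_eq0 => /eqP h.
  rewrite -[RHS]h; apply: eq_integral => x _ /=.
  by rewrite ger0_norm// bump_ge0.
have /(_ (proj1 (ae_eq_integral_abs mu measurableT _) i0)) : 
  ae_eq mu setT (fun x : 'rV[R]_d => (bump (n.+1%:R *: x))%:E) (cst 0%E) -> False; last first.
  by apply; exact/measurable_EFinP.
move=> [A [mA A0 hA]].
(* [1/(n+2) < 1/(n+1)]: the cube of half-side [r] lies inside the open cube where the scaled bump is
   positive. *)
pose r : R := (n.+2%:R)^-1.
have r0 : 0 < r by rewrite invr_gt0.
have : mu (box (const_mx (- r)) (const_mx r)) = 0%E.
  apply/eqP; rewrite -measure_le0 -A0; apply: le_measure; rewrite ?inE//.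
    exact: measurable_box.
  move=> x hx; apply: hA => /= /(_ I) /eqP; rewrite eqe gt_eqF//.
  apply: bump_gt0; rewrite normrZ ger0_norm// mulrC -ltr_pdivlMr// div1r.
  apply: (@le_lt_trans _ _ r); last by rewrite ltf_pV2 ?posrE// ltr_nat.
  apply: rV_norm_le; first exact: ltW.
  by move=> i; have := hx i; rewrite !mxE ler_norml => /andP[/ltW -> ->].
have := hmu (l := const_mx (- r)) (r := const_mx r); rewrite -/(box _ _) => ->; last first.
  by move=> i; rewrite !mxE; lra.
move=> /eqP; rewrite eqe gt_eqF//; apply: prodr_gt0 => i _; rewrite !mxE; lra.
Qed.

Lemma mollifier_ge0 n x : 0 <= mollifier n x.
Proof. by rewrite mulr_ge0 ?bump_ge0// invr_ge0 ltW// mollifier_mass_gt0. Qed.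

Lemma mollifier_support n x : n.+1%:R^-1 <= `|x| -> mollifier n x = 0.
Proof.
by move=> h; rewrite /mollifier bump_support ?mulr0//; exact: mollifier_argument_ge1.
Qed.

Lemma mollifier_classC k n : classC k (mollifier n).
Proof. exact/classC_scale/bump_scale_classC. Qed.

Lemma mollifier_test_function n : test_function (mollifier n).
Proof.
apply/test_functionP; split; first by move=> k; exact: mollifier_classC.
by exists n.+1%:R^-1 => x h; apply: mollifier_support; exact: ltW.
Qed.

Lemma mollifier_measurable n : measurable_fun setT (mollifier n).
Proof. exact: continuous_measurable_rV (classC_continuous (mollifier_classC 0 n)). Qed.

Lemma mollifier_integrable n : mu.-integrable setT (EFin \o mollifier n).
Proof.
have := integrableZl measurableT (mollifier_mass n)^-1 (bump_scale_integrable n).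
exact: eq_integrable.
Qed.

Lemma mollifier_mass1 n x : \int[mu]_y mollifier n (y - x) = 1.
Proof.
rewrite (Rintegral_shift hmu (- x) (mollifier_measurable n)).
by rewrite RintegralZl ?bump_scale_integrable// mulVf// gt_eqF// mollifier_mass_gt0.
Qed.

Lemma mollifier_shift_integrable n x : mu.-integrable setT (EFin \o (fun y => mollifier n (y - x))).
Proof.
have mE : measurable_fun setT (EFin \o mollifier n).
  by apply/measurable_EFinP; exact: mollifier_measurable.
have [H _] := @integrable_image _ _ _ _ R _ (@measurable_shift R d (- x)) mu mu
  (fun A mA => lebesgue_shift hmu (- x) mA) _ mE.
exact/H/mollifier_integrable.
Qed.

Definition mollify n V := smear V (mollifier n).

(** [mollify n V x] is an average of [V] over the ball of radius [1/(n+1)]. The uniform bound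
    ([c = 0]), convergence at continuity points ([c = V x]) and the exact value where [V] is locally
    constant ([e = 0]) are instances. *)
Lemma mollify_dist n V (M c e : R) x : measurable_fun setT V -> (forall x, `|V x| <= M) ->
  (forall y, `|y - x| < n.+1%:R^-1 -> `|V y - c| <= e) ->
  `|mollify n V x - c| <= e.
Proof.
move=> mV VM Vc.
have iV : mu.-integrable setT (EFin \o (fun y => V y * mollifier n (y - x))).
  apply: (@integrable_le _ _ _ _ _ _ (fun y => M * mollifier n (y - x))) => //.
  - apply: measurable_funM => //; apply: (measurableT_comp (mollifier_measurable n)).
    exact: measurable_shift.
  - have := integrableZl measurableT M (mollifier_shift_integrable n x); exact: eq_integrable.
  - by move=> y _; rewrite normrM [X in _ * X]ger0_norm ?mollifier_ge0// ler_wpM2r// mollifier_ge0.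
have ic : mu.-integrable setT (EFin \o (fun y => c * mollifier n (y - x))).
  have := integrableZl measurableT c (mollifier_shift_integrable n x); exact: eq_integrable.
have ie : mu.-integrable setT (EFin \o (fun y => e * mollifier n (y - x))).
  have := integrableZl measurableT e (mollifier_shift_integrable n x); exact: eq_integrable.
have iB : mu.-integrable setT (EFin \o (fun y => V y * mollifier n (y - x) - c * mollifier n (y - x))).
  have := integrableB measurableT iV ic; exact: eq_integrable.
have -> : c = \int[mu]_y (c * mollifier n (y - x)).
  by rewrite RintegralZl ?mollifier_shift_integrable// mollifier_mass1 mulr1.
rewrite /mollify /smear -RintegralB//.
apply: le_trans (le_normr_Rintegral _ _) _ => //.
have -> : e = \int[mu]_y (e * mollifier n (y - x)).
  by rewrite RintegralZl ?mollifier_shift_integrable// mollifier_mass1 mulr1.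
apply: le_Rintegral => //; first exact: (integrable_norm iB).
move=> y _; rewrite -mulrBl normrM [X in _ * X]ger0_norm ?mollifier_ge0//.
have [h|h] := ltP `|y - x| n.+1%:R^-1; last by rewrite mollifier_support// !mulr0.
by rewrite ler_wpM2r ?mollifier_ge0//; exact: Vc.
Qed.

Lemma mollify_bound n V (M : R) x : measurable_fun setT V -> (forall x, `|V x| <= M) ->
  `|mollify n V x| <= M.
Proof.
move=> mV VM; rewrite -[mollify n V x]subr0.
by apply: (mollify_dist mV VM) => y _; rewrite subr0.
Qed.

Lemma mollify_cvg V (M : R) x : measurable_fun setT V -> (forall x, `|V x| <= M) ->
  {for x, continuous V} -> mollify n V x @[n --> \oo] --> V x.
Proof.
move=> mV VM cV; apply/cvgrPdist_le => e e0.
have /cvgrPdist_le /(_ _ e0) /nbhs_ballP [r /= r0 hr] := cV.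
have [n0 hn0] := invnS_lt r0.
near=> n; rewrite distrC; apply: (mollify_dist mV VM) => y yx.
rewrite distrC; apply: hr; rewrite -ball_normE /ball_/= distrC.
apply: lt_trans yx _; apply: le_lt_trans hn0.
rewrite lef_pV2 ?posrE// ler_nat ltnS; near: n; exact: nbhs_infty_ge.
Unshelve. all: by end_near. Qed.

Lemma mollify_locally_cst n V (M c : R) x : measurable_fun setT V ->
  (forall x, `|V x| <= M) ->
  (forall y, `|y - x| < n.+1%:R^-1 -> V y = c) -> mollify n V x = c.
Proof.
move=> mV VM Vc; apply/eqP; rewrite -subr_eq0 -normr_le0.
by apply: (mollify_dist mV VM) => y /Vc ->; rewrite subrr normr0.
Qed.

(** Mollification, at a width below [e], of the indicator of the ball of radius [r + e]: the plateau
    loses at most [e] and the support gains at most [e]. *)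
Lemma plateau_exists (y : 'rV[R]_d) (r e : R) : 0 < r -> 0 < e ->
  exists chi, [/\ forall n, classC n chi, forall x, `|x - y| <= r -> chi x = 1,
    forall x, r + 2 * e < `|x - y| -> chi x = 0 & forall x, 0 <= chi x <= 1].
Proof.
move=> r0 e0; pose A := [set x : 'rV[R]_d | `|x| <= r + e].
have mA : measurable A by exact: measurable_closed_ball.
have [n hn] := invnS_lt e0.
have m1 : measurable_fun setT (\1_A : 'rV[R]_d -> R) by exact: measurable_indic.
have b1 x : `|\1_A x : R| <= 1.
  by rewrite indicE; case: (_ \in _); rewrite ?normr1 ?normr0.
have s1 x : r + e < `|x| -> \1_A x = 0 :> R.
  by move=> h; rewrite indicE memNset// /A /= => h'; have := lt_le_trans h h'; rewrite ltxx.
have [hC _] := smear_test_function m1 b1 s1 (mollifier_test_function n).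
exists (fun x => mollify n \1_A (x - y)); split.
- by move=> k; apply: (@classC_shift _ _ _ _ (- y)); exact: hC.
- move=> x xr; apply: (mollify_locally_cst m1 b1) => z zx.
  rewrite indicE mem_set// /A /=.
  rewrite -[z](subrK (x - y)) addrC; apply: le_trans (ler_normD _ _) _.
  by rewrite lerD//; apply: ltW; exact: lt_trans hn.
- move=> x xr; apply: (mollify_locally_cst m1 b1) => z zx; rewrite s1//.
  have := ler_distD z (x - y) 0; rewrite !subr0 distrC => h.
  have := lt_trans zx hn; lra.
- move=> x; apply/andP; split; last first.
    by apply: le_trans (ler_norm _) (mollify_bound _ _ m1 b1).
  by apply: Rintegral_ge0 => z _; rewrite mulr_ge0 ?mollifier_ge0.
Qed.

End mollification.

(** * Geometry of the interface *)

(* The filter of complements, in K, of the sets satisfying P has no cluster point. *)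
Lemma compact_local_ind (T : topologicalType) (K : set T) (P : set T -> Prop) :
  compact K -> P set0 -> (forall A B, P A -> P B -> P (A `|` B)) ->
  (forall A B, A `<=` B -> P B -> P A) ->
  (forall x, K x -> exists2 U, nbhs x U & P U) -> P K.
Proof.
move=> cK P0 PU Pm Pl; apply: contrapT => nPK.
pose F : set_system T := [set B | exists2 A, P A & K `\` A `<=` B].
have FF : ProperFilter F.
  apply: Build_ProperFilter_ex.
    move=> B [A PA AB]; apply: contrapT => /forallNP h.
    apply: nPK; apply: Pm PA => x Kx; apply: contrapT => nAx.
    exact: (h x (AB x (conj Kx nAx))).
  split.
  - by exists set0.
  - move=> B C [A PA AB] [A' PA' AC]; exists (A `|` A'); first exact: PU.
    by move=> x [Kx nA]; split; [apply: AB|apply: AC]; split => // h; apply: nA; [left|right].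
  - by move=> B C BC [A PA AB]; exists A => //; exact: subset_trans BC.
have FK : F K by exists set0 => // x [].
have [x [Kx clx]] := cK F FF FK.
have [U Ux PU'] := Pl x Kx.
have FU : F (K `\` U) by exists U.
by have [z [[_ nU] Uz]] := clx _ _ FU Ux.
Qed.

Section normed_facts.
Context {R : realType} {V : normedModType R}.
Implicit Types (x y z : V) (r : R).

Lemma nbhs_norm_lt y (P : set V) : nbhs y P ->
  exists2 r, 0 < r & forall z, `|z - y| < r -> P z.
Proof.
move=> /nbhs_ballP [r /= r0 hr]; exists r => // z zy; apply: hr.
by rewrite -ball_normE /ball_/= distrC.
Qed.

Lemma continuous_near_dist (f : V -> R) y r : {for y, continuous f} -> 0 < r ->
  \forall z \near nbhs y, `|f y - f z| < r.
Proof. by move=> cf r0; have /cvgrPdist_lt := cf; exact. Qed.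

Lemma norm_lt_nbhs y r : 0 < r -> nbhs y [set z | `|z - y| < r].
Proof.
move=> r0; apply: filterS (nbhsx_ballx y _ r0) => z.
by rewrite -ball_normE /ball_/= distrC.
Qed.

Lemma open_norm_gt y r : open [set z : V | r < `|z - y|].
Proof.
rewrite (_ : [set z | r < `|z - y|] = (fun z => `|z - y|) @^-1` [set s | r < s])//.
apply: open_comp; last exact: open_gt.
move=> z _; apply: (@continuous_comp _ _ _ (fun z => z - y) (fun z => `|z|)).
  by apply: continuousB; [exact: (@cvg_id _ (nbhs z))|exact: cst_continuous].
exact: norm_continuous.
Qed.

Lemma norm_convex_lt x z r (c : R) : 0 <= c <= 1 -> `|x| < r -> `|z| < r ->
  `|x + c *: (z - x)| < r.
Proof.
move=> /andP[c0 c1] xr zr; rewrite scalerBr addrCA -[x in _ + (x - _)]scale1r -scalerBl.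
apply: le_lt_trans (ler_normD _ _) _; rewrite !normrZ ger0_norm// ger0_norm ?subr_ge0//.
have [h|h] := leP `|x| `|z|; [apply: le_lt_trans zr|apply: le_lt_trans xr]; nra.
Qed.

End normed_facts.

Section classC_inverse.
Context {R : realType} {d : nat}.
Implicit Types (u : 'rV[R]_d -> R).

Lemma is_derive_inverse u x i (du : R) : u x != 0 -> is_derive x (basis_vec i) u du ->
  is_derive x (basis_vec i) (fun z => (u z)^-1) (- (u x) ^- 2 * du).
Proof.
move=> u0 [D <-]; split; first exact: derivableV.
by rewrite deriveV.
Qed.

Lemma classC1_inverse u : (forall x, u x != 0) -> classC 1 u ->
  classC 1 (fun z => (u z)^-1).
Proof.
move=> u0 hu; have cV : continuous (fun z => (u z)^-1).
  move=> x; apply: (@cvgV _ _ (nbhs (x : 'rV[R]_d)) _ u) => //.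
  exact: (classC_continuous hu).
split => // i; have D x : is_derive x (basis_vec i) (fun z => (u z)^-1)
    (- (u x) ^- 2 * partial i u x).
  by apply: is_derive_inverse => //; apply: derivableP; exact: classC_derivable hu.
split; first by move=> x; have [] := D x.
rewrite (_ : partial i _ = fun x => - ((u x)^-1 * (u x)^-1) * partial i u x); last first.
  by apply/funext => x; have [_ E] := D x; rewrite /partial E -expr2 exprVn.
have cV0 : classC 0 (fun z => (u z)^-1) by split.
apply: (@classC_mul _ _ 0); last exact: classC_partial.
by apply: (@classC_opp _ _ 0); exact: (@classC_mul _ _ 0).
Qed.

End classC_inverse.

Section interface_geometry.
Context {R : realType} {d : nat}.
Variables (Dp Dm : set 'rV[R]_d) (hD : transmission_domains Dp Dm).
Implicit Types (x y z w n : 'rV[R]_d) (i j : 'I_d) (g h : 'rV[R]_d -> R).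
Local Notation Gamma := (interface Dp Dm).

Lemma interface_closed : closed Gamma.
Proof. by apply: closedI; exact: closed_closure. Qed.

Lemma interface_measurable : measurable Gamma.
Proof. exact: closed_measurable_rV interface_closed. Qed.

Lemma Dp_measurable : measurable Dp.
Proof. exact: open_measurable_rV (td_openp hD). Qed.

Lemma Dm_measurable : measurable Dm.
Proof. exact: open_measurable_rV (td_openm hD). Qed.

Lemma Dp_not_interface x : Dp x -> ~ Gamma x.
Proof. by move=> Dx; rewrite -(td_boundary hD) => -[]. Qed.

Lemma Dm_not_closureDp x : Dm x -> ~ closure Dp x.
Proof.
move=> Dx cx; have [z [zp zm]] := cx _ (open_nbhs_nbhs (conj (td_openm hD) Dx)).
by have : (Dp `&` Dm) z by []; rewrite (td_disjoint hD).
Qed.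

Lemma Dp_not_Dm x : Dp x -> ~ Dm x.
Proof. by move=> xp xm; have : (Dp `&` Dm) x by []; rewrite (td_disjoint hD). Qed.

Lemma domains_cover x : Dp x \/ Dm x \/ Gamma x.
Proof.
have : (closure Dp `|` Dm) x by rewrite (td_cover hD).
move=> [cx|]; last by right; left.
by have [|nx] := pselect (Dp x); [left|right; right; rewrite -(td_boundary hD)].
Qed.

Lemma not_interface_side x : ~ Gamma x -> ~ Dp x -> Dm x.
Proof. by case: (domains_cover x) => // -[]. Qed.

(** On a segment that misses the interface, [Dp] coincides with the complement of [Dm]; its trace is
    therefore open and closed in a connected set. *)
Lemma segment_Dp x z : (forall c, 0 <= c <= 1 -> ~ Gamma (x + c *: (z - x))) ->
  Dp x -> Dp z.
Proof.
move=> hs Dx; pose S := (fun c : R => x + c *: (z - x)) @` `[0, 1]%classic.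
have cS : connected S.
  apply: connected_continuous_connected; first exact: segment_connected.
  apply: continuous_subspaceT => c.
  by apply: (@cvgD _ _ _ (nbhs c)); [exact: cvg_cst|exact: scalel_continuous].
have SD : S `&` Dp = S `&` ~` Dm.
  apply/seteqP; split => w [Sw hw]; split => //.
    by move=> wm; exact: Dp_not_Dm hw wm.
  have nG : ~ Gamma w by case: Sw => c; rewrite /= in_itv/= => /hs + <-.
  by apply: contrapT => np; apply: hw; exact: not_interface_side.
have E := cS (S `&` Dp) _ _ _.
suff : (S `&` Dp) z by case.
rewrite E.
- by exists 1; [rewrite /= in_itv/= ler01 lexx|rewrite scale1r addrCA subrr addr0].
- exists x; split => //; exists 0; first by rewrite /= in_itv/= lexx ler01.
  by rewrite scale0r addr0.
- by exists Dp => //; exact: td_openp hD.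
- by exists (~` Dm); [exact: open_closedC (td_openm hD)|].
Qed.

Lemma segment_sides x z : (forall c, 0 <= c <= 1 -> ~ Gamma (x + c *: (z - x))) ->
  (Dp x <-> Dp z).
Proof.
move=> hs; split; first exact: segment_Dp.
apply: segment_Dp => c /andP[c0 c1].
rewrite (_ : z + c *: (x - z) = x + (1 - c) *: (z - x)).
  by apply: hs; apply/andP; split; lra.
by apply/rowP => i; rewrite !mxE; ring.
Qed.

Lemma local_equation_at y z U g : local_equation Gamma y U g -> U z ->
  local_equation Gamma z U g.
Proof. by case. Qed.

Lemma local_equationE y U g z : local_equation Gamma y U g -> U z ->
  Gamma z <-> g z = 0.
Proof.
move=> [_ _ _ _ E] Uz; split => [Gz|gz].
  by have : (Gamma `&` U) z by []; rewrite E => -[].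
by have : [set z | U z /\ g z = 0] z by []; rewrite -E => -[].
Qed.

Lemma partial_continuous k g i : classC k.+1 g -> continuous (partial i g).
Proof. by move=> /(@classC_partial _ _ _ _ i) /classC_continuous. Qed.

(** Plays the part of the implicit function theorem: a coordinate direction in which [g] is strictly
    monotone near [y], with speed at least [c]. The sign [a] orients it upwards, and [c] is half the
    absolute value of a nonzero partial derivative at [y]. *)
Lemma chart y U g : local_equation Gamma y U g ->
  exists i (a r c : R), [/\ a = 1 \/ a = -1, 0 < r, 0 < c &
    forall z, `|z - y| < r -> U z /\ c <= a * partial i g z].
Proof.
move=> [oU Uy cg g0 _].
have [i hi] : exists i, partial i g y != 0.
  apply: contrapT => /forallNP H; have /eqP := g0 y Uy; apply.
  by apply/rowP => i; rewrite !mxE; have /negP := H i; rewrite negbK => /eqP.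
pose a := Num.sg (partial i g y); pose c := `|partial i g y| / 2.
have c0 : 0 < c by rewrite divr_gt0// normr_gt0.
have a1 : a = 1 \/ a = -1.
  by rewrite /a; case: sgrP hi => //; [left|right].
have cp : continuous (partial i g) by exact: partial_continuous cg.
have N1 := continuous_near_dist (cp y) c0.
have [r r0 hr] := nbhs_norm_lt (filterI N1 (open_nbhs_nbhs (conj oU Uy))).
exists i, a, r, c; split => // z /hr [hz Uz]; split => //.
have E : a * partial i g y = 2 * c by rewrite /a mulrC -[_ * Num.sg _]mulrC -normrEsg /c mulrCA mulfV// mulr1.
move: hz; rewrite /= ltr_norml => /andP[h1 h2].
by case: a1 => ea; rewrite ea in E *; lra.
Qed.

Lemma increase_along y g i (a r c : R) : classC 1 g -> a = 1 \/ a = -1 ->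
  (forall z, `|z - y| < r -> c <= a * partial i g z) ->
  forall z t, 0 <= t -> `|z - y| < r -> `|z + (t * a) *: basis_vec i - y| < r ->
  g z + c * t <= g (z + (t * a) *: basis_vec i).
Proof.
move=> cg a1 hc z t t0 zr zr'.
have dg x : derivable g x (basis_vec i) by exact: classC_derivable cg.
have [th th01 E] := MVT_line z (t * a) dg.
rewrite -lerBrDl E -mulrA mulrC ler_wpM2l//; apply: hc.
rewrite -scalerA (_ : _ - y = (z - y) + th *: ((z + (t * a) *: basis_vec i - y) - (z - y))).
  exact: norm_convex_lt.
by apply/rowP => j; rewrite !mxE; ring.
Qed.

Lemma norm_sign_basis (t a : R) i : a = 1 \/ a = -1 -> 0 <= t ->
  `|(t * a) *: (basis_vec i : 'rV[R]_d)| <= t.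
Proof.
move=> a1 t0; rewrite normrZ normrM (ger0_norm t0).
have -> : `|a| = 1 by case: a1 => ->; rewrite ?normrN normr1.
by rewrite mulr1 ler_piMr// norm_basis_vec.
Qed.

(* The points z with h z > 0 near y are joined to a fixed one by two segments
   on which h > 0. *)
Lemma one_side y h i (a r c : R) : 0 < r -> 0 < c -> a = 1 \/ a = -1 ->
  continuous h -> h y = 0 ->
  (forall z, `|z - y| < r -> Gamma z -> h z = 0) ->
  (forall z t, 0 <= t -> `|z - y| < r -> `|z + (t * a) *: basis_vec i - y| < r ->
    h z + c * t <= h (z + (t * a) *: basis_vec i)) ->
  exists2 r', 0 < r' & (forall z, `|z - y| < r' -> 0 < h z -> Dp z) \/
                       (forall z, `|z - y| < r' -> 0 < h z -> Dm z).
Proof.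
move=> r0 c0 a1 ch hy hG hinc; pose t := r / 2.
have t0 : 0 < t by rewrite divr_gt0.
have ct0 : 0 < c * t by rewrite mulr_gt0.
have N1 := continuous_near_dist (ch y) ct0.
have [r1 r10 hr1] := nbhs_norm_lt N1.
have N z s : `|z - y| < t -> 0 <= s -> s <= t -> `|z + (s * a) *: basis_vec i - y| < r.
  move=> zy s0 st; rewrite addrAC; apply: le_lt_trans (ler_normD _ _) _.
  have := norm_sign_basis i a1 s0; move: zy; rewrite {1}/t /t in st *; lra.
pose q := y + (t * a) *: basis_vec i.
(* Near [y] one has [h w > - c t], and a move upwards by [t] gains at least [c t]. *)
have P w : `|w - y| < Num.min r1 t -> 0 < h (w + (t * a) *: basis_vec i).
  rewrite lt_min => /andP[wr1 wt]; have := hr1 w wr1; rewrite hy /= sub0r normrN ltr_norml => /andP[h1 _].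
  have wr : `|w - y| < r by apply: lt_trans wt _; rewrite /t; lra.
  by have := hinc w t (ltW t0) wr (N w t wt (ltW t0) (lexx _)); lra.
have pos_notG w : `|w - y| < r -> 0 < h w -> ~ Gamma w.
  by move=> wr hw /(hG w wr) hw0; rewrite hw0 ltxx in hw.
have r'0 : 0 < Num.min r1 t by rewrite lt_min r10.
have S z : `|z - y| < Num.min r1 t -> 0 < h z -> ~ Gamma z /\ (Dp z <-> Dp q).
  move=> zr hz; have := zr; rewrite lt_min => /andP[zr1 zt].
  have zrr : `|z - y| < r by apply: lt_trans zt _; rewrite /t; lra.
  split; first exact: pos_notG.
  apply: (@iff_trans _ (Dp (z + (t * a) *: basis_vec i))); apply: segment_sides => s /andP[s0 s1].
    rewrite addrAC subrr add0r scalerA mulrA.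
    have st0 : 0 <= s * t by rewrite mulr_ge0// ltW.
    have st : s * t <= t by rewrite ler_piMl// ltW.
    apply: pos_notG; first exact: N.
    by have := hinc z (s * t) st0 zrr (N z _ zt st0 st); have := mulr_ge0 (ltW c0) st0; lra.
  rewrite (_ : _ + s *: _ = (y + ((z - y) + s *: (0 - (z - y)))) + (t * a) *: basis_vec i); last first.
    by apply/rowP => j; rewrite !mxE; ring.
  have K : `|y + ((z - y) + s *: (0 - (z - y))) - y| < Num.min r1 t.
    by rewrite addrC addKr; apply: norm_convex_lt; rewrite ?s0 ?normr0.
  apply: pos_notG; last exact: P.
  by apply: N; [move: K; rewrite lt_min => /andP[]|exact: ltW|exact: lexx].
exists (Num.min r1 t) => //; have [qp|nqp] := pselect (Dp q); [left|right] => z zr hz.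
  by have [_ [_]] := S z zr hz; apply.
have [nG [zq _]] := S z zr hz; apply: not_interface_side => // zp.
exact/nqp/zq.
Qed.

(** The increment along [n] is [s] times a sum in which the partial derivatives are taken at nearby
    points. Each is within [de = m / (2 A)] of its value at [y], so the sum differs from [m] by less
    than [m / 2]. *)
Lemma positive_along g y n : classC 1 g -> g y = 0 ->
  0 < \sum_i n ord0 i * partial i g y ->
  exists2 e, 0 < e & forall s, 0 < s < e -> 0 < g (y + s *: n).
Proof.
move=> cg gy; set m := \sum_i _ => m0.
pose A := \sum_i `|n ord0 i| + 1.
have A0 : 0 < A by rewrite ltr_wpDl// sumr_ge0.
pose de := m / (2 * A); have de0 : 0 < de by rewrite divr_gt0// mulr_gt0.
have NH : \forall z \near nbhs y, forall i, `|partial i g y - partial i g z| < de.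
  apply: filter_forall => i.
  have pc : continuous (partial i g) by exact: partial_continuous cg.
  by have := continuous_near_dist (pc y) de0; exact.
have [r r0 hr] := nbhs_norm_lt NH.
have N0 : 0 < `|n| + 1 by rewrite ltr_wpDl.
exists (r / (`|n| + 1)); first by rewrite divr_gt0.
move=> s /andP[s0]; rewrite ltr_pdivlMr// => sr.
have dg i z : derivable g z (basis_vec i) by exact: classC_derivable cg.
have [xi [hxi E]] := increment_partial y (s *: n) dg.
rewrite gy subr0 in E; rewrite E.
under eq_bigr do rewrite mxE -mulrA.
rewrite -mulr_sumr mulr_gt0//.
apply: (@lt_le_trans _ _ (m - \sum_i `|n ord0 i| * de)).
  rewrite -mulr_suml subr_gt0 /de mulrA ltr_pdivrMr ?mulr_gt0//.
  rewrite [ltRHS]mulrC ltr_pM2r//.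
  have : 0 <= \sum_i `|n ord0 i| by exact: sumr_ge0.
  rewrite /A; lra.
rewrite lerBlDr -big_split/=; apply: ler_sum => i _.
have hi : `|partial i g y - partial i g (xi i)| < de.
  apply: hr; apply: le_lt_trans (hxi i) _; rewrite normrZ (gtr0_norm s0).
  by apply: le_lt_trans sr; rewrite ler_pM2l// lerDl.
rewrite -lerBlDl -mulrBr; apply: le_trans (ler_norm _) _.
by rewrite normrM ler_wpM2l// ltW.
Qed.

Lemma enorm_gt0 (v : 'rV[R]_d) : v != 0 -> 0 < enorm v.
Proof.
move=> v0; rewrite /enorm sqrtr_gt0 /dotrv.
have [i vi] : exists i, v ord0 i != 0.
  apply: contrapT => /forallNP H; move/eqP : v0; apply.
  by apply/rowP => i; rewrite !mxE; have /negP := H i; rewrite negbK => /eqP.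
rewrite (bigD1 i)//= ltr_pwDl//; first by rewrite -expr2 exprn_even_gt0.
by apply: sumr_ge0 => j _; rewrite -expr2 sqr_ge0.
Qed.

Lemma enorm_normalize (v : 'rV[R]_d) (a : R) : a = 1 \/ a = -1 -> v != 0 ->
  enorm ((a / enorm v) *: v) = 1.
Proof.
move=> a1 v0; have N0 := enorm_gt0 v0.
rewrite {1}/enorm /dotrv; under eq_bigr do rewrite !mxE.
rewrite (_ : \sum_i _ = (a / enorm v) ^+ 2 * dotrv v v); last first.
  by rewrite /dotrv mulr_sumr; apply: eq_bigr => i _; ring.
rewrite -[dotrv v v]sqr_sqrtr; last by apply: sumr_ge0 => j _; rewrite -expr2 sqr_ge0.
rewrite -/(enorm v) -exprMn divfK ?gt_eqF// sqrtr_sqr.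
by case: a1 => ->; rewrite ?normrN normr1.
Qed.

(** The flux condition speaks of unit normals pointing into [Dp], while a local equation may have
    either sign. Near [y] each of the sides [g > 0] and [g < 0] lies in a single domain. They cannot
    both lie in [Dm], since [y] is a limit of points of [Dp]; so the normalized gradient of [g] or
    its opposite is an admissible normal. *)
Lemma normal_condition_tangent y w U g : Gamma y ->
  (forall n, unit_normal_into Dp Gamma y n -> dotrv w n = 0) ->
  local_equation Gamma y U g -> dotrv w (grad g y) = 0.
Proof.
move=> Gy hn le; have [oU Uy cg g0 _] := le.
have cg1 : classC 1 g by exact: classCS cg.
have gy : g y = 0 by exact/(local_equationE le Uy).
have v0 := g0 y Uy; have N0 := enorm_gt0 v0.
have [i [a [r [c [a1 r0 c0 hc]]]]] := chart le.
have inc := increase_along cg1 a1 (fun z zr => (hc z zr).2).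
have Gz z : `|z - y| < r -> Gamma z -> g z = 0.
  by move=> zr Gz; apply/(local_equationE le (hc z zr).1).
have [r1 r10 hp] := one_side r0 c0 a1 (classC_continuous cg) gy Gz inc.
have a1' : - a = 1 \/ - a = -1 by case: a1 => ->; rewrite ?opprK; [right|left].
have inc' z t : 0 <= t -> `|z - y| < r -> `|z + (t * - a) *: basis_vec i - y| < r ->
    - g z + c * t <= - g (z + (t * - a) *: basis_vec i).
  move=> t0 zr zr'.
  have := inc (z + (t * - a) *: basis_vec i) t t0 zr'.
  rewrite mulrN scaleNr subrK => /(_ zr); lra.
have Gz' z : `|z - y| < r -> Gamma z -> - g z = 0 by move=> zr /(Gz z zr) ->; rewrite oppr0.
have gy' : - g y = 0 by rewrite gy oppr0.
have [r2 r20 hm] := one_side r0 c0 a1' (classC_continuous (classC_opp cg)) gy' Gz' inc'.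
have key (b : R) r' : b = 1 \/ b = -1 -> 0 < r' ->
    (forall z, `|z - y| < r' -> 0 < b * g z -> Dp z) -> dotrv w (grad g y) = 0.
  move=> b1 r'0 hb.
  have bb : b * b = 1 by case: b1 => ->; rewrite ?mulrNN mulr1.
  pose n := (b / enorm (grad g y)) *: grad g y.
  have nn : unit_normal_into Dp Gamma y n.
    split; first exact: enorm_normalize.
      by exists U, g, (b / enorm (grad g y)).
    have cb : classC 1 (fun z => b * g z) by exact: classC_scale.
    have pb j z : partial j (fun z => b * g z) z = b * partial j g z.
      by rewrite partialZ// => x; exact: classC_derivable cg1.
    have [||e e0 he] := @positive_along (fun z => b * g z) y n cb.
    - by rewrite gy mulr0.
    - under eq_bigr do rewrite pb !mxE mulrACA [X in X * _]mulrAC bb mul1r.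
      rewrite -mulr_sumr mulr_gt0 ?invr_gt0//.
      move: N0; rewrite /enorm sqrtr_gt0 /dotrv.
      by under eq_bigr do rewrite !mxE.
    have M0 : 0 < `|n| + 1 by rewrite ltr_wpDl.
    exists (Num.min e (r' / (`|n| + 1))); first by rewrite lt_min e0 divr_gt0.
    move=> s; rewrite lt_min => /andP[s0 /andP[se]]; rewrite ltr_pdivlMr// => sr.
    apply: hb; last by apply: he; rewrite s0.
    rewrite addrAC subrr add0r normrZ (gtr0_norm s0); apply: le_lt_trans sr.
    by rewrite ler_pM2l// lerDl.
  have /eqP := hn n nn; rewrite /dotrv /n.
  under eq_bigr do rewrite mxE mulrCA; rewrite -mulr_sumr mulf_eq0.
  rewrite mulf_eq0 invr_eq0 (gt_eqF N0) orbF => /orP[/eqP b0|/eqP//].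
  by move: bb; rewrite b0 mul0r => /esym/eqP; rewrite oner_eq0.
case: hp => hp; first by apply: (key 1 r1) => //; [left|move=> z zr; rewrite mul1r; exact: hp].
case: hm => hm; first by apply: (key (-1) r2) => //; [right|move=> z zr; rewrite mulN1r; exact: hm].
have rr : 0 < Num.min r (Num.min r1 r2) by rewrite !lt_min r0 r10.
have [z [zp]] := Gy.1 _ (norm_lt_nbhs y rr).
rewrite /= !lt_min => /andP[zr /andP[zr1 zr2]]; exfalso.
have nG := Dp_not_interface zp.
have gz : g z != 0 by apply/eqP => h; apply: nG; exact/(local_equationE le (hc z zr).1).
apply: (Dp_not_Dm zp); have [h|h|h] := ltgtP (g z) 0.
- by apply: hm => //; rewrite oppr_gt0.
- exact: hp.
- by rewrite h eqxx in gz.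
Qed.

End interface_geometry.

(** * The divergence theorem across the interface *)

Lemma norm_le_sqr1 (R : realType) (t : R) : `|t| <= t * t + 1.
Proof. by rewrite -[t * t]expr2 -real_normK ?num_real//; nra. Qed.

Section interface_null.
Context {R : realType} {d : nat}.
Variable mu : {measure set 'rV[R]_d -> \bar R}.
Hypothesis hmu : is_lebesgue mu.
Variables (Dp Dm : set 'rV[R]_d) (hD : transmission_domains Dp Dm).
Implicit Types (x y z w n : 'rV[R]_d) (i j : 'I_d) (g h : 'rV[R]_d -> R).
Local Notation Gamma := (interface Dp Dm).

(* Infinitely many disjoint translates of equal measure fit in a bounded set. *)
Lemma disjoint_translates_null (A : set 'rV[R]_d) (M : R) (v : nat -> 'rV[R]_d) :
  measurable A -> (forall k x, A (x - v k) -> `|x| <= M) ->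
  (forall k l x, A (x - v k) -> A (x - v l) -> k = l) -> mu A = 0%E.
Proof.
move=> mA bA dA; pose F k := (fun x => x + - v k) @^-1` A.
have mF k : measurable (F k).
  by rewrite -[X in measurable X]setTI; exact: measurable_shift.
have muF k : mu (F k) = mu A by rewrite -lebesgue_shift.
have tF : trivIset setT F.
  by apply/trivIsetP => k l _ _ kl; rewrite -subset0 => x [xk xl]; move/eqP : kl; apply; exact: dA xk xl.
pose B := [set x : 'rV[R]_d | `|x| <= M].
have mB : measurable B by exact: measurable_closed_ball.
have Boo : (mu B < +oo)%E by apply: (lebesgue_bounded_lty hmu (M := M)).
have Aoo : (mu A < +oo)%E.
  by rewrite -(muF 0%N); apply: le_lt_trans Boo; apply: le_measure; rewrite ?inE// => x /bA.
have H (N : nat) : (N%:R * fine (mu A) <= fine (mu B)).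
  rewrite -lee_fin EFinM !fineK ?ge0_fin_numE//.
  have <- : mu (\big[setU/set0]_(k < N) F k) = (N%:R%:E * mu A)%E.
    rewrite measure_bigsetU//.
    transitivity (\sum_(k < N) mu A)%E; first by apply: eq_bigr => k _; exact: muF.
    by rewrite sumr_const card_ord mule_natl.
  apply: le_measure; rewrite ?inE//; first exact: bigsetU_measurable.
  by move=> x; rewrite -bigcup_mkord => -[k _] /bA.
have A0 : 0 <= fine (mu A) by rewrite fine_ge0.
rewrite -[mu A]fineK ?ge0_fin_numE//; congr EFin; apply/eqP; rewrite eq_le A0 andbT.
rewrite leNgt; apply/negP => Ap.
have B0 : 0 <= fine (mu B) by rewrite fine_ge0.
have := H (Num.trunc (fine (mu B) / fine (mu A))).+1; rewrite leNgt => /negP; apply.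
by rewrite -ltr_pdivrMr// truncnS_gt.
Qed.

(** By compactness it suffices to treat a small piece in a chart. Its translates along the
    transverse direction are disjoint, since [g] vanishes on the piece and is strictly increasing in
    that direction. *)
Lemma interface_null : mu Gamma = 0%E.
Proof.
have mG : measurable Gamma by exact: interface_measurable.
pose P (A : set 'rV[R]_d) := mu.-negligible (A `&` Gamma).
suff : P Gamma by rewrite /P setIid => /negligibleP; exact.
apply: (compact_local_ind (P := P) (td_compact hD)).
- by rewrite /P set0I; exact: negligible_set0.
- by move=> A B PA PB; rewrite /P setIUl; exact: negligibleU.
- by move=> A B AB; apply: negligibleS; exact: setSI.
move=> y Gy; have [U [g le]] := td_C2 hD Gy.
have [i [a [r [c [a1 r0 c0 hc]]]]] := chart le.
have cg1 : classC 1 g by have [_ _ cg _ _] := le; exact: classCS cg.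
have inc := increase_along cg1 a1 (fun z zr => (hc z zr).2).
have r20 : 0 < r / 2 by rewrite divr_gt0.
exists [set z | `|z - y| < r / 2]; first exact: norm_lt_nbhs.
rewrite /P; set A := (X in mu.-negligible X).
have mA : measurable A.
  apply: measurableI => //; apply: open_measurable_rV.
  rewrite (_ : [set z | `|z - y| < r / 2] = (fun z => `|z - y|) @^-1` [set s | s < r / 2])//.
  apply: open_comp; last exact: open_lt.
  move=> z _; apply: (@continuous_comp _ _ _ (fun z => z - y) (fun z => `|z|)).
    by apply: continuousB; [exact: (@cvg_id _ (nbhs z))|exact: cst_continuous].
  exact: norm_continuous.
apply/negligibleP => //.
(* The shifts are distinct and at most [r/2], so that a piece of radius [r/2], once translated,
   remains in the chart. *)
pose t k : R := r / 2 * k.+1%:R^-1.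
have t0 k : 0 < t k by rewrite mulr_gt0// invr_gt0.
have tr k : t k <= r / 2 by rewrite ler_piMr ?(ltW r20)// invf_le1// ler1n.
pose v k : 'rV[R]_d := (t k * a) *: basis_vec i.
have vr k : `|v k| <= r / 2.
  by apply: le_trans (tr k); apply: norm_sign_basis => //; exact: ltW.
have near_y k x : A (x - v k) -> `|x - y| < r.
  move=> [xk _]; rewrite -[x](subrK (v k)) addrAC; apply: le_lt_trans (ler_normD _ _) _.
  by move: xk (vr k) => /=; lra.
apply: (@disjoint_translates_null _ (`|y| + r) v mA).
  move=> k x /near_y xy; rewrite -[x](subrK y); apply: le_trans (ler_normD _ _) _.
  by move: xy; lra.
have lt_absurd k l x : A (x - v k) -> A (x - v l) -> t l < t k -> False.
  move=> Ak Al lk; have [kr Gk] := Ak; have [lr Gl] := Al.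
  have kr' : `|x - v k - y| < r by move: kr => /=; lra.
  have lr' : `|x - v l - y| < r by move: lr => /=; lra.
  have E : x - v l = x - v k + ((t k - t l) * a) *: basis_vec i.
    by apply/rowP => j; rewrite !mxE; ring.
  have s0 : 0 <= t k - t l by lra.
  have := inc (x - v k) _ s0 kr'; rewrite -E => /(_ lr').
  rewrite ((local_equationE le (hc _ kr').1).1 Gk) ((local_equationE le (hc _ lr').1).1 Gl).
  by have : 0 < c * (t k - t l) by [rewrite mulr_gt0// subr_gt0]; lra.
move=> k l x Ak Al; have [|lk|e] := ltgtP (t l) (t k).
- by move=> lk; case: (lt_absurd _ _ _ Ak Al lk).
- by case: (lt_absurd _ _ _ Al Ak lk).
move: e; rewrite /t => /(mulfI (lt0r_neq0 r20)) /invr_inj /eqP.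
by rewrite eqr_nat eqSS => /eqP.
Qed.

Lemma interface_ae (P : 'rV[R]_d -> Prop) : (forall x, ~ Gamma x -> P x) ->
  {ae mu, forall x, P x}.
Proof.
move=> H; exists Gamma; split; first exact: interface_measurable.
  exact: interface_null.
by move=> x /= nP; apply: contrapT => /H.
Qed.

End interface_null.

Section divergence.
Context {R : realType} {d : nat}.
Variable mu : {measure set 'rV[R]_d -> \bar R}.
Hypothesis hmu : is_lebesgue mu.
Variables (Dp Dm : set 'rV[R]_d) (hD : transmission_domains Dp Dm).
Implicit Types (x y z w n : 'rV[R]_d) (i j : 'I_d) (f g h psi : 'rV[R]_d -> R).
Implicit Types W V : 'I_d -> 'rV[R]_d -> R.
Local Notation Gamma := (interface Dp Dm).

Definition indp x : R := \1_Dp x.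
Definition indm x : R := \1_Dm x.

Lemma indpE x : Dp x -> indp x = 1. Proof. by move=> h; rewrite /indp indicE mem_set. Qed.
Lemma indp0 x : ~ Dp x -> indp x = 0. Proof. by move=> h; rewrite /indp indicE memNset. Qed.
Lemma indmE x : Dm x -> indm x = 1. Proof. by move=> h; rewrite /indm indicE mem_set. Qed.
Lemma indm0 x : ~ Dm x -> indm x = 0. Proof. by move=> h; rewrite /indm indicE memNset. Qed.

Lemma indp_norm x : `|indp x| <= 1.
Proof. by rewrite /indp indicE; case: (_ \in _); rewrite ?normr1 ?normr0. Qed.

Lemma indm_norm x : `|indm x| <= 1.
Proof. by rewrite /indm indicE; case: (_ \in _); rewrite ?normr1 ?normr0. Qed.

Lemma measurable_indp : measurable_fun setT indp.
Proof. by apply: measurable_indic; exact: Dp_measurable hD. Qed.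

Lemma measurable_indm : measurable_fun setT indm.
Proof. by apply: measurable_indic; exact: Dm_measurable hD. Qed.

(** On the interface the increments of the product are bounded by those of [h], whose derivative
    vanishes there: the indicator creates no jump. *)
Lemma is_derive_indp_mul h j : (forall x, derivable h x (basis_vec j)) ->
  (forall x, Gamma x -> h x = 0 /\ partial j h x = 0) ->
  forall x, is_derive x (basis_vec j) (fun z => indp z * h z) (indp x * partial j h x).
Proof.
move=> dh hG x; case: (domains_cover hD x) => [xp|[xm|xG]].
- have E : {near x, h =1 (fun z => indp z * h z)}.
    apply: filterS (open_nbhs_nbhs (conj (td_openp hD) xp)) => z zp.
    by rewrite indpE// mul1r.
  by rewrite indpE// mul1r; apply: near_eq_is_derive E _; exact: derivableP.
- have E : {near x, cst 0 =1 (fun z => indp z * h z)}.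
    apply: filterS (open_nbhs_nbhs (conj (td_openm hD) xm)) => z zm.
    by rewrite indp0 ?mul0r// => /(Dp_not_Dm hD).
  rewrite indp0 ?mul0r; last by move=> /(Dp_not_Dm hD).
  exact: near_eq_is_derive E (is_derive_cst _ _ _).
have [h0 dh0] := hG x xG; rewrite dh0 mulr0.
apply: (@is_derive0_dominated _ _ _ h) => [z|].
  by rewrite h0 mulr0 !subr0 normrM ler_piMl// indp_norm.
by rewrite -dh0; exact: derivableP.
Qed.

Definition has_support (N : R) f := forall x, N < `|x| -> f x = 0.

Lemma integral_indp_partial h j N : classC 1 h -> has_support N h ->
  (forall x, Gamma x -> h x = 0 /\ partial j h x = 0) ->
  \int[mu]_x (indp x * partial j h x) = 0.
Proof.
move=> ch hN hG.
have dh x : derivable h x (basis_vec j) by exact: classC_derivable ch.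
have D := is_derive_indp_mul dh hG.
have E x : partial j (fun z => indp z * h z) x = indp x * partial j h x.
  by have [] := D x.
have [K _ hK] := continuous_bounded_support (classC_continuous ch) hN.
have [M _ hM] := continuous_bounded_support (classC_continuous (classC_partial j ch)) (partial_support j hN).
under eq_Rintegral do rewrite -E.
apply: (@integral_partial_eq0 _ _ _ hmu _ j M N K).
- apply: measurable_funM; first exact: measurable_indp.
  exact: continuous_measurable_rV (classC_continuous ch).
- by move=> x; apply: le_trans (hK x); rewrite normrM ler_piMl// indp_norm.
- by move=> x /hN ->; rewrite mulr0.
- by move=> x; have [] := D x.
- by move=> x; rewrite E; apply: le_trans (hM x); rewrite normrM ler_piMl// indp_norm.
Qed.

Definition divergence W x := \sum_j partial j (W j) x.

Definition compact_field W :=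
  (forall j, classC 1 (W j)) /\ exists N, forall j, has_support N (W j).

(** Orthogonality to the gradients of all local equations, which avoids the choice of a normal and
    of its orientation. *)
Definition tangential W := forall y U g, Gamma y -> local_equation Gamma y U g ->
  \sum_j W j y * partial j g y = 0.

Lemma indp_mul_integrable h N : continuous h -> has_support N h ->
  mu.-integrable setT (EFin \o (fun x => indp x * h x)).
Proof.
move=> ch hN; have [K _ hK] := continuous_bounded_support ch hN.
apply: (@integrable_bounded_support _ _ _ hmu _ K N).
- by apply: measurable_funM; [exact: measurable_indp|exact: continuous_measurable_rV].
- by move=> x; apply: le_trans (hK x); rewrite normrM ler_piMl// indp_norm.
- by move=> x /hN ->; rewrite mulr0.
Qed.

Lemma Rintegral_sum (F : 'I_d -> 'rV[R]_d -> R) :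
  (forall j, mu.-integrable setT (EFin \o F j)) ->
  \int[mu]_x (\sum_j F j x) = \sum_j \int[mu]_x F j x.
Proof.
move=> iF; have [I1 ->] // : mu.-integrable setT (EFin \o (fun x => \sum_j F j x)) /\
  \int[mu]_x (\sum_j F j x) = \sum_j \int[mu]_x F j x.
elim: (index_enum _) => [|j s [ih1 ih2]].
  rewrite big_nil; split.
    have := integrable0 mu setT; apply: eq_integrable => // x _ /=.
    by rewrite big_nil.
  by under eq_Rintegral do rewrite big_nil; rewrite Rintegral_cst// mul0r.
split.
  have := integrableD measurableT (iF j) ih1; apply: eq_integrable => // x _ /=.
  by rewrite big_cons.
by under eq_Rintegral do rewrite big_cons; rewrite RintegralD// ih2 big_cons.
Qed.

Lemma integral_indp_divergence W N : (forall j, classC 1 (W j)) ->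
  (forall j, has_support N (W j)) ->
  (forall j x, Gamma x -> W j x = 0 /\ partial j (W j) x = 0) ->
  \int[mu]_x (indp x * divergence W x) = 0.
Proof.
move=> cW WN WG; under eq_Rintegral do rewrite mulr_sumr.
rewrite Rintegral_sum => [|j]; last first.
  apply: (@indp_mul_integrable _ N); first exact: classC_continuous (classC_partial j (cW j)).
  exact: (partial_support j (WN j)).
by rewrite big1// => j _; exact: integral_indp_partial (cW j) (WN j) (WG j).
Qed.

Lemma partial_off_support h y r j : (forall x, r < `|x - y| -> h x = 0) ->
  forall x, r < `|x - y| -> partial j h x = 0.
Proof.
move=> hr x xr; rewrite (partial_in_open (U := [set x | r < `|x - y|]) (g := fun=> 0) _ _ _ hr)//.
  by rewrite partial_cst.
exact: open_norm_gt.
Qed.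

(** The localized form of the divergence theorem. The radius is the same for all fields, so that a
    single cutoff around [y] serves them all in the compactness argument. *)
Definition divergence_free_near y := exists2 r : R, 0 < r &
  forall W, compact_field W -> tangential W ->
  (forall j x, r < `|x - y| -> W j x = 0) ->
  \int[mu]_x (indp x * divergence W x) = 0.

Lemma divergence_local_off y : ~ Gamma y -> divergence_free_near y.
Proof.
move=> nG; have oG : open (~` Gamma) by apply: closed_openC; exact: interface_closed.
have [r r0 hr] := nbhs_norm_lt (open_nbhs_nbhs (conj oG nG)).
exists (r / 2); first by rewrite divr_gt0.
move=> W [cW [N WN]] _ Wr; apply: (@integral_indp_divergence W N) => // j x Gx.
have xr : r / 2 < `|x - y|.
  rewrite ltNge; apply/negP => h; apply: (hr x) Gx.
  by apply: le_lt_trans h _; rewrite ltr_pdivrMr// ltr_pMr// ltr1n.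
by split; [exact: Wr|exact: partial_off_support (Wr j) _ xr].
Qed.

(* Walking along the transverse direction reaches Gamma within |g| / c. *)
Lemma vanishing_bound y U g : Gamma y -> local_equation Gamma y U g ->
  exists2 r : R, 0 < r & (forall x, `|x - y| <= r -> U x) /\
  forall (G : 'rV[R]_d -> R) N, classC 1 G -> has_support N G ->
  (forall x, U x -> Gamma x -> G x = 0) -> (forall x, r < `|x - y| -> G x = 0) ->
  exists2 C, 0 <= C & forall x, `|G x| <= C * `|g x|.
Proof.
move=> Gy le; have [i [a [r [c [a1 r0 c0 hc]]]]] := chart le.
have cg1 : classC 1 g by have [_ _ cg _ _] := le; exact: classCS cg.
have inc := increase_along cg1 a1 (fun z zr => (hc z zr).2).
have dg z : derivable g z (basis_vec i) by exact: classC_derivable cg1.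
(* A start within [rho] of [y] followed by a walk of length at most [rho] stays within the radius
   [r] of the chart. *)
pose rho := r / 4; have rho0 : 0 < rho by rewrite divr_gt0.
exists rho => //; split => [x xr|G N cG GN GG Gr].
  by apply: (hc x _).1; rewrite /rho in xr *; lra.
have [K K0 hK] := continuous_bounded_support (classC_continuous cG) GN.
have [M M0 hM] := continuous_bounded_support (classC_continuous (classC_partial i cG)) (partial_support i GN).
have crho0 : 0 < c * rho by rewrite mulr_gt0.
(* [M / c] comes from the walk to the interface when [|g x| < c rho]; otherwise [K / (c rho)] turns
   the trivial bound [K] into a multiple of [|g x|]. *)
exists (M / c + K / (c * rho)); first by rewrite addr_ge0// divr_ge0// ltW.
move=> x; have [xr|/Gr ->] := leP `|x - y| rho; last first.
  by rewrite normr0 mulr_ge0// addr_ge0// divr_ge0// ltW.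
have [gbig|gsmall] := leP (c * rho) `|g x|.
  apply: le_trans (hK x) _; rewrite mulrDl; apply: (@le_trans _ _ (K / (c * rho) * `|g x|)).
    by rewrite mulrAC ler_pdivlMr// ler_wpM2l// ltW.
  by rewrite lerDr mulr_ge0// divr_ge0// ltW.
suff [t tb gt] : exists2 t : R, `|t| <= `|g x| / c & g (x + (t * a) *: basis_vec i) = 0.
  have tr : `|t| < rho by apply: le_lt_trans tb _; rewrite ltr_pdivrMr// mulrC.
  have tar : `|(t * a) *: (basis_vec i : 'rV[R]_d)| <= `|t|.
    rewrite normrZ normrM; have -> : `|a| = 1 by case: a1 => ->; rewrite ?normrN normr1.
    by rewrite mulr1 ler_piMr// norm_basis_vec.
  have zr : `|x + (t * a) *: basis_vec i - y| < r.
    rewrite addrAC; apply: le_lt_trans (ler_normD _ _) _.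
    by rewrite /rho in xr tr; lra.
  have Gz : G (x + (t * a) *: basis_vec i) = 0.
    by apply: GG; [exact: (hc _ zr).1|apply/(local_equationE le (hc _ zr).1)].
  have dG z : derivable G z (basis_vec i) by exact: classC_derivable cG.
  have := line_lipschitz dG hM x (t * a).
  rewrite Gz sub0r normrN normrM; have -> : `|a| = 1 by case: a1 => ->; rewrite ?normrN normr1.
  rewrite mulr1 => h; apply: le_trans h _.
  apply: (@le_trans _ _ (M / c * `|g x|)).
    by rewrite -mulrA ler_wpM2l// ?[c^-1 * _]mulrC// ltW.
  by rewrite ler_wpM2r// lerDl divr_ge0// ltW.
pose T := `|g x| / c.
have T0 : 0 <= T by rewrite divr_ge0// ltW.
have Trho : T < rho by rewrite ltr_pdivrMr// mulrC.
have cT : c * T = `|g x| by rewrite mulrC divfK// gt_eqF.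
pose F (t : R) := g (x + (t * a) *: basis_vec i).
have cF : continuous F.
  move=> t; rewrite /F (_ : (fun t => _) = (fun s => g (x + s *: basis_vec i)) \o (fun t => t * a))//.
  apply: continuous_comp; first exact: mulrr_continuous.
  have cl : continuous (fun s : R => g (x + s *: basis_vec i)) by exact: derivable_line_continuous.
  exact: cl.
have near s : `|s| <= T -> `|x + (s * a) *: basis_vec i - y| < r.
  move=> sT; rewrite addrAC; apply: le_lt_trans (ler_normD _ _) _.
  have : `|(s * a) *: (basis_vec i : 'rV[R]_d)| <= `|s|.
    rewrite normrZ normrM; have -> : `|a| = 1 by case: a1 => ->; rewrite ?normrN normr1.
    by rewrite mulr1 ler_piMr// norm_basis_vec.
  by rewrite /rho in xr Trho; lra.
have F0 : F 0 = g x by rewrite /F mul0r scale0r addr0.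
have xr' : `|x - y| < r by rewrite /rho in xr; lra.
(* The sign of [g x] decides the direction of the walk. At the end of a walk of length [T] the value
   of [g] is 0 or of the opposite sign, and the intermediate value theorem applies. *)
have [gx|gx] := leP 0 (g x).
  have h1 : F (- T) <= 0.
    have s : `|x + (- T * a) *: basis_vec i - y| < r by apply: near; rewrite normrN ger0_norm.
    have := inc (x + (- T * a) *: basis_vec i) T T0 s.
    rewrite mulNr scaleNr subrK => /(_ xr'); rewrite -scaleNr -mulNr -/(F (- T)) cT ger0_norm//; lra.
  have T0' : - T <= 0 by lra.
  have [|t] := @IVT R F (- T) 0 0 T0' (continuous_subspaceT cF).
    by rewrite F0 min_l ?max_r ?h1//; apply: le_trans gx.
  rewrite in_itv/= => /andP[t1 t2] Ft; exists t => //.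
  by rewrite ler0_norm// -[`|g x| / c]/T; lra.
have h1 : 0 <= F T.
  have := inc x T T0 xr' (near T _); rewrite ger0_norm// => /(_ (lexx _)).
  by rewrite -/(F T) cT ltr0_norm//; lra.
have [|t] := @IVT R F 0 T 0 T0 (continuous_subspaceT cF).
  have gF : g x <= F T by apply: le_trans h1; exact: ltW.
  by rewrite F0 min_l// max_r// (ltW gx) h1.
rewrite in_itv/= => /andP[t1 t2] Ft; exists t => //.
by rewrite ger0_norm.
Qed.

Lemma classC1_square_weight (n : nat) g : classC 1 g -> classC 1 (fun z => 1 + n%:R * g z ^+ 2).
Proof.
move=> cg; apply: classC_add; first exact: classC_cst.
by apply: classC_scale; exact: classC_mul.
Qed.

Lemma square_weight_gt0 (n : nat) g x : 0 < 1 + n%:R * g x ^+ 2.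
Proof. by rewrite ltr_wpDr// mulr_ge0// sqr_ge0. Qed.

(** Of order [g^2] near the interface, hence zero there together with its gradient, and tending to 1
    wherever [g] is nonzero. Being rational in [g] with a positive denominator, it inherits class
    C^1 from [g]. *)
Definition cutoff (n : nat) g z : R := 1 - (1 + n%:R * g z ^+ 2)^-1.

Lemma classC1_cutoff (n : nat) g : classC 1 g -> classC 1 (cutoff n g).
Proof.
move=> cg; apply: classC_sub; first exact: classC_cst.
by apply: classC1_inverse => [x|]; [exact: lt0r_neq0 (square_weight_gt0 n g x)|exact: classC1_square_weight].
Qed.

Lemma partial_cutoff (n : nat) g j x : classC 1 g -> partial j (cutoff n g) x =
  2 * n%:R * g x * partial j g x * (1 + n%:R * g x ^+ 2) ^- 2.
Proof.
move=> cg; have dg : is_derive x (basis_vec j) g (partial j g x).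
  by apply: derivableP; exact: classC_derivable cg.
have dw : is_derive x (basis_vec j) (fun z => 1 + n%:R * g z ^+ 2) (2 * n%:R * g x * partial j g x).
  have := is_deriveD (is_derive_cst (1:R) x (basis_vec j))
    (is_deriveM (is_derive_cst (n%:R:R) x (basis_vec j)) (is_deriveM dg dg)).
  by move=> /is_derive_eq; apply; rewrite /GRing.scale /=; ring.
have := is_deriveB (is_derive_cst (1:R) x (basis_vec j))
  (is_derive_inverse (lt0r_neq0 (square_weight_gt0 n g x)) dw).
by case=> _; rewrite /partial => ->; ring.
Qed.

Lemma cutoff0 (n : nat) g x : g x = 0 -> cutoff n g x = 0.
Proof. by move=> g0; rewrite /cutoff g0 expr0n mulr0 addr0 invr1 subrr. Qed.

Lemma divergence_mul psi W x : classC 1 psi -> (forall j, classC 1 (W j)) ->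
  divergence (fun j z => psi z * W j z) x =
  psi x * divergence W x + \sum_j W j x * partial j psi x.
Proof.
move=> cp cW; rewrite /divergence mulr_sumr -big_split; apply: eq_bigr => j _ /=.
by rewrite partialM// => z; [exact: classC_derivable cp|exact: classC_derivable (cW j)].
Qed.

Lemma inv_square_weight_le (n : nat) (s : R) : 0 < s ->
  (1 + n%:R * s)^-1 <= (1 + s^-1) * n.+1%:R^-1.
Proof.
move=> s0; have n0 : 0 <= n%:R :> R by [].
have w0 : 0 < 1 + n%:R * s by rewrite ltr_wpDr// mulr_ge0// ltW.
rewrite ler_pdivlMr// mulrC ler_pdivrMr//.
have -> : (1 + s^-1) * (1 + n%:R * s) = 1 + n%:R + (n%:R * s + s^-1).
  by field; rewrite gt_eqF.
rewrite -natr1 [n%:R + 1]addrC lerDl addr_ge0//; first by rewrite mulr_ge0// ltW.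
by rewrite invr_ge0 ltW.
Qed.

(** The truncated field [H n] vanishes with its derivatives on the interface, so its divergence has
    integral 0 on [Dp]. This divergence is the cutoff times that of [W], plus
    [2 n g G / (1 + n g^2)^2] with [G] the scalar product of [W] and [grad g]. Tangency makes [G]
    vanish on the interface, so [|G| <= C |g|], and the extra term is at most [2 C / (1 + n g^2)]:
    bounded, and tending to 0 where [g] is nonzero. Dominated convergence concludes. *)
Lemma divergence_local_on y : Gamma y -> divergence_free_near y.
Proof.
move=> Gy; have [U [g le]] := td_C2 hD Gy.
have [oU Uy cg g0 _] := le; have cg1 : classC 1 g by exact: classCS cg.
have [r r0 [rU HC]] := vanishing_bound Gy le.
exists r => // W [cW [N WN]] tW Wr.
pose G x := \sum_j W j x * partial j g x.
have cG : classC 1 G.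
  by apply: classC_sum => j; exact: (classC_mul (cW j) (classC_partial j cg)).
have GN : has_support N G by move=> x xN; rewrite /G big1// => j _; rewrite WN// mul0r.
have GG x : U x -> Gamma x -> G x = 0.
  by move=> Ux Gx; apply: (tW x U g Gx); exact: local_equation_at le Ux.
have Gr x : r < `|x - y| -> G x = 0 by move=> xr; rewrite /G big1// => j _; rewrite Wr// mul0r.
have [C C0 hC] := HC G N cG GN GG Gr.
have cDW : continuous (divergence W).
  by apply: (@classC_continuous _ _ 0); apply: classC_sum => j; exact: (classC_partial j (cW j)).
have DWN : has_support N (divergence W).
  by move=> x xN; rewrite /divergence big1// => j _; exact: (partial_support j (WN j)).
have [K K0 hK] := continuous_bounded_support cDW DWN.
pose H (n : nat) j z := cutoff n g z * W j z.
have cH (n : nat) j : classC 1 (H n j) by exact: (classC_mul (classC1_cutoff n cg1) (cW j)).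
have HN (n : nat) j : has_support N (H n j) by move=> x xN; rewrite /H WN// mulr0.
have HE (n : nat) x : divergence (H n) x = cutoff n g x * divergence W x +
    2 * n%:R * g x * (1 + n%:R * g x ^+ 2) ^- 2 * G x.
  rewrite (divergence_mul x (classC1_cutoff n cg1) cW).
  congr (_ + _); rewrite /G mulr_sumr; apply: eq_bigr => j _.
  by rewrite partial_cutoff//; ring.
pose u (n : nat) x : R := 1 + n%:R * g x ^+ 2.
have u0 (n : nat) x : 0 < u n x by exact: square_weight_gt0.
have u1 (n : nat) x : (u n x)^-1 <= 1 by rewrite invf_le1// lerDl mulr_ge0// sqr_ge0.
have Tb (n : nat) x : `|2 * n%:R * g x * (u n x) ^- 2 * G x| <= 2 * C * (u n x)^-1.
  rewrite !normrM; rewrite (ger0_norm (_ : 0 <= 2))// (ger0_norm (_ : 0 <= n%:R))//.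
  rewrite (ger0_norm (_ : 0 <= (u n x) ^- 2)); last by rewrite invr_ge0 sqr_ge0.
  apply: (@le_trans _ _ (2 * n%:R * `|g x| * u n x ^- 2 * (C * `|g x|))).
    by rewrite ler_wpM2l// !mulr_ge0// invr_ge0 sqr_ge0.
  rewrite (_ : _ * (C * _) = 2 * C * ((n%:R * `|g x| ^+ 2) * u n x ^- 2)); last by ring.
  rewrite ler_wpM2l ?mulr_ge0// real_normK ?num_real//.
  rewrite ler_pdivrMr ?exprn_gt0// -[u n x ^+ 2]/(u n x * u n x) [leRHS]mulrA mulVf ?gt_eqF// mul1r.
  by rewrite /u lerDr.
have Sb (n : nat) x : `|indp x * divergence (H n) x - indp x * divergence W x| <= (K + 2 * C) * (u n x)^-1.
  rewrite -mulrBr normrM; apply: (@le_trans _ _ `|divergence (H n) x - divergence W x|).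
    by rewrite ler_piMl// indp_norm.
  rewrite HE /cutoff -/(u n x) mulrBl mul1r.
  rewrite (_ : _ - _ = - ((u n x)^-1 * divergence W x) + 2 * n%:R * g x * u n x ^- 2 * G x); last by ring.
  apply: le_trans (ler_normD _ _) _; rewrite [leRHS]mulrDl; apply: lerD => //.
  rewrite normrN normrM ger0_norm ?invr_ge0 ?(ltW (u0 _ _))// mulrC.
  by rewrite ler_wpM2r// invr_ge0 ltW.
have int0 (n : nat) : \int[mu]_x (indp x * divergence (H n) x) = 0.
  apply: (integral_indp_divergence (cH n) (HN n)) => j x Gx.
  have [xr|xr] := leP `|x - y| r; last first.
    have Hr z : r < `|z - y| -> H n j z = 0 by move=> zr; rewrite /H Wr// mulr0.
    by split; [exact: Hr|exact: partial_off_support Hr _ xr].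
  have gx : g x = 0 by apply/(local_equationE le (rU x xr)).
  split; first by rewrite /H cutoff0// mul0r.
  rewrite /H partialM//; last 2 first.
    by move=> z; exact: classC_derivable (classC1_cutoff n cg1).
    by move=> z; exact: classC_derivable (cW j).
  by rewrite cutoff0// mul0r partial_cutoff// gx mulr0 !mul0r mulr0 addr0.
have mS (n : nat) : measurable_fun setT (fun x => indp x * divergence (H n) x).
  apply: measurable_funM; first exact: measurable_indp.
  apply: continuous_measurable_rV; apply: (@classC_continuous _ _ 0).
  by apply: classC_sum => j; exact: (classC_partial j (cH n j)).
have mS' : measurable_fun setT (fun x => indp x * divergence W x).
  by apply: measurable_funM; [exact: measurable_indp|exact: continuous_measurable_rV].
have cS x : indp x * divergence (H n) x @[n --> \oo] --> indp x * divergence W x.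
  have [xp|nxp] := pselect (Dp x); last first.
    by rewrite indp0// mul0r; under eq_fun do rewrite mul0r; exact: cvg_cst.
  (* Inside the ball a zero of [g] belongs to the interface, hence not to [Dp]; so [x] is outside
     the ball, where all the fields vanish. *)
  have [gx|gx] := eqVneq (g x) 0.
    have xr : r < `|x - y|.
      rewrite ltNge; apply/negP => xr; apply: (Dp_not_interface hD xp).
      exact/(local_equationE le (rU x xr)).
    have -> : divergence W x = 0.
      by rewrite /divergence big1// => j _; exact: partial_off_support (Wr j) _ xr.
    have E (n : nat) : indp x * divergence (H n) x = 0.
      rewrite HE Gr// mulr0 addr0 (_ : divergence W x = 0) ?mulr0//.
      by rewrite /divergence big1// => j _; exact: partial_off_support (Wr j) _ xr.
    by rewrite mulr0; under eq_fun do rewrite E; exact: cvg_cst.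
  apply/subr_cvg0; apply: norm_cvg0.
  have s0 : 0 < g x ^+ 2 by rewrite exprn_even_gt0.
  have L : ((K + 2 * C) * (1 + (g x ^+ 2)^-1)) * n.+1%:R^-1 @[n --> \oo] --> (0 : R).
    rewrite -[X in _ --> X](mulr0 ((K + 2 * C) * (1 + (g x ^+ 2)^-1))).
    by apply: cvgM; [exact: cvg_cst|exact: invnS_cvg0].
  apply: (squeeze_cvgr _ (cvg_cst 0) L); apply: nearW => n /=.
  rewrite normr_ge0/=; apply: le_trans (Sb n x) _.
  rewrite -mulrA ler_wpM2l//; first by rewrite addr_ge0 ?mulr_ge0// ltW.
  exact: inv_square_weight_le.
have dom (n : nat) x : `|indp x * divergence (H n) x| <=
    ((K + K) + 2 * C) * \1_[set x : 'rV[R]_d | `|x| <= N] x.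
  have [xN|xN] := leP `|x| N; last first.
    rewrite (_ : divergence _ x = 0); last first.
      by rewrite /divergence big1// => j _; exact: (partial_support j (HN n j)).
    rewrite mulr0 normr0 mulr_ge0 ?addr_ge0 ?mulr_ge0 ?(ltW K0)//.
  rewrite indicE mem_set// mulr1 -[_ * divergence (H n) x](subrK (indp x * divergence W x)).
  apply: le_trans (ler_normD _ _) _; rewrite addrC -addrA; apply: lerD.
    by rewrite normrM; apply: le_trans (hK x); rewrite ler_piMl// indp_norm.
  apply: le_trans (Sb n x) _; rewrite ler_piMr// addr_ge0 ?mulr_ge0// ltW//.
have := Rintegral_dominated measurableT mS mS' (aeW _ (fun x _ => cS x))
  (integrable_ball_indic hmu _ _) (fun (n : nat) x _ => dom n x).
under eq_fun do rewrite int0.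
by move=> L; have := cvg_unique _ L (cvg_cst _); exact.
Qed.

Lemma compact_field_mul psi W : classC 1 psi -> compact_field W ->
  compact_field (fun j z => psi z * W j z).
Proof.
move=> cp [cW [N WN]]; split; first by move=> j; exact: classC_mul.
by exists N => j x /WN ->; rewrite mulr0.
Qed.

Lemma tangential_mul psi W : tangential W -> tangential (fun j z => psi z * W j z).
Proof.
move=> tW y U g Gy le; under eq_bigr do rewrite -mulrA.
by rewrite -mulr_sumr (tW y U g Gy le) mulr0.
Qed.

Lemma divergence_integrable W : compact_field W ->
  mu.-integrable setT (EFin \o (fun x => indp x * divergence W x)).
Proof.
move=> [cW [N WN]]; apply: (@indp_mul_integrable _ N).
  by apply: (@classC_continuous _ _ 0); apply: classC_sum => j; exact: classC_partial.
by move=> x xN; rewrite /divergence big1// => j _; exact: (partial_support j (WN j)).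
Qed.

(** A partition of unity built along the compactness argument: a set is good if some [psi], equal to
    1 on it, makes the integral vanish for every admissible field. For a union the function is
    [a + b (1 - a)], and quantifying over all fields allows the second property to be applied to
    [(1 - a) W]. *)
Theorem divergence_tangential W : compact_field W -> tangential W ->
  \int[mu]_x (indp x * divergence W x) = 0.
Proof.
move=> kW tW; have [cW [N WN]] := kW.
pose P (A : set 'rV[R]_d) := exists psi, [/\ classC 1 psi, forall x, A x -> psi x = 1 &
  forall W, compact_field W -> tangential W ->
  \int[mu]_x (indp x * divergence (fun j z => psi z * W j z) x) = 0].
have [psi [_ psi1 H]] : P [set x | `|x| <= N].
  apply: compact_local_ind; first exact: compact_closed_ball.
  - exists (fun=> 0); split => //; first exact: classC_cst.
    move=> V kV _; rewrite (_ : (fun x => _) = cst 0) ?Rintegral_cst ?mul0r//.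
    apply/funext => x; rewrite /divergence big1 ?mulr0// => j _.
    by rewrite (_ : (fun z => _) = fun=> 0) ?partial_cst//; apply/funext => z; rewrite mul0r.
  - move=> A B [a [ca a1 Ha]] [b [cb b1 Hb]].
    exists (fun z => a z + b z * (1 - a z)); split.
    + exact: (classC_add ca (classC_mul cb (classC_sub (@classC_cst R d _ _) ca))).
    + by move=> x [/a1 ->|/b1 ->]; rewrite ?subrr ?mulr0 ?addr0// mul1r addrC subrK.
    + move=> V kV tV.
      have c1a : classC 1 (fun z => 1 - a z) by exact: (classC_sub (@classC_cst R d _ _) ca).
      have kaV := compact_field_mul ca kV.
      have kV' := compact_field_mul c1a kV; have tV' := tangential_mul (fun z => 1 - a z) tV.
      have kbV := compact_field_mul cb kV'.
      transitivity (\int[mu]_x (indp x * divergence (fun j z => a z * V j z) x +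
         indp x * divergence (fun j z => b z * ((1 - a z) * V j z)) x)).
        apply: eq_Rintegral => x _; rewrite -mulrDr; congr (_ * _).
        rewrite /divergence -big_split; apply: eq_bigr => j _ /=.
        have da z : derivable (fun z => a z * V j z) z (basis_vec j).
          exact: classC_derivable (kaV.1 j).
        have db z : derivable (fun z => b z * ((1 - a z) * V j z)) z (basis_vec j).
          exact: classC_derivable (kbV.1 j).
        rewrite -(congr1 (@^~ x) (partialD da db)); congr (partial j _ x).
        by apply/funext => z; ring.
      rewrite RintegralD//; [|exact: divergence_integrable..].
      by rewrite Ha// Hb// addr0.
  - move=> A B AB [a [ca a1 Ha]]; exists a; split => // x /AB; exact: a1.
  move=> y _; have [r r0 Hr] : divergence_free_near y.
    have [Gy|nGy] := pselect (Gamma y); first exact: divergence_local_on.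
    exact: divergence_local_off.
  (* A plateau of radius [r/3] and a transition of width [2 r/3]: [chi] vanishes beyond [r]. *)
  have r30 : 0 < r / 3 by rewrite divr_gt0.
  have [chi [cchi chi1 chi0 _]] := plateau_exists hmu y r30 r30.
  exists [set z | `|z - y| < r / 3]; first exact: norm_lt_nbhs.
  exists chi; split => //; first by move=> x /ltW /chi1.
  move=> V kV tV; apply: Hr; [exact: compact_field_mul|exact: tangential_mul|].
  by move=> j x xr; rewrite chi0 ?mul0r//; lra.
rewrite -(H W kW tW); apply: eq_Rintegral => x _; congr (_ * _).
apply: eq_bigr => j _; congr (partial j _ x); apply/funext => z.
by have [/psi1 ->|zN] := leP `|z| N; [rewrite mul1r|rewrite WN// mulr0].
Qed.

(* The distributional divergence of a piecewise C^1 field with continuous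
   normal component has no singular part on the interface. *)
Lemma weak_divergence (Vp Vm : 'I_d -> 'rV[R]_d -> R) f :
  (forall j, classC 1 (Vp j)) -> (forall j, classC 1 (Vm j)) -> classC 1 f ->
  (exists N, has_support N f) ->
  (forall y n, Gamma y -> unit_normal_into Dp Gamma y n ->
    dotrv (\row_j (Vp j y - Vm j y)) n = 0) ->
  \int[mu]_x (\sum_j (indp x * Vp j x + indm x * Vm j x) * partial j f x) =
  - \int[mu]_x ((indp x * divergence Vp x + indm x * divergence Vm x) * f x).
Proof.
move=> cp cm cf [N fN] Hn.
(* Off the interface the piecewise field is [Vm] everywhere plus [Vp - Vm] on [Dp]. Only the
   difference sees the interface, and it is tangential; [Q] is of class C^1 on the whole space, so
   its divergence integrates to 0. *)
pose W j z := f z * (Vp j z - Vm j z); pose Q j z := f z * Vm j z.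
have cd j : classC 1 (fun z => Vp j z - Vm j z) by exact: (classC_sub (cp j) (cm j)).
have kW : compact_field W.
  split; first by move=> j; apply: classC_mul.
  by exists N => j x /fN; rewrite /W => ->; rewrite mul0r.
have tW : tangential W.
  move=> y U g Gy le; under eq_bigr do rewrite -mulrA.
  rewrite -mulr_sumr [X in _ * X](_ : _ = 0) ?mulr0//.
  have := normal_condition_tangent hD Gy (fun n => Hn y n Gy) le.
  by rewrite /dotrv; under eq_bigr do rewrite !mxE.
have cQ j : classC 1 (Q j) by exact: classC_mul.
have QN j : has_support N (Q j) by move=> x /fN; rewrite /Q => ->; rewrite mul0r.
have E1 := divergence_tangential kW tW.
have contdiv V : (forall j, classC 1 (V j)) -> continuous (divergence V).
  by move=> cV; apply: (@classC_continuous _ _ 0); apply: classC_sum => j; exact: classC_partial.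
have iQ j : mu.-integrable setT (EFin \o partial j (Q j)).
  have c := classC_continuous (classC_partial j (cQ j)).
  have [K _ hK] := continuous_bounded_support c (partial_support j (QN j)).
  by apply: (integrable_bounded_support hmu _ hK (partial_support j (QN j))); exact: continuous_measurable_rV.
have E2 : \int[mu]_x divergence Q x = 0.
  rewrite Rintegral_sum// big1// => j _.
  have [K _ hK] := continuous_bounded_support (classC_continuous (cQ j)) (QN j).
  have [M _ hM] := continuous_bounded_support
    (classC_continuous (classC_partial j (cQ j))) (partial_support j (QN j)).
  apply: (@integral_partial_eq0 _ _ _ hmu _ j M N K) => //.
  - exact: continuous_measurable_rV (classC_continuous (cQ j)).
  - exact: QN.
  - by move=> x; exact: classC_derivable (cQ j).
have DQN : has_support N (divergence Q).
  by move=> x xN; rewrite /divergence big1// => j _; exact: (partial_support j (QN j)).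
have iDQ : mu.-integrable setT (EFin \o divergence Q).
  have [K _ hK] := continuous_bounded_support (contdiv Q cQ) DQN.
  apply: (integrable_bounded_support hmu _ hK DQN).
  exact: continuous_measurable_rV (contdiv Q cQ).
have iDW := divergence_integrable kW.
pose A x := \sum_j (indp x * Vp j x + indm x * Vm j x) * partial j f x.
pose B x := (indp x * divergence Vp x + indm x * divergence Vm x) * f x.
have mc h : continuous h -> measurable_fun setT h by exact: continuous_measurable_rV.
have mpj j : measurable_fun setT (partial j f) by apply: mc; exact: classC_continuous (classC_partial j cf).
have mP j : measurable_fun setT (Vp j) by apply: mc; exact: classC_continuous (cp j).
have mM j : measurable_fun setT (Vm j) by apply: mc; exact: classC_continuous (cm j).
have mip := measurable_indp; have mim := measurable_indm.
have mA : measurable_fun setT A.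
  rewrite /A; apply: measurable_sum => j; apply: measurable_funM => //.
  by apply: measurable_funD; apply: measurable_funM.
have mB : measurable_fun setT B.
  rewrite /B; apply: measurable_funM; last by apply: mc; exact: classC_continuous cf.
  by apply: measurable_funD; apply: measurable_funM => //; apply: mc; exact: contdiv.
have iA : mu.-integrable setT (EFin \o A).
  (* Replacing [|t|] by [t^2 + 1] gives a majorant whose continuity follows from the rules for
     [classC]. *)
  pose D x := \sum_j ((Vp j x * partial j f x) * (Vp j x * partial j f x) + 1 +
                      ((Vm j x * partial j f x) * (Vm j x * partial j f x) + 1)).
  have cD : continuous (fun x => D x).
    apply: (@classC_continuous _ _ 0); apply: classC_sum => j.
    have q V : (forall j, classC 1 (V j)) -> classC 0 (fun x => V j x * partial j f x).
      by move=> cV; exact: (classC_mul (classCS (cV j)) (classC_partial j cf)).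
    have q2 V : (forall j, classC 1 (V j)) -> classC 0 (fun x =>
        (V j x * partial j f x) * (V j x * partial j f x) + 1).
      by move=> cV; exact: (classC_add (classC_mul (q V cV) (q V cV)) (@classC_cst R d _ _)).
    exact: (classC_add (q2 Vp cp) (q2 Vm cm)).
  have [K K0 hK] := continuous_bounded_ball N cD.
  apply: (@integrable_bounded_support _ _ _ hmu _ K N) => // x; last first.
    by move=> xN; rewrite /A big1// => j _; rewrite (partial_support j fN) ?mulr0.
  have [xN|xN] := leP `|x| N; last first.
    rewrite /A big1 ?normr0; last by move=> j _; rewrite (partial_support j fN) ?mulr0.
    exact: ltW.
  apply: le_trans (hK x xN); apply: le_trans (ler_norm_sum _ _ _) _.
  apply: le_trans (ler_norm _); apply: ler_sum => j _.
  rewrite mulrDl -[indp x * _ * _]mulrA -[indm x * _ * _]mulrA.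
  apply: le_trans (ler_normD _ _) _; apply: lerD; rewrite normrM.
    apply: (@le_trans _ _ `|Vp j x * partial j f x|); first by rewrite ler_piMl// indp_norm.
    exact: norm_le_sqr1.
  apply: (@le_trans _ _ `|Vm j x * partial j f x|); first by rewrite ler_piMl// indm_norm.
  exact: norm_le_sqr1.
have key : {ae mu, forall x, setT x -> A x + B x = indp x * divergence W x + divergence Q x}.
  apply: (interface_ae hmu hD) => x nG _.
  rewrite (divergence_mul x cf cd) (divergence_mul x cf cm).
  have -> : divergence (fun j z => Vp j z - Vm j z) x = divergence Vp x - divergence Vm x.
    rewrite /divergence -sumrB; apply: eq_bigr => j _.
    by rewrite partialB// => z; [exact: classC_derivable (cp j)|exact: classC_derivable (cm j)].
  rewrite /A /B; have [xp|nxp] := pselect (Dp x).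
    rewrite indpE// indm0//; last exact: Dp_not_Dm hD _ xp.
    under eq_bigr do rewrite mul1r mul0r addr0.
    under [X in _ = 1 * (_ + X) + _]eq_bigr do rewrite mulrBl.
    by rewrite sumrB; ring.
  have xm := not_interface_side hD nG nxp.
  rewrite indp0// indmE//; under eq_bigr do rewrite mul1r mul0r add0r.
  by ring.
have mAB : measurable_fun setT (fun x => A x + B x) by exact: measurable_funD.
have mR : measurable_fun setT (fun x => indp x * divergence W x + divergence Q x).
  apply: measurable_funD; last exact: mc (contdiv Q cQ).
  by apply: measurable_funM => //; apply: mc; apply: contdiv => j; exact: (kW.1 j).
have iAB : mu.-integrable setT (EFin \o (fun x => A x + B x)).
  have iR := integrableD measurableT iDW iDQ.
  apply: (ae_eq_integrable measurableT mAB mR key).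
  by apply: eq_integrable iR.
have iB : mu.-integrable setT (EFin \o B).
  have := integrableB measurableT iAB iA; apply: eq_integrable => // x _ /=.
  by rewrite -EFinB addrC addKr.
apply/eqP; rewrite -addr_eq0 -RintegralD// (ae_eq_Rintegral measurableT mAB mR key).
by rewrite RintegralD// E1 E2 addr0.
Qed.

End divergence.

(** * Weak derivatives and the energy form *)

Lemma cvg_big_sum (R : realType) (I : finType) (u : I -> nat -> R) (l : I -> R) :
  (forall i, u i n @[n --> \oo] --> l i) ->
  \sum_i u i n @[n --> \oo] --> \sum_i l i.
Proof.
move=> h; elim: (index_enum I) => [|i s ih].
  by rewrite big_nil; under eq_fun do rewrite big_nil; exact: cvg_cst.
by rewrite big_cons; under eq_fun do rewrite big_cons; exact: cvgD.
Qed.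

Lemma near_dist_continuous (R : realType) (V : normedModType R) (f : V -> R) x :
  (forall e, 0 < e -> \forall z \near nbhs x, `|f x - f z| < e) -> {for x, continuous f}.
Proof. by move=> H; apply/cvgrPdist_lt => e e0; exact: H. Qed.

Section sobolev.
Context {R : realType} {d : nat}.
Variable mu : {measure set 'rV[R]_d -> \bar R}.
Hypothesis hmu : is_lebesgue mu.
Implicit Types (x y z l r : 'rV[R]_d) (i j : 'I_d) (f u v w h K : 'rV[R]_d -> R).

Definition locally_integrable h := measurable_fun setT h /\
  forall N, mu.-integrable setT (EFin \o (fun x => `|h x| * \1_[set x | `|x| <= N] x)).

Lemma in_L2_measurable u : in_L2 mu u -> measurable_fun setT u.
Proof. by rewrite /in_L2 inE => /andP[]; rewrite inE. Qed.

Lemma in_L2P u : in_L2 mu u <->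
  measurable_fun setT u /\ mu.-integrable setT (EFin \o (fun x => u x ^+ 2)).
Proof.
split=> [hu|[mu' iu]].
  by split; [exact: in_L2_measurable|exact: Lfun2_integrable_sqr].
rewrite /in_L2 inE; apply/andP; split; rewrite inE//=.
rewrite /finite_norm unlock; apply: poweR_lty.
rewrite (eq_integral (EFin \o (fun x => u x ^+ 2))).
  apply: integrable_lty => //.
by move=> x _ /=; rewrite -real_normK ?num_real// powR_mulrn.
Qed.

Lemma in_L2_bounded_support u (M N : R) : measurable_fun setT u ->
  (forall x, `|u x| <= M) -> has_support N u -> in_L2 mu u.
Proof.
move=> mu' uM uN; apply/in_L2P; split => //.
apply: (@integrable_bounded_support _ _ _ hmu _ (M ^+ 2) N).
- exact: measurable_funX.
- move=> x; rewrite normrX lerXn2r// ?nnegrE//; exact: le_trans (uM x).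
- by move=> x /uN ->; rewrite expr0n.
Qed.

Lemma in_L2_mul u v : in_L2 mu u -> in_L2 mu v ->
  mu.-integrable setT (EFin \o (fun x => u x * v x)).
Proof. by move=> hu hv; apply/Lfun1_integrable; exact: Lfun2_mul_Lfun1. Qed.

Lemma in_L2_sub u v : in_L2 mu u -> in_L2 mu v -> in_L2 mu (fun x => u x - v x).
Proof.
move=> hu hv; have /in_L2P[m1 i1] := hu; have /in_L2P[m2 i2] := hv.
apply/in_L2P; split; first exact: measurable_funB.
have i3 := in_L2_mul hu hv.
have I := integrableD measurableT (integrableB measurableT i1 (integrableZl measurableT 2 i3)) i2.
by apply: eq_integrable I => // x _ /=; congr EFin; ring.
Qed.

Lemma in_L2_locally_integrable u : in_L2 mu u -> locally_integrable u.
Proof.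
move=> hu; have m := in_L2_measurable hu; split => // N.
have mB := @measurable_closed_ball R d N.
have hB : in_L2 mu (\1_[set x | `|x| <= N] : _ -> R).
  apply: (@in_L2_bounded_support _ 1 N); first exact: measurable_indic.
    by move=> x; rewrite indicE; case: (_ \in _); rewrite ?normr1 ?normr0.
  by move=> x xN; rewrite indicE memNset// /= => h; have := lt_le_trans xN h; rewrite ltxx.
have := integrable_norm (in_L2_mul hu hB); apply: eq_integrable => // x _ /=.
by rewrite normrM [X in _ * X]ger0_norm// indicE; case: (_ \in _).
Qed.

Lemma locally_integrable_sub u v : locally_integrable u -> locally_integrable v ->
  locally_integrable (fun x => u x - v x).
Proof.
move=> [m1 i1] [m2 i2]; split; first exact: measurable_funB.
move=> N; have I := integrableD measurableT (i1 N) (i2 N).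
apply: (integrable_le measurableT _ I).
  apply: measurable_funM; last by apply: measurable_indic; exact: measurable_closed_ball.
  by apply: measurableT_comp => //; exact: measurable_funB.
move=> x _ /=; rewrite normrM normr_id -mulrDl; apply: ler_pM => //; first exact: ler_normB.
by rewrite indicE; case: (_ \in _); rewrite ?normr1 ?normr0.
Qed.

Lemma locally_integrable_mul u K (M N : R) : locally_integrable u ->
  measurable_fun setT K -> (forall x, `|K x| <= M) -> has_support N K ->
  mu.-integrable setT (EFin \o (fun x => u x * K x)).
Proof.
move=> [m1 i1] mK KM KN.
have I := integrableZl measurableT M (i1 N).
apply: (integrable_le measurableT _ I); first exact: measurable_funM.
move=> x _ /=; rewrite normrM mulrA [M * _]mulrC -mulrA; apply: ler_pM => //.
have [xN|xN] := leP `|x| N; first by rewrite indicE mem_set// mulr1.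
by rewrite KN// normr0 mulr_ge0//; apply: le_trans (KM 0).
Qed.

Lemma mollify_support n K N : has_support N K -> has_support (N + 1) (mollify mu n K).
Proof.
move=> KN x xN; have S z : n.+1%:R^-1 < `|z| -> mollifier mu n z = 0.
  by move=> zn; apply: mollifier_support; exact: ltW.
apply: (smear_support mu KN S).
by apply: le_lt_trans xN; rewrite lerD2l invf_le1// ler1n.
Qed.

Lemma mollify_test_function n K (M N : R) : measurable_fun setT K ->
  (forall x, `|K x| <= M) -> has_support N K -> test_function (mollify mu n K).
Proof.
move=> mK KM KN; rewrite /mollify; apply: (smear_test_function hmu mK KM KN).
exact: mollifier_test_function.
Qed.

Lemma test_function_measurable f : test_function f -> measurable_fun setT f.
Proof. by case=> cf _; exact: continuous_measurable_rV (classC_continuous (cf 0%N)). Qed.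

Lemma test_function_partial f i : test_function f -> test_function (partial i f).
Proof.
move=> /test_functionP [cf [N fN]]; apply/test_functionP; split.
  by move=> n; exact: classC_partial (cf n.+1).
by exists N; exact: partial_support.
Qed.

Lemma test_function_mul_integrable u f : locally_integrable u -> test_function f ->
  mu.-integrable setT (EFin \o (fun x => u x * f x)).
Proof.
move=> hu hf; have /test_functionP [cf [N fN]] := hf.
have [M _ fM] := continuous_bounded_support (classC_continuous (cf 0%N)) fN.
exact: locally_integrable_mul hu (test_function_measurable hf) fM fN.
Qed.

(** Continuity of [K] is asked almost everywhere only, which covers indicators of boxes as well as
    functions glued along the interface. *)
Lemma mollify_pairing_cvg h K (M N : R) : locally_integrable h ->
  measurable_fun setT K -> (forall x, `|K x| <= M) -> has_support N K ->
  {ae mu, forall x, {for x, continuous K}} ->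
  \int[mu]_x (h x * mollify mu n K x) @[n --> \oo] --> \int[mu]_x (h x * K x).
Proof.
move=> [mh ih] mK KM KN cK.
have I := integrableZl measurableT M (ih (N + 1)).
apply: (Rintegral_dominated measurableT _ _ _ I).
- move=> n; apply: measurable_funM => //.
  by apply: test_function_measurable; exact: mollify_test_function KM KN.
- exact: measurable_funM.
- apply: filterS cK => x cx _; apply: cvgM; first exact: cvg_cst.
  exact: mollify_cvg KM cx.
move=> n x _ /=; rewrite normrM mulrA [M * _]mulrC -mulrA; apply: ler_pM => //.
have [xN|xN] := leP `|x| (N + 1).
  by rewrite indicE mem_set// mulr1; exact: mollify_bound KM.
by rewrite (mollify_support n KN)// normr0 mulr_ge0//; apply: le_trans (KM 0).
Qed.

(** The part of the hyperplane in a ball has disjoint translates by [1/(k+1)] times a basis vector,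
    all at distance at most 1. *)
Lemma hyperplane_ae i (a : R) : {ae mu, forall x : 'rV[R]_d, x ord0 i != a}.
Proof.
have H (n : nat) : {ae mu, forall x : 'rV[R]_d, `|x| <= n%:R -> x ord0 i != a}.
  pose A := [set x : 'rV[R]_d | `|x| <= n%:R /\ x ord0 i = a].
  have mA : measurable A.
    apply: measurableI; first exact: measurable_closed_ball.
    by have := @measurable_coord R d i measurableT _ (measurable_set1 a); rewrite setTI.
  exists A; split => //; last first.
    by move=> x /= /not_implyP [xn /negP]; rewrite negbK => /eqP.
  pose v (k : nat) : 'rV[R]_d := k.+1%:R^-1 *: basis_vec i.
  have vn k : `|v k| <= 1.
    rewrite normrZ ger0_norm//; apply: le_trans (ler_wpM2l _ (norm_basis_vec i)) _ => //.
    by rewrite mulr1 invf_le1// ler1n.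
  apply: (disjoint_translates_null hmu (M := n%:R + 1) (v := v) mA).
    move=> k x [xk _]; rewrite -[x](subrK (v k)); apply: le_trans (ler_normD _ _) _.
    exact: lerD.
  move=> k l x [_ xk] [_ xl]; move: xk xl; rewrite !mxE !eqxx /= !mulr1 => <-.
  move=> /(congr1 (fun t => x ord0 i - t)).
  by rewrite !subKr => /invr_inj /eqP; rewrite eqr_nat eqSS => /eqP.
apply: filterS (ae_foralln H) => x hx.
by apply: (hx (Num.trunc `|x|).+1); apply: ltW; exact: truncnS_gt.
Qed.

Lemma box_indic_continuous_ae l r :
  {ae mu, forall x, {for x, continuous (\1_(box l r) : 'rV[R]_d -> R)}}.
Proof.
have H : {ae mu, forall x : 'rV[R]_d, forall i, x ord0 i != l ord0 i /\ x ord0 i != r ord0 i}.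
  apply: filter_forall => i; apply: filterS2 (hyperplane_ae i (l ord0 i)) (hyperplane_ae i (r ord0 i)).
  by move=> x.
apply: filterS H => x hx.
have E : \forall z \near nbhs x, \1_(box l r) x = \1_(box l r) (z : 'rV[R]_d) :> R.
  have E1 : \forall z \near nbhs x, forall i,
     (l ord0 i < (z : 'rV[R]_d) ord0 i <= r ord0 i) = (l ord0 i < x ord0 i <= r ord0 i).
    apply: filter_forall => i; have [xl xr] := hx i.
    have cx := @continuous_coord R d i x.
    have A : \forall z \near nbhs x, (l ord0 i < (z : 'rV[R]_d) ord0 i) = (l ord0 i < x ord0 i).
      have [h|h|h] := ltgtP (l ord0 i) (x ord0 i); last by rewrite h eqxx in xl.
        exact: (cvgr_gt _ cx).
      have H : \forall z \near nbhs x, (z : 'rV[R]_d) ord0 i < l ord0 i by exact: (cvgr_lt _ cx).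
      by apply: filterS H => z zl; apply/negbTE; rewrite -leNgt ltW.
    have B : \forall z \near nbhs x, ((z : 'rV[R]_d) ord0 i <= r ord0 i) = (x ord0 i <= r ord0 i).
      have [h|h|h] := ltgtP (x ord0 i) (r ord0 i); last by rewrite h eqxx in xr.
        have H : \forall z \near nbhs x, (z : 'rV[R]_d) ord0 i < r ord0 i by exact: (cvgr_lt _ cx).
        by apply: filterS H => z; exact: ltW.
      have H : \forall z \near nbhs x, r ord0 i < (z : 'rV[R]_d) ord0 i by exact: (cvgr_gt _ cx).
      by apply: filterS H => z zl; apply/negbTE; rewrite -ltNge.
    by apply: filterS2 A B => z -> ->.
  apply: filterS E1 => z hz; rewrite !indicE; congr ((nat_of_bool _)%:R).
  have Ez : box l r z <-> box l r x.
    by split=> hb i; have := hb i; rewrite /= hz.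
  by apply/idP/idP; rewrite !inE => /Ez.
apply: near_dist_continuous => e e0.
by apply: filterS E => z <-; rewrite subrr normr0.
Qed.

Lemma box_bounded l r : exists N, forall x, box l r x -> `|x| <= N.
Proof.
exists (`|l| + `|r|) => x hx; apply: rV_norm_le; first exact: addr_ge0.
move=> i; have /andP[a b] := hx i.
have := coord_le_norm l i; have := coord_le_norm r i.
rewrite !ler_norml => /andP[c1 c2] /andP[c3 c4].
have := normr_ge0 l; have := normr_ge0 r.
by move=> *; apply/andP; split; lra.
Qed.

Lemma box_indic_support l r : exists N, has_support N (\1_(box l r) : 'rV[R]_d -> R).
Proof.
have [N hN] := box_bounded l r; exists N => x xN.
by rewrite indicE memNset// => /hN h; have := lt_le_trans xN h; rewrite ltxx.
Qed.

Lemma box_indic_bound l r x : `|\1_(box l r) x : R| <= 1.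
Proof. by rewrite indicE; case: (_ \in _); rewrite ?normr1 ?normr0. Qed.

Lemma box_indic_measurable l r : measurable_fun setT (\1_(box l r) : 'rV[R]_d -> R).
Proof. by apply: measurable_indic; exact: measurable_box. Qed.

Lemma locally_integrable_box h l r : locally_integrable h ->
  mu.-integrable (box l r) (EFin \o h).
Proof.
move=> lh; apply/(integrable_mkcond _ (measurable_box l r)).2.
have [N hN] := box_indic_support l r.
have I := locally_integrable_mul lh (box_indic_measurable l r) (box_indic_bound l r) hN.
apply: eq_integrable I => // x _ /=; rewrite /patch indicE.
by case: ifP => _; rewrite ?mulr1 ?mulr0.
Qed.

Lemma ae_eq0_box_pairing h : locally_integrable h ->
  (forall l r, \int[mu]_x (h x * \1_(box l r) x) = 0) -> {ae mu, forall x, h x = 0}.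
Proof.
move=> lh h0; apply: ae_eq0_boxes => [|l r|l r].
- by case: lh.
- exact: locally_integrable_box.
- by rewrite -integral_box_indic -(h0 l r); apply: eq_Rintegral => x _; rewrite mulrC.
Qed.

(** Mollified indicators of boxes are test functions, and the indicators are continuous off the
    faces of the box. *)
Lemma ae_eq0_test_functions h : locally_integrable h ->
  (forall f, test_function f -> \int[mu]_x (h x * f x) = 0) ->
  {ae mu, forall x, h x = 0}.
Proof.
move=> lh h0; apply: ae_eq0_box_pairing => // l r.
have [N hN] := box_indic_support l r.
have m := box_indic_measurable l r; have b := box_indic_bound l r.
have := mollify_pairing_cvg lh m b hN (box_indic_continuous_ae l r).
have E n : \int[mu]_x (h x * mollify mu n \1_(box l r) x) = 0.
  by apply: h0; exact: mollify_test_function m b hN.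
under eq_fun do rewrite E.
by move=> L; have := cvg_unique _ L (cvg_cst _); exact.
Qed.

Lemma weak_partial_unique i u w1 w2 : in_L2 mu w1 -> in_L2 mu w2 ->
  weak_partial mu i u w1 -> weak_partial mu i u w2 -> {ae mu, forall x, w1 x = w2 x}.
Proof.
move=> h1 h2 d1 d2.
have l1 := in_L2_locally_integrable h1; have l2 := in_L2_locally_integrable h2.
have : {ae mu, forall x, w1 x - w2 x = 0}; last first.
  by apply: filterS => x /eqP; rewrite subr_eq0 => /eqP.
apply: ae_eq0_test_functions => [|f hf]; first exact: locally_integrable_sub.
under eq_Rintegral do rewrite mulrBl.
rewrite RintegralB//; [|exact: test_function_mul_integrable..].
by apply/eqP; rewrite subr_eq0 -eqr_opp -d1// -d2.
Qed.

Lemma weakDP i u : in_H1 mu u -> in_L2 mu (weakD mu i u) /\ weak_partial mu i u (weakD mu i u).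
Proof. by move=> [_ /(_ i)]; exact: getPex. Qed.

(** Makes the choice inside [weakD] harmless: any explicit square-integrable weak derivative may be
    substituted for it in integrals. *)
Lemma weakD_unique i u w : in_L2 mu w -> weak_partial mu i u w ->
  {ae mu, forall x, weakD mu i u x = w x}.
Proof.
move=> hw dw; have [h1 d1] : in_L2 mu (weakD mu i u) /\ weak_partial mu i u (weakD mu i u).
  exact: (@getPex _ [set w | in_L2 mu w /\ weak_partial mu i u w] (ex_intro _ w (conj hw dw))).
exact: weak_partial_unique h1 hw d1 dw.
Qed.

End sobolev.

(** * Green's formula for the transmission problem *)

Section transmission_green.
Context {R : realType} {d : nat}.
Variable mu : {measure set 'rV[R]_d -> \bar R}.
Hypothesis hmu : is_lebesgue mu.
Variables (Dp Dm : set 'rV[R]_d) (hD : transmission_domains Dp Dm).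
Implicit Types (x y z n : 'rV[R]_d) (i j : 'I_d) (a b f u v w h : 'rV[R]_d -> R).
Local Notation Gamma := (interface Dp Dm).

(** The value on the interface, a null set, is 0. *)
Definition glue a b x : R := indp Dp x * a x + indm Dm x * b x.

Lemma glue_p a b x : Dp x -> glue a b x = a x.
Proof.
move=> xp; rewrite /glue indpE// mul1r indm0 ?mul0r ?addr0//.
exact: (Dp_not_Dm hD).
Qed.

Lemma glue_m a b x : Dm x -> glue a b x = b x.
Proof.
move=> xm; rewrite /glue indmE// mul1r indp0 ?mul0r ?add0r// => xp.
exact: (Dp_not_Dm hD xp xm).
Qed.

Lemma glue_measurable a b : measurable_fun setT a -> measurable_fun setT b ->
  measurable_fun setT (glue a b).
Proof.
move=> ma mb; apply: measurable_funD; apply: measurable_funM => //.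
  exact: (measurable_indp hD).
exact: (measurable_indm hD).
Qed.

Lemma glue_support a b N : has_support N a -> has_support N b -> has_support N (glue a b).
Proof. by move=> aN bN x xN; rewrite /glue aN// bN// !mulr0 addr0. Qed.

Lemma glue_bound a b M x : (Dp x -> `|a x| <= M) -> (Dm x -> `|b x| <= M) -> 0 <= M ->
  `|glue a b x| <= M.
Proof.
move=> aM bM M0; have [xp|nxp] := pselect (Dp x); first by rewrite glue_p// aM.
have [xm|nxm] := pselect (Dm x); first by rewrite glue_m// bM.
by rewrite /glue indp0// indm0// !mul0r addr0 normr0.
Qed.

Lemma glue_bounded_support a b N : continuous a -> continuous b ->
  has_support N a -> has_support N b -> exists2 M, 0 < M & forall x, `|glue a b x| <= M.
Proof.
move=> ca cb aN bN; have [A A0 hA] := continuous_bounded_support ca aN.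
have [B B0 hB] := continuous_bounded_support cb bN.
exists (A + B) => [|x]; first exact: addr_gt0.
apply: glue_bound => [_|_|]; last by rewrite addr_ge0// ltW.
  by apply: le_trans (hA x) _; rewrite lerDl ltW.
by apply: le_trans (hB x) _; rewrite lerDr ltW.
Qed.

Lemma glue_continuous_ae a b : continuous a -> continuous b ->
  {ae mu, forall x, {for x, continuous (glue a b)}}.
Proof.
move=> ca cb; apply: (interface_ae hmu hD) => x nG.
case: (domains_cover hD x) => [xp|[xm|//]]; apply: near_dist_continuous => e e0.
  have := continuous_near_dist (ca x) e0.
  apply: filterS2 (open_nbhs_nbhs (conj (td_openp hD) xp)) => z zp.
  by rewrite !glue_p.
have := continuous_near_dist (cb x) e0.
apply: filterS2 (open_nbhs_nbhs (conj (td_openm hD) xm)) => z zm.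
by rewrite !glue_m.
Qed.

Lemma divergence_classC0 V : (forall j, classC 1 (V j)) -> continuous (@divergence R d V).
Proof.
move=> cV; apply: (@classC_continuous _ _ 0); apply: classC_sum => j.
exact: classC_partial.
Qed.

Lemma divergence_support V N : (forall j, has_support N (V j)) ->
  has_support N (@divergence R d V).
Proof.
move=> VN x xN; rewrite /divergence big1// => j _; exact: (partial_support j (VN j)).
Qed.

(** At fixed [x] the translated mollifier is a test function of [y], so [weak_divergence] moves the
    derivatives from it back to the field: mollification commutes with the piecewise divergence,
    without any contribution of the interface. *)
Lemma divergence_mollify (Vp Vm : 'I_d -> 'rV[R]_d -> R) (N : R) (k : nat) x :
  (forall j, classC 1 (Vp j)) -> (forall j, classC 1 (Vm j)) ->
  (forall j, has_support N (Vp j)) -> (forall j, has_support N (Vm j)) ->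
  (forall y n, Gamma y -> unit_normal_into Dp Gamma y n ->
    dotrv (\row_j (Vp j y - Vm j y)) n = 0) ->
  \sum_j partial j (mollify mu k (glue (Vp j) (Vm j))) x =
  mollify mu k (glue (divergence Vp) (divergence Vm)) x.
Proof.
move=> cp cm pN mN Hn.
have c0 V j : classC 1 (V j) -> continuous (V j) by exact: classC_continuous.
have mV j : measurable_fun setT (glue (Vp j) (Vm j)).
  by apply: glue_measurable; apply: continuous_measurable_rV; exact: c0.
have bV j : exists2 M, 0 < M & forall x, `|glue (Vp j) (Vm j) x| <= M.
  by apply: glue_bounded_support (pN j) (mN j); exact: c0.
have tm := mollifier_test_function mu k.
have df i z : derivable (mollifier mu k) z (basis_vec i).
  exact: classC_derivable (mollifier_classC mu 1 k).
have E j : partial j (mollify mu k (glue (Vp j) (Vm j))) x =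
    - \int[mu]_y (glue (Vp j) (Vm j) y * partial j (fun y => mollifier mu k (y - x)) y).
  have [M _ hM] := bV j.
  rewrite /mollify (partial_smear hmu (mV j) hM (glue_support (pN j) (mN j)) j tm).
  rewrite /smear (partial_shift (- x) (df j)) -mulN1r -RintegralZl//.
    by apply: eq_Rintegral => y _; rewrite mulrN mulN1r.
  have /test_functionP [cf [N' fN]] := test_function_partial j tm.
  have [M' _ hM'] := continuous_bounded_support (classC_continuous (cf 0%N)) fN.
  apply: (@integrable_bounded_support _ _ _ hmu _ (M * M') N).
  - apply: measurable_funM => //.
    have tp := test_function_measurable (test_function_partial j tm).
    by apply: (measurableT_comp tp); exact: measurable_shift.
  - by move=> y; rewrite normrM; exact: ler_pM.
  - by move=> y yN; rewrite (glue_support (pN j) (mN j))// mul0r.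
under eq_bigr do rewrite E.
rewrite sumrN -Rintegral_sum; last first.
  move=> j; have [M _ hM] := bV j.
  have hV : in_L2 mu (glue (Vp j) (Vm j)).
    by apply: (in_L2_bounded_support hmu (mV j) hM (glue_support (pN j) (mN j))).
  have tx : test_function (fun y => mollifier mu k (y - x)).
    apply/test_functionP; split; first by move=> m; exact: classC_shift (mollifier_classC mu m k).
    exists (`|x| + k.+1%:R^-1) => y yN; apply: mollifier_support.
    apply: ltW; apply: lt_le_trans (lerB_dist _ _); rewrite ltrBrDl; exact: yN.
  apply: test_function_mul_integrable (test_function_partial j tx).
  exact: in_L2_locally_integrable hV.
have cx : classC 1 (fun y => mollifier mu k (y - x)).
  exact: classC_shift (mollifier_classC mu 1 k).
have sx : exists N', has_support N' (fun y => mollifier mu k (y - x)).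
  exists (`|x| + k.+1%:R^-1) => y yN; apply: mollifier_support.
  by apply: ltW; apply: lt_le_trans (lerB_dist _ _); rewrite ltrBrDl; exact: yN.
by rewrite (weak_divergence hmu hD cp cm cx sx Hn) opprK.
Qed.

(** Weak derivatives are tested against smooth functions, and the glued field may jump. It is
    mollified, [divergence_mollify] gives its divergence, and both sides pass to the limit because
    glued functions are continuous almost everywhere. *)
Lemma green_weak u (D : 'I_d -> 'rV[R]_d -> R) (Vp Vm : 'I_d -> 'rV[R]_d -> R) (N : R) :
  in_L2 mu u -> (forall j, in_L2 mu (D j)) -> (forall j, weak_partial mu j u (D j)) ->
  (forall j, classC 1 (Vp j)) -> (forall j, classC 1 (Vm j)) ->
  (forall j, has_support N (Vp j)) -> (forall j, has_support N (Vm j)) ->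
  (forall y n, Gamma y -> unit_normal_into Dp Gamma y n ->
    dotrv (\row_j (Vp j y - Vm j y)) n = 0) ->
  \sum_j \int[mu]_x (D j x * glue (Vp j) (Vm j) x) =
  - \int[mu]_x (u x * glue (divergence Vp) (divergence Vm) x).
Proof.
move=> hu hDu dDu cp cm pN mN Hn.
have c0 V j : classC 1 (V j) -> continuous (V j) by exact: classC_continuous.
have mV j : measurable_fun setT (glue (Vp j) (Vm j)).
  by apply: glue_measurable; apply: continuous_measurable_rV; exact: c0.
have bV j : exists2 M, 0 < M & forall x, `|glue (Vp j) (Vm j) x| <= M.
  by apply: glue_bounded_support (pN j) (mN j); exact: c0.
have cpd := divergence_classC0 cp; have cmd := divergence_classC0 cm.
have mDv : measurable_fun setT (glue (divergence Vp) (divergence Vm)).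
  by apply: glue_measurable; apply: continuous_measurable_rV.
have pdN := divergence_support pN; have mdN := divergence_support mN.
have [Md _ hMd] := glue_bounded_support cpd cmd pdN mdN.
have lu := in_L2_locally_integrable hmu hu.
have test k j : test_function (mollify mu k (glue (Vp j) (Vm j))).
  have [M _ hM] := bV j.
  exact: mollify_test_function (mV j) hM (glue_support (pN j) (mN j)).
have L1 : \sum_j \int[mu]_x (D j x * mollify mu k (glue (Vp j) (Vm j)) x) @[k --> \oo]
    --> \sum_j \int[mu]_x (D j x * glue (Vp j) (Vm j) x).
  apply: cvg_big_sum => j; have [M _ hM] := bV j.
  apply: (mollify_pairing_cvg hmu _ (mV j) hM (glue_support (pN j) (mN j))).
    exact: in_L2_locally_integrable.
  by apply: glue_continuous_ae; exact: c0.
have L2 : (- \int[mu]_x (u x * mollify mu k (glue (divergence Vp) (divergence Vm)) x)) @[k --> \oo]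
    --> - \int[mu]_x (u x * glue (divergence Vp) (divergence Vm) x).
  apply: cvgN; apply: (mollify_pairing_cvg hmu lu mDv hMd (glue_support pdN mdN)).
  exact: glue_continuous_ae.
have E k : - (\int[mu]_x (u x * mollify mu k (glue (divergence Vp) (divergence Vm)) x)) =
   \sum_j \int[mu]_x (D j x * mollify mu k (glue (Vp j) (Vm j)) x).
  under eq_Rintegral do rewrite -(divergence_mollify k _ cp cm pN mN Hn) mulr_sumr.
  rewrite Rintegral_sum; last first.
    by move=> j; apply: test_function_mul_integrable lu _; exact: test_function_partial.
  rewrite -sumrN; apply: eq_bigr => j _.
  by rewrite (dDu j _ (test k j)) opprK.
move: L2; under eq_fun do rewrite E.
by move=> L2; exact: (cvg_unique _ L1 L2).
Qed.

Variables (ep em : R).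

(* The pieces on the two sides of a compactly supported function in the
   transmission domain. *)
Record transmission_pair (psip psim : 'rV[R]_d -> R) (N : R) : Prop := {
  tp_C2p : classC 2 psip; tp_C2m : classC 2 psim;
  tp_suppp : has_support N psip; tp_suppm : has_support N psim;
  tp_continuous : forall y, Gamma y -> psip y = psim y;
  tp_flux : forall y n, Gamma y -> unit_normal_into Dp Gamma y n ->
    dotrv (\row_j (ep * partial j psip y - em * partial j psim y)) n = 0 }.

Definition laplacian h x : R := \sum_i partial i (partial i h) x.

Definition transmission_laplacian (psip psim : 'rV[R]_d -> R) :=
  glue (fun x => ep * laplacian psip x) (fun x => em * laplacian psim x).

Section pair.
Variables (psip psim : 'rV[R]_d -> R) (N : R).
Hypothesis tp : transmission_pair psip psim N.
Let psi := glue psip psim.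
Let dpsi i := glue (partial i psip) (partial i psim).

Let cp1 : classC 1 psip. Proof. exact: classCS (tp_C2p tp). Qed.
Let cm1 : classC 1 psim. Proof. exact: classCS (tp_C2m tp). Qed.

Lemma glue_in_L2 a b : continuous a -> continuous b -> has_support N a ->
  has_support N b -> in_L2 mu (glue a b).
Proof.
move=> ca cb aN bN; have [M _ hM] := glue_bounded_support ca cb aN bN.
apply: (in_L2_bounded_support hmu _ hM (glue_support aN bN)).
by apply: glue_measurable; exact: continuous_measurable_rV.
Qed.

Lemma transmission_in_L2 : in_L2 mu psi.
Proof.
apply: glue_in_L2 (tp_suppp tp) (tp_suppm tp).
  exact: classC_continuous cp1.
exact: classC_continuous cm1.
Qed.

Lemma transmission_partial_in_L2 i : in_L2 mu (dpsi i).
Proof.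
apply: glue_in_L2 (partial_support i (tp_suppp tp)) (partial_support i (tp_suppm tp)).
  exact: classC_continuous (classC_partial i cp1).
exact: classC_continuous (classC_partial i cm1).
Qed.

(** [weak_divergence] for the field whose only component is the [i]-th, equal to [psip] and [psim]
    on the two sides: it has no jump since these agree on the interface. *)
Lemma transmission_weak_partial i : weak_partial mu i psi (dpsi i).
Proof.
move=> f hf; have /test_functionP [cf [N' fN]] := hf.
pose e j : 'rV[R]_d -> R := fun _ => (j == i)%:R.
have ce j : classC 1 (e j) by exact: classC_cst.
have c1 j : classC 1 (fun x => e j x * psip x) by exact: (classC_mul (ce j) cp1).
have c2 j : classC 1 (fun x => e j x * psim x) by exact: (classC_mul (ce j) cm1).
have fN' : exists N, has_support N f by exists N'.
have := weak_divergence hmu hD c1 c2 (cf 1%N) fN'.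
have dE (h : 'rV[R]_d -> R) x : classC 1 h ->
    divergence (fun j x => e j x * h x) x = partial i h x.
  move=> ch; rewrite /divergence (bigD1 i)//= big1 ?addr0.
    by rewrite partialZ ?eqxx ?mul1r// => z; exact: classC_derivable ch.
  move=> j ji; rewrite partialZ; last by move=> z; exact: classC_derivable ch.
  by rewrite (negbTE ji) mul0r.
move=> WD; transitivity (\int[mu]_x (\sum_j (indp Dp x * (e j x * psip x) +
    indm Dm x * (e j x * psim x)) * partial j f x)).
  apply: eq_Rintegral => x _; rewrite (bigD1 i)//= big1 ?addr0.
    by rewrite /e eqxx !mul1r.
  by move=> j /negbTE ji; rewrite /e ji !mul0r !mulr0 addr0 mul0r.
rewrite WD => [|y n Gy _]; last first.
  rewrite /dotrv big1// => j _; rewrite mxE (tp_continuous tp Gy) subrr mul0r//.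
congr (- _); apply: eq_Rintegral => x _; congr (_ * _).
by rewrite /dpsi /glue !dE.
Qed.

Lemma transmission_in_H1 : in_H1 mu psi.
Proof.
split; first exact: transmission_in_L2.
move=> i; exists (dpsi i); split; first exact: transmission_partial_in_L2.
exact: transmission_weak_partial.
Qed.

Lemma transmission_laplacian_in_L2 : in_L2 mu (transmission_laplacian psip psim).
Proof.
have cl h : classC 2 h -> continuous (laplacian h).
  move=> ch; apply: (@classC_continuous _ _ 0); apply: classC_sum => j.
  by do 2 apply: classC_partial.
have sl h : has_support N h -> has_support N (laplacian h).
  move=> hN x xN; rewrite /laplacian big1// => j _.
  exact: (partial_support j (partial_support j hN)).
apply: glue_in_L2.
- by apply: (@classC_continuous _ _ 0); apply: classC_scale; split => //; exact: cl (tp_C2p tp).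
- by apply: (@classC_continuous _ _ 0); apply: classC_scale; split => //; exact: cl (tp_C2m tp).
- by move=> x xN; rewrite (sl _ (tp_suppp tp))// mulr0.
- by move=> x xN; rewrite (sl _ (tp_suppm tp))// mulr0.
Qed.

(** Green's formula for the field [ep grad psip] on one side and [em grad psim] on the other: the
    flux condition says precisely that it has no normal jump. The chosen weak derivatives of [psi]
    are replaced by the piecewise ones almost everywhere. *)
Lemma energy_transmission u : in_H1 mu u ->
  energy mu (fun x => (diffusivity ep em Dp Dm x)%:M) u psi =
  - \int[mu]_x (u x * transmission_laplacian psip psim x).
Proof.
move=> hu.
have hD1 j := (weakDP j hu).1; have hD2 j := (weakDP j hu).2.
have cVp j : classC 1 (fun x => ep * partial j psip x).
  by apply: classC_scale; exact: classC_partial (tp_C2p tp).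
have cVm j : classC 1 (fun x => em * partial j psim x).
  by apply: classC_scale; exact: classC_partial (tp_C2m tp).
have sVp j : has_support N (fun x => ep * partial j psip x).
  by move=> x xN; rewrite (partial_support j (tp_suppp tp))// mulr0.
have sVm j : has_support N (fun x => em * partial j psim x).
  by move=> x xN; rewrite (partial_support j (tp_suppm tp))// mulr0.
have dE (c : R) h x : classC 2 h ->
    divergence (fun j x => c * partial j h x) x = c * laplacian h x.
  move=> ch; rewrite /divergence /laplacian mulr_sumr; apply: eq_bigr => j _.
  by rewrite partialZ// => z; exact: classC_derivable (classC_partial j ch).
have := green_weak hu.1 hD1 hD2 cVp cVm sVp sVm (tp_flux tp).
rewrite (_ : glue (divergence _) (divergence _) = transmission_laplacian psip psim); last first.
  apply/funext => x; rewrite /transmission_laplacian /glue.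
  by rewrite (dE ep psip x (tp_C2p tp)) (dE em psim x (tp_C2m tp)).
move=> <-; rewrite /energy; apply: eq_bigr => i _.
rewrite (bigD1 i)//= [X in _ + X]big1 ?addr0; last first.
  move=> j ji; rewrite (_ : (fun x => _) = cst 0) ?Rintegral_cst ?mul0r//.
  by apply/funext => x; rewrite mxE eq_sym (negbTE ji) mulr0n !mul0r.
have mW v : in_H1 mu v -> measurable_fun setT (weakD mu i v).
  by move=> hv; have [/in_L2_measurable] := weakDP i hv.
have meps : measurable_fun setT (diffusivity ep em Dp Dm).
  apply: measurable_funD; apply: measurable_funM => //; apply: measurable_indic.
    by apply: closed_measurable_rV; exact: closed_closure.
  exact: Dm_measurable hD.
apply: ae_eq_Rintegral => //.
- apply: measurable_funM; last exact: mW transmission_in_H1.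
  apply: measurable_funM; last exact: mW.
  by under eq_fun do rewrite mxE eqxx mulr1n.
- apply: measurable_funM; first exact: mW.
  by apply: glue_measurable; apply: continuous_measurable_rV;
    [exact: classC_continuous (cVp i)|exact: classC_continuous (cVm i)].
have A := weakD_unique hmu (transmission_partial_in_L2 i) (@transmission_weak_partial i).
have B : {ae mu, forall x, ~ Gamma x} by apply: (interface_ae hmu hD).
apply: filterS2 A B => x E nG _; rewrite E mxE eqxx mulr1n /dpsi /diffusivity.
case: (domains_cover hD x) => [xp|[xm|//]].
  have xm := Dp_not_Dm hD xp.
  rewrite !glue_p// !indicE (mem_set (subset_closure xp)) (memNset xm) mulr1 mulr0 addr0.
  by ring.
have nc := Dm_not_closureDp hD xm.
rewrite !glue_m// !indicE (memNset nc) (mem_set xm) mulr1 mulr0 add0r.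
by ring.
Qed.

End pair.
End transmission_green.

(** * Mixtures, densities and transition operators *)

Section mixture.
Local Open Scope ereal_scope.
Context d1 d2 (Y : measurableType d1) (Z : measurableType d2) (R : realType).
Variables (m : {measure set Z -> \bar R}) (nu : {measure set Y -> \bar R}).
Variables (D : set Y) (mD : measurable D) (k : Y -> {measure set Z -> \bar R}).
Hypothesis mk : forall B, measurable B -> measurable_fun setT (fun y => k y B).
Hypothesis mE : forall B, measurable B -> m B = \int[nu]_(y in D) k y B.

Import HBNNSimple.

Let mixture_nnsfun (g : {nnsfun Z >-> R}) :
  \int[m]_z (g z)%:E = \int[nu]_(y in D) \int[k y]_z (g z)%:E.
Proof.
have mA r : measurable (g @^-1` [set r]) by rewrite -[X in measurable X]setTI; exact: measurable_funP.
have g0 r : r \in range g -> (0 <= r)%R by rewrite inE => -[z _ <-].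
(* One finite list of values that serves every measure [l], so that [m] and all the [k y] are
   expanded along the same sum. *)
have [S [S0 E]] : exists S : seq R, all (fun r => 0 <= r)%R S /\
    forall l : {measure set Z -> \bar R}, \int[l]_z (g z)%:E =
      \sum_(r <- S) (r%:E * l (g @^-1` [set r])).
  have fg : finite_set (range g) by exact: fimfunP.
  exists (finmap.enum_fset (fset_set (range g))); split.
    by apply/allP => r rS; apply: g0; rewrite -(in_fset_set fg).
  by move=> l; rewrite integralT_nnsfun sintegralE fsbig_finite.
rewrite E; under eq_integral do rewrite E.
have mk' r : measurable_fun D (fun y => k y (g @^-1` [set r])).
  by apply: measurable_funTS; exact: mk.
elim: S S0 {E} => [_|r S ih /= /andP[r0 S0]].
  rewrite big_nil; under eq_integral do rewrite big_nil.
  by rewrite integral0.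
rewrite big_cons; under eq_integral do rewrite big_cons.
rewrite ge0_integralD//.
- by rewrite -ih//; congr (_ + _); rewrite mE// ge0_integralZl.
- by move=> y _; rewrite mule_ge0.
- exact: measurable_funeM.
- by move=> y _; rewrite big_seq; apply: sume_ge0 => r' r'S; rewrite mule_ge0// lee_fin (allP S0).
elim: S {ih S0} => [|r' S ih'].
  by under eq_fun do rewrite big_nil; exact: measurable_cst.
by under eq_fun do rewrite big_cons; apply: emeasurable_funD => //; exact: measurable_funeM.
Qed.

(** Linearity on simple functions, then monotone convergence on both sides. The Markov property and
    the use of densities are both read as mixtures. *)
Lemma ge0_integral_mixture (f : Z -> \bar R) : measurable_fun setT f ->
  (forall z, 0 <= f z) -> \int[m]_z f z = \int[nu]_(y in D) \int[k y]_z f z.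
Proof.
move=> mf f0; pose g := nnsfun_approx measurableT mf.
have mg n : measurable_fun setT (EFin \o g n) by exact/measurable_EFinP.
have g0 n z : 0 <= (EFin \o g n) z by rewrite lee_fin.
have ndg z : nondecreasing_seq (fun n => (EFin \o g n) z).
  by move=> a b ab; rewrite lee_fin; exact/lefP/nd_nnsfun_approx.
have cg z : f z = limn (fun n => (EFin \o g n) z).
  by apply/esym/cvg_lim => //; exact: cvg_nnsfun_approx.
have L (l : {measure set Z -> \bar R}) : \int[l]_z f z = limn (fun n => \int[l]_z (g n z)%:E).
  under eq_integral do rewrite cg.
  by rewrite monotone_convergence.
rewrite L; under eq_fun do rewrite mixture_nnsfun.
under eq_integral do rewrite L.
rewrite monotone_convergence//.
- move=> n; apply: measurable_funTS; exact: (measurable_fun_integral_kernel mk (g0 n) (mg n)).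
- by move=> n y _; apply: integral_ge0 => z _; exact: g0.
- move=> y _ a b ab; apply: ge0_le_integral => //.
  - by move=> z _; exact: g0.
  - exact: mg.
  - exact: mg.
  - by move=> z _; exact: ndg.
Qed.

End mixture.

Section mixture_real.
Context d1 d2 (Y : measurableType d1) (Z : measurableType d2) (R : realType).
Variables (m : {measure set Z -> \bar R}) (nu : {measure set Y -> \bar R}).
Variables (D : set Y) (mD : measurable D) (k : Y -> probability Z R).
Hypothesis mk : forall B, measurable B -> measurable_fun setT (fun y => k y B).
Hypothesis mE : forall B, measurable B -> m B = (\int[nu]_(y in D) k y B)%E.
Hypothesis nuD : (nu D < +oo)%E.
Variables (f : Z -> R) (M : R).
Hypotheses (mf : measurable_fun setT f) (fM : forall z, `|f z| <= M).

Let mass : m setT = nu D.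
Proof.
rewrite mE//; under eq_integral do rewrite probability_setT.
by rewrite integral_cst// mul1e.
Qed.

Let M0 : 0 <= M. Proof. exact: le_trans (normr_ge0 _) (fM point). Qed.

(** Adding the bound makes the integrand nonnegative and reduces bounded functions to the
    nonnegative case. *)
Let g z := f z + M.
Let g0 z : 0 <= g z.
Proof. by have := fM z; rewrite ler_norml /g => /andP[h _]; rewrite -lerBlDr sub0r. Qed.
Let mg : measurable_fun setT g. Proof. exact: measurable_funD. Qed.

Let ik y : (k y).-integrable setT (EFin \o f).
Proof. by apply: (@integrable_bounded _ _ _ _ _ _ M) => //; rewrite [X in (X < _)%E]probability_setT ltry. Qed.

Let kg y : \int[k y]_z g z = \int[k y]_z f z + M.
Proof.
rewrite /g RintegralD//; last by apply: (@integrable_bounded _ _ _ _ _ _ `|M|) => //;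
  rewrite [X in (X < _)%E]probability_setT ltry.
  by rewrite Rintegral_cst// [X in fine X]probability_setT mulr1.
exact: ik.
Qed.

Let ekg y : (\int[k y]_z (g z)%:E = (\int[k y]_z f z + M)%:E)%E.
Proof.
rewrite -kg /Rintegral fineK//; apply: integrable_fin_num => //.
apply: (@integrable_bounded _ _ _ _ _ _ (M + M)) => //.
  by rewrite [X in (X < _)%E]probability_setT ltry.
by move=> z _; apply: le_trans (ler_normD _ _) _; rewrite lerD// ger0_norm.
Qed.

Lemma mixture_measurable : measurable_fun setT (fun y => \int[k y]_z f z).
Proof.
have H : measurable_fun setT (fun y => \int[k y]_z (g z)%:E)%E.
  have h0 z : (0 <= (EFin \o g) z)%E by rewrite lee_fin.
  by apply: (measurable_fun_integral_kernel mk h0); exact/measurable_EFinP.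
move: H; under eq_fun do rewrite ekg.
move=> /measurable_EFinP H.
have -> : (fun y => \int[k y]_z f z) = (fun y => (\int[k y]_z f z + M) - M).
  by apply/funext => y; rewrite addrK.
exact: measurable_funB.
Qed.

Lemma mixture_bound y : `|\int[k y]_z f z| <= M.
Proof.
have h : (k y setT < +oo)%E by rewrite probability_setT ltry.
have := Rintegral_le_bound measurableT h mf (fun z _ => fM z).
by rewrite [X in fine X]probability_setT mulr1.
Qed.

Lemma Rintegral_mixture : \int[m]_z f z = \int[nu]_(y in D) (\int[k y]_z f z).
Proof.
have im : m.-integrable setT (EFin \o f).
  by apply: (@integrable_bounded _ _ _ _ _ _ M) => //; rewrite mass.
have mi := mixture_measurable.
have ii : nu.-integrable D (EFin \o (fun y => \int[k y]_z f z)).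
  apply: (@integrable_bounded _ _ _ _ _ _ M) => //; first exact: measurable_funTS.
  by move=> y _; exact: mixture_bound.
have : \int[m]_z g z = \int[nu]_(y in D) (\int[k y]_z f z + M).
  rewrite /Rintegral (@ge0_integral_mixture _ _ _ _ _ m nu D mD (fun y => k y) mk mE (EFin \o g)) => [||z].
  - by congr fine; apply: eq_integral => y _; exact: ekg.
  - exact/measurable_EFinP.
  - by rewrite lee_fin.
rewrite RintegralD//; last by apply: (@integrable_bounded _ _ _ _ _ _ `|M|) => //; rewrite mass.
rewrite RintegralD//; last by apply: (@integrable_bounded _ _ _ _ _ _ `|M|) => //; exact: measurable_cst.
rewrite !Rintegral_cst//.
have -> : fine (m setT) = fine (nu D) by rewrite mass.
by move=> /addIr.
Qed.

End mixture_real.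

Section density.
Context d (Z : measurableType d) (R : realType).
Variables (m mu : {measure set Z -> \bar R}) (p : Z -> R).
Hypotheses (p0 : forall z, 0 <= p z) (mp : measurable_fun setT p).
Hypothesis mE : forall B, measurable B -> m B = (\int[mu]_(z in B) (p z)%:E)%E.

(** A measure with density [p] is a mixture of Dirac masses of weight [p z]. *)
Let k (z : Z) : {measure set Z -> \bar R} := mscale (NngNum (p0 z)) (dirac z).

Lemma ge0_integral_density (f : Z -> \bar R) : measurable_fun setT f ->
  (forall z, 0 <= f z)%E -> (\int[m]_z f z = \int[mu]_z ((p z)%:E * f z))%E.
Proof.
move=> mf f0; rewrite (@ge0_integral_mixture _ _ _ _ _ m mu setT measurableT k)//.
- apply: eq_integral => z _; rewrite ge0_integral_mscale//=.
  by rewrite integral_dirac// diracT mul1e.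
- move=> B mB; rewrite /k /= /mscale /=; apply: emeasurable_funM.
    exact/measurable_EFinP.
  rewrite (_ : (fun z => _) = (fun z => (\1_B z)%:E)); last by apply/funext => z; rewrite diracE indicE.
  by apply/measurable_EFinP; exact: measurable_indic.
- move=> B mB; rewrite mE// integral_mkcond; apply: eq_integral => z _.
  rewrite /k /= /mscale /= diracE /patch; case: ifP => _; rewrite ?mule1 ?mule0//.
Qed.

Lemma Rintegral_density (f : Z -> R) : measurable_fun setT f ->
  \int[m]_z f z = \int[mu]_z (p z * f z).
Proof.
move=> mf; have mF : measurable_fun setT (EFin \o f) by exact/measurable_EFinP.
rewrite /Rintegral; congr fine; rewrite [LHS]integralE [RHS]integralE.
congr (_ - _)%E.
  rewrite (ge0_integral_density (measurable_funepos mF))//.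
  apply: eq_integral => z _; rewrite !funeposE /= -!EFin_max -EFinM; congr EFin.
  by rewrite maxr_pMr// mulr0.
rewrite (ge0_integral_density (measurable_funeneg mF))//.
apply: eq_integral => z _; rewrite !funenegE /= -!EFin_max -EFinM; congr EFin.
by rewrite maxr_pMr// mulr0 mulrN.
Qed.

End density.

Section restricted_measure.
Context d (T : measurableType d) (R : realType).
Variables (mu : {measure set T -> \bar R}) (A : set T) (mA : measurable A).

Lemma Rintegral_restricted (f : T -> R) : measurable_fun setT f ->
  \int[mrestr mu mA]_x f x = \int[mu]_(x in A) f x.
Proof.
move=> mf; rewrite (@Rintegral_density _ _ _ (mrestr mu mA) mu (\1_A)) //.
- rewrite [RHS]Rintegral_mkcond; apply: eq_Rintegral => x _.
  by rewrite /patch indicE; case: ifP => _; rewrite ?mul1r ?mul0r.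
- move=> B mB; rewrite /mrestr /=.
  by rewrite integral_indic// setIC.
Qed.

End restricted_measure.

Section lebesgue_shift1.
Context {R : realType}.
Local Notation leb := (@lebesgue_measure R).

Lemma lebesgue_measure_shift (v : R) (A : set R) : measurable A ->
  leb A = leb ((fun x => x + v) @^-1` A).
Proof.
have mv : measurable_fun setT (fun x : measurableTypeR R => x + v : measurableTypeR R) by exact: measurable_funD.
pose nu0 : {measure set (measurableTypeR R) -> \bar R} :=
  pushforward leb (fun x : measurableTypeR R => x + v : measurableTypeR R).
pose nu := nu0 mv.
move=> mA; rewrite -[RHS]/(nu A); apply: lebesgue_measure_unique => //.
move=> X [[a b] _ <-]; rewrite /nu /nu0 /= /pushforward.
rewrite (_ : _ @^-1` _ = `](a - v), (b - v)]%classic).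
  by rewrite !lebesgue_measure_itv/= !lte_fin ltrD2r -!EFinB opprB addrA subrK.
by apply/seteqP; split => x /=; rewrite !in_itv/= ltrBlDr lerBrDr.
Qed.

Lemma Rintegral_shift1 (v : R) (f : R -> R) : measurable_fun setT f ->
  \int[leb]_x f (x + v) = \int[leb]_x f x.
Proof.
move=> mf; symmetry.
apply: (@Rintegral_image _ _ _ _ R (fun x : measurableTypeR R => x + v : measurableTypeR R)) => //.
  exact: measurable_funD.
by move=> A mA; exact: lebesgue_measure_shift.
Qed.

End lebesgue_shift1.

Lemma invnS_near_le {R : realType} (e : R) : 0 < e -> \forall n \near \oo, n.+1%:R^-1 <= e.
Proof.
move=> e0; have /cvgrPdist_le/(_ _ e0) := @invnS_cvg0 R.
by apply: filterS => n; rewrite sub0r normrN ger0_norm// invr_ge0.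
Qed.

Lemma grid_cell_index_uniq {R : realType} {d : nat} (n : nat) k (x : 'rV[R]_d) :
  grid_cell n k x -> grid_index n x = k.
Proof.
move=> kx; apply/rowP => i; have := kx i; rewrite !mxE.
rewrite ltr_pdivrMr ?ltr0n// ler_pdivlMr ?ltr0n// mulrC => h.
rewrite (ceil_def (m := k ord0 i + 1)) ?addrK// intrD.
by [].
Qed.

(** * Joint measurability of the transition density *)

Section transition_density_regularity.
Context {R : realType} {d : nat}.
Variable mu : {measure set 'rV[R]_d -> \bar R}.
Variable p : R -> 'rV[R]_d -> 'rV[R]_d -> R.
Hypothesis cp : {within [set q : R * 'rV[R]_d * 'rV[R]_d | 0 < q.1.1],
    continuous (fun q : R * 'rV[R]_d * 'rV[R]_d => p q.1.1 q.1.2 q.2)}.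

Lemma density_cvg (T : Type) (F : set_system T) {FF : Filter F} (t : R)
    (x y : 'rV[R]_d) (t_ : T -> R) (x_ y_ : T -> 'rV[R]_d) :
  0 < t -> t_ n @[n --> F] --> t -> x_ n @[n --> F] --> x ->
  y_ n @[n --> F] --> y -> p (t_ n) (x_ n) (y_ n) @[n --> F] --> p t x y.
Proof.
move=> t0 ct cx cy.
have oD : open [set q : R * 'rV[R]_d * 'rV[R]_d | 0 < q.1.1].
  apply: (@open_comp _ _ (fun q : R * 'rV[R]_d * 'rV[R]_d => q.1.1) [set s | 0 < s]); last exact: open_gt.
  by move=> q _; apply: continuous_comp; exact: cvg_fst.
move: cp; rewrite continuous_open_subspace// => /(_ (t, x, y)).
rewrite inE => /(_ t0) c.
apply: (cvg_comp (fun n => (t_ n, x_ n, y_ n)) (fun q : R * 'rV[R]_d * 'rV[R]_d => p q.1.1 q.1.2 q.2) _ c).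
exact: (cvg_pair (cvg_pair ct cx) cy).
Qed.

Lemma density_continuous (t : R) (x : 'rV[R]_d) : 0 < t -> continuous (p t x).
Proof.
move=> t0 y; apply: (@density_cvg _ (nbhs y)) => //; exact: cvg_cst.
Qed.

Lemma density_measurable (t : R) (x : 'rV[R]_d) : 0 < t -> measurable_fun setT (p t x).
Proof. by move=> t0; apply: continuous_measurable_rV; exact: density_continuous. Qed.

(** Continuity is known for positive times, and Tonelli's theorem is applied to functions of all
    times; hence the extension by 0. *)
Definition positive_time_density (q : R * 'rV[R]_d) (y : 'rV[R]_d) : R :=
  if 0 < q.1 then p q.1 q.2 y else 0.

Lemma positive_time_density_measurable :
  measurable_fun setT (fun z : R * 'rV[R]_d * 'rV[R]_d => positive_time_density z.1 z.2).
Proof.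
pose D : set (R * 'rV[R]_d) := [set q | 0 < q.1].
have mD : measurable D.
  rewrite (_ : D = fst @^-1` `]0, +oo[%classic).
    by rewrite -[X in measurable X]setTI; exact: measurable_fst.
  by apply/seteqP; split => q /=; rewrite in_itv/= andbT.
have H : measurable_fun (D `*` setT) (fun z : R * 'rV[R]_d * 'rV[R]_d => p z.1.1 z.1.2 z.2).
  (* Times are rounded up, so that a positive time stays in the region where [p] is continuous;
     points are sent to the upper corner of their cell. *)
  pose q (n : nat) (z : R * 'rV[R]_d) : int * 'rV[int]_d :=
    (Num.ceil (n.+1%:R * z.1), grid_index n z.2).
  pose e (n : nat) (c : int * 'rV[int]_d) : R * 'rV[R]_d :=
    (c.1%:~R / n.+1%:R, \row_i (((c.2 ord0 i)%:~R + 1) / n.+1%:R)).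
  have ce (n : nat) (s : R) : 0 <= (Num.ceil (n.+1%:R * s))%:~R / n.+1%:R - s <= n.+1%:R^-1.
    have n0 : 0 < n.+1%:R :> R by rewrite ltr0n.
    rewrite subr_ge0 ler_pdivlMr// mulrC ceil_ge/= lerBlDr.
    rewrite ler_pdivrMr// mulrDl mulVf ?gt_eqF// [s * _]mulrC.
    by have /ltW := ceilB1_lt (n.+1%:R * s); rewrite intrB lerBlDl.
  have e0 n z : D z -> 0 < (e n (q n z)).1.
    move=> Dz; have /andP[h _] := ce n z.1; rewrite /=.
    by apply: lt_le_trans Dz _; rewrite -subr_ge0.
  apply: (@measurable_fun_discretization _ _ _ _ _ _ D q e (fun z y => p z.1 z.2 y)) => //.
  - move=> n [a k]; apply: measurableI => //.
    rewrite (_ : [set _ | _] = [set s | Num.ceil (n.+1%:R * s) = a] `*` grid_cell n k).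
      apply: measurableX; last exact: measurable_box.
      rewrite (_ : [set _ | _] = (fun s => n.+1%:R * s) @^-1` `](a%:~R - 1), a%:~R]%classic).
        rewrite -[X in measurable X]setTI; have m : measurable_fun setT (fun s : R => n.+1%:R * s).
          exact: measurable_funM.
        exact: m.
      apply/seteqP; split => s /=; rewrite in_itv/=.
        by move=> <-; have := ceil_itv (n.+1%:R * s); rewrite intrB.
      by rewrite -[1]/(1%:~R) -intrB => /ceil_def.
    apply/seteqP; split => -[s z] /=.
      by case=> <- <-; split => //; exact: grid_cell_index.
    by case=> <- h; congr pair; exact: grid_cell_index_uniq.
  - by move=> n z Dz; apply: density_measurable; exact: e0.
  - move=> z y Dz; apply: density_cvg => //.
    + apply/cvgrPdist_le => _/posnumP[eps]; near=> n; rewrite /= distrC ger0_norm.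
        have /andP[_] := ce n z.1; move=> /le_trans; apply.
        by near: n; exact: invnS_near_le.
      by have /andP[] := ce n z.1.
    + apply/cvgrPdist_le => _/posnumP[eps]; near=> n; rewrite /=.
      have c : @grid_cell R d n (grid_index n z.2) (\row_i (((grid_index n z.2 ord0 i)%:~R + 1) / n.+1%:R)).
        by move=> i; rewrite !mxE ltr_pM2r ?invr_gt0 ?ltr0n// ltrDl ltr01 lexx.
      apply: le_trans (grid_cell_near (grid_cell_index n z.2) c) _.
      by near: n; exact: invnS_near_le.
    + exact: cvg_cst.
rewrite (_ : (fun z => _) = (fun z : R * 'rV[R]_d * 'rV[R]_d => p z.1.1 z.1.2 z.2) \_ (D `*` setT)).
  exact: (iffLR (measurable_restrictT _ (measurableX mD measurableT)) H).
apply/funext => -[[s x] y]; rewrite /positive_time_density /patch /=.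
case: ifPn => h; first by rewrite mem_set.
by rewrite memNset// => -[/= h' _]; rewrite h' in h.
Unshelve. all: by end_near. Qed.

End transition_density_regularity.

(** * Transition operators and the Markov property of the Hunt process *)

Section hunt_semigroup.
Context {R : realType} {d : nat}.
Context {dO : measure_display} {Omega : measurableType dO}.
Variables (P : 'rV[R]_d -> probability Omega R) (X : R -> Omega -> 'rV[R]_d).
Hypothesis hX : hunt_process P X.
Implicit Types (f : 'rV[R]_d -> R) (M : R).

Let mX t : 0 <= t -> measurable_fun setT (X t) := @hunt_measurable _ _ _ _ _ _ hX t.

Definition transition (t : R) f (x : 'rV[R]_d) : R := \int[P x]_w f (X t w).

(** The law of [X t] bundled as a probability on the state space, so that expectations of [f (X t)]
    become integrals against a kernel in [x]. *)
Let state_law t (t0 : 0 <= t) (x : 'rV[R]_d) : probability 'rV[R]_d R :=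
  distribution (P x) (HB.pack_for {mfun Omega >-> 'rV[R]_d} (X t)
     (isMeasurableFun.Build _ _ _ _ _ (mX t0))).

Let transition_law t (t0 : 0 <= t) f x : measurable_fun setT f ->
  transition t f x = \int[state_law t0 x]_z f z.
Proof.
move=> mf; symmetry; apply: (@Rintegral_image _ _ _ _ R (X t)) => //.
exact: mX.
Qed.

Lemma transition_measurable t f M : 0 <= t -> measurable_fun setT f ->
  (forall z, `|f z| <= M) -> measurable_fun setT (transition t f).
Proof.
move=> t0 mf fM; rewrite (_ : transition t f = fun x => \int[state_law t0 x]_z f z).
  apply: mixture_measurable mf fM => B mB; exact: (hunt_kernel hX).
by apply/funext => x; exact: transition_law.
Qed.

Lemma transition_bound t f M x : 0 <= t -> measurable_fun setT f ->
  (forall z, `|f z| <= M) -> `|transition t f x| <= M.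
Proof. by move=> t0 mf fM; rewrite (transition_law t0)//; exact: mixture_bound. Qed.

Lemma state_integrable t f M x : 0 <= t -> measurable_fun setT f ->
  (forall z, `|f z| <= M) -> (P x).-integrable setT (EFin \o (f \o X t)).
Proof.
move=> t0 mf fM; apply: (@integrable_bounded _ _ _ _ _ _ M) => //.
- by rewrite [X in (X < _)%E]probability_setT ltry.
- by apply: measurableT_comp => //; exact: mX.
- by move=> w _; exact: fM.
Qed.

Variable F : R -> set (set Omega).
Hypotheses (hF : filtration F) (hS : strong_markov P X F).

(** The strong Markov property at the constant time [s], read as a mixture: the law of [X (s + r)]
    on [A] is the integral over [A] of the kernel taken at [X s]. This passes from sets to bounded
    functions. *)
Lemma simple_markov s r x A f M : 0 <= s -> 0 <= r -> F s A ->
  measurable_fun setT f -> (forall z, `|f z| <= M) ->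
  \int[P x]_(w in A) f (X (s + r) w) = \int[P x]_(w in A) transition r f (X s w).
Proof.
move=> s0 r0 sA mf fM; have mA : measurable A by exact: (filt_measurable hF s0).
have sr0 : 0 <= s + r by rewrite addr_ge0.
pose m0 : {measure set 'rV[R]_d -> \bar R} := pushforward (mrestr (P x) mA) (X (s + r)).
pose m := m0 (mX sr0).
have := @Rintegral_mixture _ _ _ _ _ m (P x) A mA (fun w => state_law r0 (X s w)) _ _ _ f M mf fM.
rewrite (_ : \int[m]_z f z = \int[P x]_(w in A) f (X (s + r) w)); last first.
  rewrite -(@Rintegral_restricted _ _ _ _ _ mA (fun w => f (X (s + r) w))).
    by apply: (@Rintegral_image _ _ _ _ R (X (s + r))) => //; exact: mX.
  by apply: measurableT_comp => //; exact: mX.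
move=> ->.
- by apply: eq_Rintegral => w _; rewrite (transition_law r0).
- move=> B mB; apply: (measurableT_comp (hunt_kernel hX r0 mB)); exact: mX.
- move=> B mB; have := hS x (tau := fun => s%:E) _ r0 (A := A) _ mB.
  rewrite /at_time/= (_ : A `&` [set w | (s%:E < +oo)%E] = A); last first.
    by apply/seteqP; split => w; [case|move=> ?; split => //=; exact: ltry].
  move=> <-.
  + rewrite /m /m0/= /pushforward /mrestr setIC; congr (P x _).
    by apply/seteqP; split => w /= [Aw]; [move=> Bw; split => //; split => //; exact: ltry|case].
  + split=> [w|t t0]; first by rewrite lee_fin.
    have [F0 FC _] := filt_sigma hF t0.
    have [st|st] := leP s t.
      rewrite (_ : [set _ | _] = setT `\` set0); first exact: FC.
      by apply/seteqP; split => w //=; rewrite ?lee_fin; split.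
    rewrite (_ : [set _ | _] = set0)//.
    by apply/seteqP; split => w //=; rewrite ?lee_fin leNgt st.
  + split=> // t t0.
    have [F0 FC _] := filt_sigma hF t0.
    have [st|st] := leP s t.
      rewrite (_ : _ `&` _ = A); first exact: (filt_mono hF s0 st).
      by apply/seteqP; split => w /=; [case|move=> ?; split => //; rewrite ?lee_fin].
    rewrite (_ : _ `&` _ = set0)//.
    by apply/seteqP; split => w //= [_]; rewrite ?lee_fin leNgt st.
- exact: le_lt_trans (probability_le1 _ mA) (ltry 1).
Qed.

End hunt_semigroup.

(** Drawn from the Markov property, hence valid at every starting point, whereas the semigroup law
    of the form holds almost everywhere. *)
Lemma transition_semigroup {R : realType} {d : nat} {dO : measure_display}
    {Omega : measurableType dO} (P : 'rV[R]_d -> probability Omega R)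
    (X : R -> Omega -> 'rV[R]_d) (hX : hunt_process P X) (s r : R) (x : 'rV[R]_d)
    (f : 'rV[R]_d -> R) (M : R) :
  0 <= s -> 0 <= r -> measurable_fun setT f -> (forall z, `|f z| <= M) ->
  transition P X (s + r) f x = transition P X s (transition P X r f) x.
Proof.
have [F [hF _ _ hS _]] := hunt_filtration hX.
move=> s0 r0 mf fM; apply: (simple_markov hX hF hS) mf fM => //.
have [F0 FC _] := filt_sigma hF s0.
by rewrite -(setD0 setT); exact: FC.
Qed.

Section hunt_density.
Context {R : realType} {d : nat}.
Context {dO : measure_display} {Omega : measurableType dO}.
Variables (P : 'rV[R]_d -> probability Omega R) (X : R -> Omega -> 'rV[R]_d).
Hypothesis hX : hunt_process P X.
Variable mu : {measure set 'rV[R]_d -> \bar R}.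
Hypothesis hmu : is_lebesgue mu.
Variable p : R -> 'rV[R]_d -> 'rV[R]_d -> R.
Hypothesis cp : {within [set q : R * 'rV[R]_d * 'rV[R]_d | 0 < q.1.1],
    continuous (fun q : R * 'rV[R]_d * 'rV[R]_d => p q.1.1 q.1.2 q.2)}.
Hypothesis ap : aronson p.
Hypothesis hXp : has_transition_function P X mu p.
Implicit Types (f : 'rV[R]_d -> R) (M : R).

Lemma density_ge0 t x y : 0 < t -> 0 <= p t x y.
Proof.
move=> t0; have [c1 [c2 [c3 [c4 [c10 _ _ _ /(_ t x y t0) /andP[h _]]]]]] := ap.
apply: le_trans h; apply: mulr_ge0; last exact: expR_ge0.
by apply: mulr_ge0; [exact: ltW|exact: powR_ge0].
Qed.

Lemma density_mass t x : 0 < t -> (\int[mu]_y (p t x y)%:E = 1)%E.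
Proof.
by move=> t0; rewrite -hXp// preimage_setT probability_setT.
Qed.

Lemma density_integrable t x : 0 < t -> mu.-integrable setT (EFin \o p t x).
Proof.
move=> t0; apply/integrableP; split.
  by apply/measurable_EFinP; exact: density_measurable.
under eq_integral do rewrite /= ger0_norm ?density_ge0//.
by rewrite density_mass// ltry.
Qed.

Lemma transition_density_integral t f x : 0 < t -> measurable_fun setT f ->
  transition P X t f x = \int[mu]_y (p t x y * f y).
Proof.
move=> t0 mf; have mX := hunt_measurable hX (ltW t0).
pose m0 : {measure set 'rV[R]_d -> \bar R} := pushforward (P x) (X t).
pose m := m0 mX.
rewrite -(@Rintegral_density _ _ _ m mu (p t x)) //.
- by symmetry; apply: (@Rintegral_image _ _ _ _ R (X t)).
- by move=> y; exact: density_ge0.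
- exact: density_measurable.
- by move=> B mB; rewrite -hXp.
Qed.

Lemma density_mul_integrable t f M x : 0 < t -> measurable_fun setT f ->
  (forall z, `|f z| <= M) -> mu.-integrable setT (EFin \o (fun y => p t x y * f y)).
Proof.
move=> t0 mf fM; apply: (@integrable_le _ _ _ _ _ _ (fun y => M * p t x y)) => //.
- by apply: measurable_funM => //; exact: density_measurable.
- exact: (integrableZl measurableT M (density_integrable x t0)).
- move=> y _; rewrite normrM ger0_norm ?density_ge0// mulrC.
  by apply: ler_wpM2r => //; exact: density_ge0.
Qed.

(** At positive times the law of the process has a density, so null sets are invisible from every
    starting point. *)
Lemma transition_ae_eq t f g x : 0 < t -> measurable_fun setT f ->
  measurable_fun setT g -> {ae mu, forall y, f y = g y} ->
  transition P X t f x = transition P X t g x.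
Proof.
move=> t0 mf mg fg; rewrite !transition_density_integral//.
apply: ae_eq_Rintegral => //.
- by apply: measurable_funM => //; exact: density_measurable.
- by apply: measurable_funM => //; exact: density_measurable.
- by apply: filterS fg => y -> _.
Qed.

(** Tonelli's theorem wants a nonnegative integrand: [M] is added to [f], and subtracted afterwards
    since the density has mass 1. *)
Lemma transition_joint_measurable f M : measurable_fun setT f ->
  (forall z, `|f z| <= M) ->
  measurable_fun setT (fun q : R * 'rV[R]_d => if 0 < q.1 then transition P X q.1 f q.2 else 0).
Proof.
move=> mf fM; have sf := lebesgue_rV_sigma_finite hmu.
pose h (z : R * 'rV[R]_d * 'rV[R]_d) : \bar R :=
  (positive_time_density p z.1 z.2 * (f z.2 + M))%:E.
have h0 z : (0 <= h z)%E.
  rewrite lee_fin mulr_ge0//.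
    by rewrite /positive_time_density; case: ifP => // z0; exact: density_ge0.
  by have := fM z.2; rewrite ler_norml => /andP[k _]; rewrite -lerBlDr sub0r.
have mh : measurable_fun setT h.
  apply/measurable_EFinP; apply: measurable_funM.
    exact: positive_time_density_measurable.
  by apply: measurable_funD => //; exact: measurableT_comp.
have mH := measurableT_comp (fine_measurable measurableT) (tonelli_measurable sf mh h0).
have mD : measurable [set q : R * 'rV[R]_d | 0 < q.1].
  rewrite (_ : [set _ | _] = fst @^-1` `]0, +oo[%classic).
    by rewrite -[X in measurable X]setTI; exact: measurable_fst.
  by apply/seteqP; split => q /=; rewrite in_itv/= andbT.
rewrite (_ : (fun q : R * 'rV[R]_d => if _ then _ else _) = fun q : R * 'rV[R]_d =>
   fine (\int[mu]_y h (q, y))%E - M * \1_[set q : R * 'rV[R]_d | 0 < q.1] q).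
  apply: measurable_funB => //.
  by apply: measurable_funM => //; exact: measurable_indic.
apply/funext => -[t x] /=; rewrite indicE /h/= /positive_time_density/=; case: ifPn => t0.
  rewrite mem_set//= mulr1.
  rewrite transition_density_integral//.
  rewrite -[fine _]/(\int[mu]_y (p t x y * (f y + M))).
  under [X in _ = X - _]eq_Rintegral do rewrite mulrDr.
  rewrite RintegralD//; last 2 first.
  - exact: density_mul_integrable fM.
  - by apply: (@density_mul_integrable _ (cst M) `|M|).
  under [X in _ = _ + X - _]eq_Rintegral do rewrite mulrC.
  rewrite RintegralZl//; last exact: density_integrable.
  by rewrite /Rintegral density_mass//= mulr1 addrK.
rewrite memNset/=; last exact/negP.
under eq_integral do rewrite mul0r.
by rewrite integral0 mulr0 subr0.
Qed.

End hunt_density.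

(** * The generator and time integrals of the semigroup *)

Section norm2_square.
Context {R : realType} {d : nat}.
Variable mu : {measure set 'rV[R]_d -> \bar R}.

(** Turns a bound on the norm into one on the integral of the square, the form suited to Jensen's
    inequality and Tonelli's theorem. *)
Lemma norm2_le (u : 'rV[R]_d -> R) (c : R) : 0 <= c ->
  (norm2 mu u <= c%:E)%E <-> (\int[mu]_x (u x ^+ 2)%:E <= (c ^+ 2)%:E)%E.
Proof.
move=> c0; have n2 : (2 : R) != 0 by rewrite pnatr_eq0.
have I0 : (0 <= \int[mu]_x (u x ^+ 2)%:E)%E.
  by apply: integral_ge0 => x _; rewrite lee_fin sqr_ge0.
have E : (norm2 mu u `^ 2 = \int[mu]_x (u x ^+ 2)%:E)%E.
  rewrite /norm2 poweR_Lnorm//; apply: eq_integral => x _ /=.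
  by rewrite -(real_normK (num_real (u x))) powR_mulrn.
have in0y (x : \bar R) : (0 <= x)%E -> (x \in `[0%E, +oo%E]).
  by move=> x0; rewrite in_itv/= x0 leey.
have N0 : (0 <= norm2 mu u)%E by exact: Lnorm_ge0.
rewrite -E; split=> h.
  have -> : ((c ^+ 2)%:E = c%:E `^ 2)%E by rewrite poweR_EFin powR_mulrn.
  by apply: gt0_ler_poweR => //; apply: in0y; rewrite ?lee_fin.
have H (x : \bar R) : (0 <= x)%E -> ((x `^ 2) `^ 2^-1 = x)%E.
  by move=> x0; rewrite -poweRrM divff// poweRe1.
rewrite -(H _ N0) -(H c%:E) ?lee_fin//.
apply: gt0_ler_poweR; rewrite ?invr_ge0 ?ler0n//; try by apply: in0y; exact: poweR_ge0.
by rewrite [leRHS]poweR_EFin powR_mulrn.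
Qed.

End norm2_square.

Section time_average.
Context {R : realType} {d : nat}.
Variable mu : {measure set 'rV[R]_d -> \bar R}.
Hypothesis hmu : is_lebesgue mu.
Local Notation leb := (@lebesgue_measure R).

Lemma lebesgue_R_sigma_finite : sigma_finite [set: measurableTypeR R] leb.
Proof. exact: (sigma_finiteT leb). Qed.

Lemma lebesgue_interval_indic (a b : R) :
  (\int[leb]_s (\1_(`]a, b]%classic) s)%:E = (if a < b then b - a else 0)%:E)%E.
Proof.
rewrite integral_indic// setIT.
have := @lebesgue_measure_itv R `]a, b]; rewrite /= lte_fin => ->.
by case: ifP => _ //; rewrite EFinB.
Qed.

Lemma interval_indic_integrable (a b : R) :
  leb.-integrable setT (EFin \o (\1_(`]a, b]%classic) : R -> R)).
Proof.
apply/integrableP; split; first by apply/measurable_EFinP; exact: measurable_indic.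
under eq_integral do rewrite /= ger0_norm ?indicE//.
have := lebesgue_interval_indic a b; rewrite /Rintegral.
under [X in X = _]eq_integral do rewrite indicE.
by move=> ->; case: ifP => _; rewrite ltry.
Qed.

Lemma Rintegral_interval_indic (a b : R) : a <= b ->
  \int[leb]_s \1_(`]a, b]%classic) s = b - a.
Proof.
move=> ab; rewrite /Rintegral lebesgue_interval_indic.
by case: ltgtP ab => //= ->; rewrite subrr.
Qed.

Section jensen.
Variables (G : R -> R) (M : R).
Hypotheses (mG : measurable_fun setT G) (GM : forall s, `|G s| <= M).

Lemma interval_mul_integrable (a b : R) :
  leb.-integrable setT (EFin \o (fun s => \1_(`]a, b]%classic) s * G s)).
Proof.
have I := integrableZl measurableT M (interval_indic_integrable a b).
apply: (integrable_le measurableT _ I).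
  by apply: measurable_funM => //; exact: measurable_indic.
move=> s _; rewrite normrM mulrC; apply: ler_pM => //.
by rewrite ger0_norm// indicE.
Qed.

(** The integral of [(G - m)^2] over []0, h]] is nonnegative, where [m] is the mean of [G]. *)
Lemma jensen_average (h : R) : 0 < h ->
  (h^-1 * \int[leb]_s (\1_(`]0, h]%classic) s * G s)) ^+ 2 <=
  h^-1 * \int[leb]_s (\1_(`]0, h]%classic) s * G s ^+ 2).
Proof.
move=> h0; set m := h^-1 * _.
have I1 := interval_mul_integrable 0 h.
have I2 : leb.-integrable setT (EFin \o (fun s => \1_(`]0, h]%classic) s * G s ^+ 2)).
  have I := integrableZl measurableT (M ^+ 2) (interval_indic_integrable 0 h).
  apply: (integrable_le measurableT _ I).
    by apply: measurable_funM; [exact: measurable_indic|exact: measurable_funX].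
  move=> s _; rewrite normrM mulrC normrX; apply: ler_pM => //.
    by rewrite lerXn2r// nnegrE// (le_trans _ (GM 0)).
  by rewrite ger0_norm// indicE.
have : 0 <= \int[leb]_s (\1_(`]0, h]%classic) s * (G s - m) ^+ 2).
  by apply: Rintegral_ge0 => s _; rewrite mulr_ge0 ?sqr_ge0// indicE.
have -> : \int[leb]_s (\1_(`]0, h]%classic) s * (G s - m) ^+ 2) =
    \int[leb]_s (\1_(`]0, h]%classic) s * G s ^+ 2
      + ((- (2 * m)) * (\1_(`]0, h]%classic) s * G s) + m ^+ 2 * \1_(`]0, h]%classic) s)).
  by apply: eq_Rintegral => s _; ring.
have J1 := integrableZl measurableT (- (2 * m)) I1.
have J2 := integrableZl measurableT (m ^+ 2) (interval_indic_integrable 0 h).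
rewrite RintegralD//; last exact: (integrableD measurableT J1 J2).
rewrite RintegralD// !RintegralZl//; last exact: interval_indic_integrable.
rewrite Rintegral_interval_indic ?(ltW h0)// subr0.
have hm : \int[leb]_s (\1_(`]0, h]%classic) s * G s) = h * m.
  by rewrite /m mulrA mulfV ?gt_eqF// mul1r.
rewrite hm => H; rewrite mulrC ler_pdivlMr//.
by apply: le_trans (_ : m ^+ 2 * h <= _); nra.
Qed.

End jensen.

Lemma interval_integral_measurable d' (T : measurableType d') (G : R -> T -> R) (M a b : R) :
  measurable_fun setT (fun q : R * T => G q.1 q.2) ->
  (forall s x, `|G s x| <= M) ->
  measurable_fun setT (fun x => \int[leb]_s (\1_(`]a, b]%classic) s * G s x)).
Proof.
move=> mG GM.
have mGx x : measurable_fun setT (G^~ x).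
  exact: (measurableT_comp mG (pair2_measurable x)).
pose K (z : T * measurableTypeR R) : \bar R := (\1_(`]a, b]%classic) z.2 * (G z.2 z.1 + M))%:E.
have K0 z : (0 <= K z)%E.
  rewrite lee_fin mulr_ge0 ?indicE// -lerBlDr sub0r.
  by have := GM z.2 z.1; rewrite ler_norml => /andP[].
have mK : measurable_fun setT K.
  apply/measurable_EFinP; apply: measurable_funM.
    by apply: measurableT_comp => //; exact: measurable_indic.
  apply: measurable_funD => //.
  exact: (measurableT_comp mG (measurable_fun_pair measurable_snd measurable_fst)).
have mH := measurableT_comp (fine_measurable measurableT)
  (tonelli_measurable lebesgue_R_sigma_finite mK K0).
rewrite (_ : (fun x => _) = fun x => fine (\int[leb]_s K (x, s))%E - M * \int[leb]_s \1_(`]a, b]%classic) s).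
  exact: measurable_funB.
apply/funext => x; rewrite -[fine _]/(\int[leb]_s (\1_(`]a, b]%classic) s * (G s x + M))).
have I1 := interval_mul_integrable (mGx x) (GM^~ x) a b.
have I2 := integrableZl measurableT M (interval_indic_integrable a b).
under [X in _ = X - _]eq_Rintegral do rewrite mulrDr [_ * M]mulrC.
rewrite RintegralD// RintegralZl ?addrK//; exact: interval_indic_integrable.
Qed.

(** Minkowski's inequality for a time average, by Jensen's inequality at each point and an exchange
    of the two integrals. *)
Lemma average_L2_le (G : R -> 'rV[R]_d -> R) (M c h : R) : 0 < h -> 0 <= c ->
  measurable_fun setT (fun q : R * 'rV[R]_d => G q.1 q.2) ->
  (forall s x, `|G s x| <= M) ->
  (forall s, 0 < s <= h -> (norm2 mu (G s) <= c%:E)%E) ->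
  (norm2 mu (fun x => (h^-1 * \int[leb]_s (\1_(`]0, h]%classic) s * G s x))%R) <= c%:E)%E.
Proof.
move=> h0 c0 mG GM Gc; apply/norm2_le => //.
have sf := lebesgue_rV_sigma_finite hmu.
have mGx x : measurable_fun setT (G^~ x).
  exact: (measurableT_comp mG (pair2_measurable x)).
pose H (z : 'rV[R]_d * measurableTypeR R) : \bar R := (h^-1 * (\1_(`]0, h]%classic) z.2 * G z.2 z.1 ^+ 2))%:E.
have H0 z : (0 <= H z)%E.
  by rewrite lee_fin mulr_ge0 ?invr_ge0 ?(ltW h0)// mulr_ge0 ?sqr_ge0// indicE.
have mH : measurable_fun setT H.
  apply/measurable_EFinP/measurable_funM => //; apply: measurable_funM.
    by apply: measurableT_comp => //; exact: measurable_indic.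
  apply: measurable_funX.
  exact: (measurableT_comp mG (measurable_fun_pair measurable_snd measurable_fst)).
have avg x : (((h^-1 * \int[leb]_s (\1_(`]0, h]%classic) s * G s x)) ^+ 2)%:E <=
    \int[leb]_s H (x, s))%E.
  apply: le_trans (_ : _ <= (h^-1 * \int[leb]_s (\1_(`]0, h]%classic) s * G s x ^+ 2))%:E)%E _.
    rewrite lee_fin; apply: (@jensen_average (G^~ x) M) => //.
  have I2 : leb.-integrable setT (EFin \o (fun s => \1_(`]0, h]%classic) s * G s x ^+ 2)).
    apply: (@interval_mul_integrable (fun s => G s x ^+ 2) (M ^+ 2)).
      exact: measurable_funX.
    move=> s; rewrite normrX lerXn2r ?nnegrE//; exact: le_trans (GM 0 x).
  rewrite -RintegralZl// /Rintegral fineK//.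
  by apply: integrable_fin_num => //; exact: (integrableZl measurableT h^-1 I2).
apply: (@le_trans _ _ (\int[mu]_x \int[leb]_s H (x, s))%E).
  apply: ge0_le_integral => //.
  - by move=> x _; rewrite lee_fin sqr_ge0.
  - apply/measurable_EFinP/measurable_funX/measurable_funM => //.
    exact: interval_integral_measurable mG GM.
  - exact: (tonelli_measurable lebesgue_R_sigma_finite mH H0).
rewrite (tonelli_measure sf lebesgue_R_sigma_finite mH H0).
apply: (@le_trans _ _ (\int[leb]_s ((h^-1 * c ^+ 2)%:E * (\1_(`]0, h]%classic) s)%:E))%E).
  apply: ge0_le_integral => //.
  - by move=> s _; apply: integral_ge0 => x _; exact: H0.
  - apply: (@tonelli_measurable _ _ _ _ _ mu sf (fun z => H (z.2, z.1))) => //.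
    exact: (measurableT_comp mH (measurable_fun_pair measurable_snd measurable_fst)).
  - by apply/measurable_EFinP/measurable_funM => //; exact: measurable_indic.
  move=> s _; rewrite /H/= indicE; have [sI|_] := boolP (s \in _); last first.
    under eq_integral do rewrite mul0r mulr0.
    by rewrite integral0 mule0.
  under eq_integral do rewrite mul1r EFinM.
  have sh : 0 < s <= h by move: sI; rewrite inE/= in_itv.
  rewrite ge0_integralZl ?lee_fin ?invr_ge0 ?(ltW h0)//.
  - rewrite mule1 EFinM; apply: lee_wpmul2l; first by rewrite lee_fin invr_ge0 ltW.
    by apply/norm2_le => //; exact: Gc.
  - apply/measurable_EFinP/measurable_funX.
    exact: (measurableT_comp mG (pair1_measurable s)).
  - by move=> x _; rewrite lee_fin sqr_ge0.
rewrite integralZl//; last exact: interval_indic_integrable.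
rewrite lebesgue_interval_indic h0 subr0 -EFinM lee_fin mulrAC mulVf ?mul1r//.
by rewrite gt_eqF.
Qed.

End time_average.

(** * Time integrals of the transition operators *)

Section occupation.
Context {R : realType} {d : nat}.
Context {dO : measure_display} {Omega : measurableType dO}.
Variables (P : 'rV[R]_d -> probability Omega R) (X : R -> Omega -> 'rV[R]_d).
Hypothesis hX : hunt_process P X.
Variable mu : {measure set 'rV[R]_d -> \bar R}.
Hypothesis hmu : is_lebesgue mu.
Variable p : R -> 'rV[R]_d -> 'rV[R]_d -> R.
Hypothesis cp : {within [set q : R * 'rV[R]_d * 'rV[R]_d | 0 < q.1.1],
    continuous (fun q : R * 'rV[R]_d * 'rV[R]_d => p q.1.1 q.1.2 q.2)}.
Hypothesis ap : aronson p.
Hypothesis hXp : has_transition_function P X mu p.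
Implicit Types (f g : 'rV[R]_d -> R) (M N a b h t : R).
Local Notation leb := (@lebesgue_measure R).
Local Notation Tr := (transition P X).

(** The potential of [f] over a finite time interval. With the left end excluded, adjacent intervals
    are disjoint, and time 0, at which there is no density, never enters when [a >= 0]. *)
Definition occupation a b f (x : 'rV[R]_d) : R :=
  \int[leb]_s (\1_(`]a, b]%classic) s * Tr s f x).

Definition positive_transition f (s : R) (x : 'rV[R]_d) : R :=
  if 0 < s then Tr s f x else 0.

Lemma positive_transition_measurable f M : measurable_fun setT f ->
  (forall z, `|f z| <= M) ->
  measurable_fun setT (fun q : R * 'rV[R]_d => positive_transition f q.1 q.2).
Proof. by move=> mf fM; exact: (transition_joint_measurable hX hmu cp ap hXp mf fM). Qed.

Lemma positive_transition_bound f M s x : measurable_fun setT f ->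
  (forall z, `|f z| <= M) -> `|positive_transition f s x| <= M.
Proof.
move=> mf fM; rewrite /positive_transition; case: ifPn => s0.
  by apply: (transition_bound hX) => //; exact: ltW.
by rewrite normr0; exact: le_trans (normr_ge0 _) (fM 0).
Qed.

Lemma interval_positive a b f s x : 0 <= a ->
  \1_(`]a, b]%classic) s * Tr s f x = \1_(`]a, b]%classic) s * positive_transition f s x.
Proof.
move=> a0; rewrite indicE; have [|_] := boolP (s \in _); last by rewrite !mul0r.
rewrite inE/= in_itv/= => /andP[as' _].
by rewrite /positive_transition (le_lt_trans a0 as').
Qed.

Lemma occupationE a b f x : 0 <= a -> occupation a b f x =
  \int[leb]_s (\1_(`]a, b]%classic) s * positive_transition f s x).
Proof. by move=> a0; apply: eq_Rintegral => s _; exact: interval_positive. Qed.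

Lemma positive_transition_section_measurable f M x : measurable_fun setT f ->
  (forall z, `|f z| <= M) -> measurable_fun setT (fun s => positive_transition f s x).
Proof.
move=> mf fM.
exact: (measurableT_comp (positive_transition_measurable mf fM) (pair2_measurable x)).
Qed.

Lemma occupation_integrable a b f M x : 0 <= a -> measurable_fun setT f ->
  (forall z, `|f z| <= M) ->
  leb.-integrable setT (EFin \o (fun s => \1_(`]a, b]%classic) s * Tr s f x)).
Proof.
move=> a0 mf fM.
under eq_fun do rewrite /= interval_positive//.
apply: interval_mul_integrable.
  exact: positive_transition_section_measurable mf fM.
by move=> s; exact: positive_transition_bound.
Qed.

Lemma occupation_measurable a b f M : 0 <= a -> measurable_fun setT f ->
  (forall z, `|f z| <= M) -> measurable_fun setT (occupation a b f).
Proof.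
move=> a0 mf fM; rewrite (_ : occupation a b f = fun x =>
  \int[leb]_s (\1_(`]a, b]%classic) s * positive_transition f s x)); last first.
  by apply/funext => x; exact: occupationE.
apply: interval_integral_measurable (positive_transition_measurable mf fM) _ => s x.
exact: positive_transition_bound.
Qed.

Lemma occupation_bound a b f M x : 0 <= a <= b -> measurable_fun setT f ->
  (forall z, `|f z| <= M) -> `|occupation a b f x| <= M * (b - a).
Proof.
move=> /andP[a0 ab] mf fM.
have I := occupation_integrable b x a0 mf fM.
apply: le_trans (le_normr_Rintegral measurableT I) _.
have J := integrableZl measurableT M (interval_indic_integrable a b).
rewrite -Rintegral_interval_indic// -RintegralZl//; last exact: interval_indic_integrable.
apply: le_Rintegral => //; first exact: integrable_norm.
move=> s _; rewrite interval_positive// normrM mulrC; apply: ler_pM => //.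
  exact: positive_transition_bound.
by rewrite ger0_norm// indicE.
Qed.

Lemma transition_sub t f g M N x : 0 <= t -> measurable_fun setT f ->
  measurable_fun setT g -> (forall z, `|f z| <= M) -> (forall z, `|g z| <= N) ->
  Tr t (fun z => f z - g z) x = Tr t f x - Tr t g x.
Proof.
move=> t0 mf mg fM gN; rewrite /transition RintegralB//.
- exact: (state_integrable hX x t0 mf fM).
- exact: (state_integrable hX x t0 mg gN).
Qed.

Lemma occupation_sub a b f g M N x : 0 <= a -> measurable_fun setT f ->
  measurable_fun setT g -> (forall z, `|f z| <= M) -> (forall z, `|g z| <= N) ->
  occupation a b (fun z => f z - g z) x = occupation a b f x - occupation a b g x.
Proof.
move=> a0 mf mg fM gN; rewrite /occupation -RintegralB//.
- apply: eq_Rintegral => s _; rewrite indicE; have [|_] := boolP (s \in _); last by rewrite !mul0r subr0.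
  rewrite inE/= in_itv/= => /andP[as' _].
  by rewrite (transition_sub x _ mf mg fM gN) ?mulrBr// (le_trans a0)// ltW.
- exact: occupation_integrable fM.
- exact: occupation_integrable gN.
Qed.

Lemma occupation_cat a b (c : R) f M x : 0 <= a -> a <= b -> b <= c ->
  measurable_fun setT f -> (forall z, `|f z| <= M) ->
  occupation a c f x = occupation a b f x + occupation b c f x.
Proof.
move=> a0 ab bc mf fM; rewrite /occupation -RintegralD//.
- apply: eq_Rintegral => s _; rewrite -mulrDl; congr (_ * _).
  have E u v : (s \in `]u, v]%classic) = (u < s <= v).
    by apply/idP/idP; rewrite inE/= in_itv.
  rewrite !indicE !E; case: (leP s b) => sb.
    by rewrite (le_trans sb bc) !andbT addr0.
  by rewrite (le_lt_trans ab sb) add0r.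
- exact: occupation_integrable fM.
- by apply: occupation_integrable fM => //; exact: le_trans ab.
Qed.

Lemma occupation_transition a b t f M x : 0 <= a -> 0 <= t ->
  measurable_fun setT f -> (forall z, `|f z| <= M) ->
  occupation a b (Tr t f) x = occupation (a + t) (b + t) f x.
Proof.
move=> a0 t0 mf fM; rewrite [RHS]occupationE ?addr_ge0//.
rewrite -(Rintegral_shift1 t (f := fun s =>
  \1_(`](a + t), (b + t)]%classic) s * positive_transition f s x)); last first.
  apply: measurable_funM; first exact: measurable_indic.
  exact: positive_transition_section_measurable mf fM.
apply: eq_Rintegral => s _.
have -> : \1_(`](a + t), (b + t)]%classic) (s + t) = \1_(`]a, b]%classic) s :> R.
  rewrite !indicE; congr (_%:R); congr nat_of_bool; apply/idP/idP; rewrite !inE/= !in_itv/=.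
    by rewrite ltrD2r lerD2r.
  by rewrite ltrD2r lerD2r.
rewrite indicE; have [|_] := boolP (s \in _); last by rewrite !mul0r.
rewrite inE/= in_itv/= => /andP[as' _]; have s0 : 0 < s by exact: le_lt_trans as'.
rewrite /positive_transition ltr_pwDl// (transition_semigroup hX x (ltW s0) t0 mf fM)//.
Qed.

Lemma transition_occupation a b h f M x : 0 <= a -> 0 < h ->
  measurable_fun setT f -> (forall z, `|f z| <= M) ->
  Tr h (occupation a b f) x = occupation a b (Tr h f) x.
Proof.
move=> a0 h0 mf fM; have mo := occupation_measurable b a0 mf fM.
rewrite (transition_density_integral hX cp ap hXp)//.
pose G (y : 'rV[R]_d) (s : measurableTypeR R) : R :=
  p h x y * (\1_(`]a, b]%classic) s * positive_transition f s y).
have mG : measurable_fun setT (fun z => G z.1 z.2).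
  apply: measurable_funM.
    by apply: measurableT_comp => //; exact: (density_measurable cp).
  apply: measurable_funM.
    by apply: measurableT_comp => //; exact: measurable_indic.
  exact: (measurableT_comp (positive_transition_measurable mf fM) (measurable_fun_pair measurable_snd measurable_fst)).
have GE y : p h x y * occupation a b f y = \int[leb]_s G y s.
  rewrite /G occupationE// RintegralZl//.
  exact: (interval_mul_integrable (positive_transition_section_measurable y mf fM)
    (fun s => positive_transition_bound s y mf fM)).
under eq_Rintegral do rewrite GE.
rewrite (@fubini_Rintegral _ _ 'rV[R]_d (measurableTypeR R) R mu leb G (p h x)
   (fun s => M * \1_(`]a, b]%classic) s) (lebesgue_rV_sigma_finite hmu)
   lebesgue_R_sigma_finite mG); first last.
- move=> y s; rewrite /G normrM ger0_norm ?(density_ge0 ap)// ler_wpM2l ?(density_ge0 ap)//.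
  rewrite normrM mulrC; apply: ler_pM => //; first exact: positive_transition_bound.
  by rewrite ger0_norm// indicE.
- exact: (integrableZl measurableT M (interval_indic_integrable a b)).
- exact: (density_integrable cp ap hXp).
apply: eq_Rintegral => s _; rewrite /G indicE.
have [|_] := boolP (s \in _); last first.
  under eq_Rintegral do rewrite mul0r mulr0.
  by rewrite /Rintegral integral0 mul0r.
rewrite inE/= in_itv/= => /andP[as' _]; have s0 : 0 < s by exact: le_lt_trans as'.
under eq_Rintegral do rewrite mul1r /positive_transition s0.
have mT := transition_measurable hX (ltW s0) mf fM.
rewrite mul1r -(transition_density_integral hX cp ap hXp x h0 mT).
rewrite -(transition_semigroup hX x (ltW h0) (ltW s0) mf fM) addrC.
by rewrite (transition_semigroup hX x (ltW s0) (ltW h0) mf fM).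
Qed.

(** Both sides are the time integral of the semigroup over []t, t + h]] minus the one over []0, h]].
    The right-hand form is the one whose average over small [h] is controlled by strong
    continuity. *)
Lemma transition_occupation_increment h t f M x : 0 < h -> 0 <= t ->
  measurable_fun setT f -> (forall z, `|f z| <= M) ->
  Tr h (occupation 0 t f) x - occupation 0 t f x =
  occupation 0 h (fun z => Tr t f z - f z) x.
Proof.
move=> h0 t0 mf fM; have mT := transition_measurable hX t0 mf fM.
have TM z : `|Tr t f z| <= M by exact: (transition_bound hX).
rewrite (occupation_sub h x _ mT mf TM fM)//.
rewrite (transition_occupation t x _ h0 mf fM)// (occupation_transition t x _ (ltW h0) mf fM)//.
rewrite (occupation_transition h x _ t0 mf fM)// !add0r.
have A := occupation_cat x (lexx 0) t0 (_ : t <= t + h) mf fM.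
have B := occupation_cat x (lexx 0) (ltW h0) (_ : h <= t + h) mf fM.
rewrite addrC in A; move: A B; rewrite [h + t]addrC lerDl lerDr (ltW h0) t0.
move=> /(_ isT) A /(_ isT) B.
have : occupation 0 t f x + occupation t (t + h) f x = occupation 0 h f x + occupation h (t + h) f x.
  by rewrite -A -B.
move: (occupation 0 t f x) (occupation t _ f x) (occupation 0 h f x) (occupation h _ f x) => *.
by lra.
Qed.

End occupation.

Section occupation_generator.
Context {R : realType} {d : nat}.
Context {dO : measure_display} {Omega : measurableType dO}.
Variables (P : 'rV[R]_d -> probability Omega R) (X : R -> Omega -> 'rV[R]_d).
Hypothesis hX : hunt_process P X.
Variable mu : {measure set 'rV[R]_d -> \bar R}.
Hypothesis hmu : is_lebesgue mu.
Variable a : 'rV[R]_d -> 'M[R]_d.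
Variable p : R -> 'rV[R]_d -> 'rV[R]_d -> R.
Hypothesis hp : transition_density mu a p.
Hypothesis hXp : has_transition_function P X mu p.
Implicit Types (f g u v : 'rV[R]_d -> R) (M N h t : R).
Local Notation leb := (@lebesgue_measure R).
Local Notation Tr := (transition P X).
Local Notation occ := (occupation P X).
Local Notation T := (fun t u x => \int[mu]_y (p t x y * u y)).

Let cp := tdens_continuous hp.
Let ap := tdens_aronson hp.
Let sg := (tdens_kernel hp).1.

Lemma kernel_transition t f : 0 < t -> measurable_fun setT f -> T t f = Tr t f.
Proof.
by move=> t0 mf; apply/funext => x; rewrite (transition_density_integral hX cp ap hXp).
Qed.

Lemma transition_in_L2 t f : 0 < t -> in_L2 mu f -> in_L2 mu (Tr t f).
Proof.
move=> t0 hf; rewrite -kernel_transition//; last exact: in_L2_measurable hf.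
exact: (sg_L2 sg).
Qed.

Lemma transition_symmetric t u v : 0 < t -> in_L2 mu u -> in_L2 mu v ->
  \int[mu]_x (Tr t u x * v x) = \int[mu]_x (u x * Tr t v x).
Proof.
move=> t0 hu hv.
rewrite -(kernel_transition t0 (in_L2_measurable hu)) -(kernel_transition t0 (in_L2_measurable hv)).
exact: (sg_symmetric sg).
Qed.

Lemma norm2_lty_in_L2 u (c : R) : measurable_fun setT u -> (norm2 mu u <= c%:E)%E -> in_L2 mu u.
Proof.
move=> mu' uc; rewrite /in_L2 inE; apply/andP; split; rewrite inE//=.
by rewrite /finite_norm (le_lt_trans uc)// ltry.
Qed.

(** Each operator contracts L^2, and a time average keeps the common bound. *)
Lemma occupation_in_L2 t u M : 0 < t -> in_L2 mu u -> (forall z, `|u z| <= M) ->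
  in_L2 mu (occ 0 t u).
Proof.
move=> t0 hu uM; have mu' := in_L2_measurable hu.
pose c := fine (norm2 mu u).
have N0 : (0 <= norm2 mu u)%E by exact: Lnorm_ge0.
have cE : norm2 mu u = c%:E.
  rewrite fineK// ge0_fin_numE//.
  by move: hu; rewrite /in_L2 inE => /andP[_]; rewrite inE.
have c0 : 0 <= c by rewrite -lee_fin -cE.
have mP := positive_transition_measurable hX hmu cp ap hXp mu' uM.
have bP s x := positive_transition_bound hX s x mu' uM.
have H : (norm2 mu (fun x => (t^-1 * occ 0 t u x)%R) <= c%:E)%E.
  rewrite (_ : (fun x => _) = fun x =>
    t^-1 * \int[leb]_s (\1_(`]0, t]%classic) s * positive_transition P X u s x)); last first.
    by apply/funext => x; rewrite occupationE.
  apply: (average_L2_le hmu t0 c0 mP bP) => s /andP[s0 _].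
  rewrite (_ : positive_transition P X u s = T s u).
    by rewrite -cE; exact: (sg_contraction sg).
  by rewrite kernel_transition//; apply/funext => x; rewrite /positive_transition s0.
have mo := occupation_measurable hX hmu cp ap hXp t (lexx 0) mu' uM.
have /norm2_lty_in_L2/in_L2P : (norm2 mu (fun x => (t^-1 * occ 0 t u x)%R) <= c%:E)%E by [].
case; first exact: measurable_funM.
move=> _ I; apply/in_L2P; split => //.
have := integrableZl measurableT (t ^+ 2) I; apply: eq_integrable => // x _ /=.
by rewrite -EFinM -exprMn mulrA mulfV ?gt_eqF// mul1r.
Qed.

(** By [transition_occupation_increment], the difference quotient minus the expected image [f] is
    the average over []0, h]] of [T s f - f]. Strong continuity makes these differences small in L^2
    for small [s], and the average inherits the bound. *)
Lemma generator_occupation t u M : 0 < t -> in_L2 mu u -> (forall z, `|u z| <= M) ->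
  generator mu T (occ 0 t u) (fun x => Tr t u x - u x).
Proof.
move=> t0 hu uM; have mu' := in_L2_measurable hu.
set f := fun x => Tr t u x - u x.
have mT := transition_measurable hX (ltW t0) mu' uM.
have TM z : `|Tr t u z| <= M by apply: (transition_bound hX) => //; exact: ltW.
have mf : measurable_fun setT f by exact: measurable_funB.
have fM z : `|f z| <= M + M by apply: le_trans (ler_normB _ _) _; exact: lerD.
have hf : in_L2 mu f by apply: in_L2_sub => //; exact: transition_in_L2.
have mo := occupation_measurable hX hmu cp ap hXp t (lexx 0) mu' uM.
split => //; first exact: occupation_in_L2 uM.
have mP := positive_transition_measurable hX hmu cp ap hXp mf fM.
have bP s x := positive_transition_bound hX s x mf fM.
pose G s x := positive_transition P X f s x - f x.
have mG : measurable_fun setT (fun q : R * 'rV[R]_d => G q.1 q.2).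
  apply: measurable_funB => //; exact: measurableT_comp.
have GM s x : `|G s x| <= (M + M) + (M + M).
  by apply: le_trans (ler_normB _ _) _; exact: lerD.
have E h : 0 < h -> (fun x => h^-1 * (T h (occ 0 t u) x - occ 0 t u x) - f x) =
    fun x => h^-1 * \int[leb]_s (\1_(`]0, h]%classic) s * G s x).
  move=> h0; apply/funext => x.
  rewrite (congr1 (fun F => F x) (kernel_transition h0 mo)).
  rewrite (transition_occupation_increment hX hmu cp ap hXp x h0 (ltW t0) mu' uM).
  rewrite occupationE// /G.
  under [X in _ = _ * X]eq_Rintegral do rewrite mulrBr [X in _ - X]mulrC.
  have I := interval_indic_integrable 0 h.
  rewrite RintegralB//; last 2 first.
  - exact: (interval_mul_integrable (positive_transition_section_measurable hX hmu cp ap hXp x mf fM) (bP^~ x)).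
  - exact: (integrableZl measurableT (f x) I).
  rewrite RintegralZl// Rintegral_interval_indic ?(ltW h0)// subr0 mulrBr; congr (_ - _).
  by rewrite mulrCA mulVf ?gt_eqF// mulr1.
have /fine_cvgP[fin0 /cvgrPdist_le c0] := sg_continuous sg hf.
have small (e : R) : 0 < e -> \forall h \near 0^'+,
    (norm2 mu (fun x => (h^-1 * (T h (occ 0 t u) x - occ 0 t u x) - f x)%R) <= e%:E)%E.
  move=> e0; have [dl /= dl0 H] : \forall s \near (0:R)^'+, (norm2 mu (fun x => (T s f x - f x)%R) <= e%:E)%E.
    near=> s; have fs : norm2 mu (fun x => (T s f x - f x)%R) \is a fin_num by near: s.
    rewrite -(fineK fs) lee_fin.
    have : `|0 - fine (norm2 mu (fun x => (T s f x - f x)%R))| <= e by near: s; exact: c0.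
    by rewrite sub0r normrN; apply: le_trans; exact: ler_norm.
  exists dl => //= h hd h0; rewrite E//.
  apply: (average_L2_le hmu h0 (ltW e0) mG GM) => s /andP[s0 sh].
  rewrite (_ : G s = fun x => T s f x - f x).
    apply: H => //=; apply: le_lt_trans hd.
    by rewrite !sub0r !normrN !gtr0_norm.
  apply/funext => x; rewrite /G /positive_transition s0.
  by rewrite (congr1 (fun F => F x) (kernel_transition s0 mf)).
have nn h : (0 <= norm2 mu (fun x => (h^-1 * (T h (occ 0 t u) x - occ 0 t u x) - f x)%R))%E.
  exact: Lnorm_ge0.
apply/fine_cvgP; split.
  have := small 1 ltr01; apply: filterS => h hh.
  by rewrite ge0_fin_numE//; apply: le_lt_trans hh (ltry _).
apply/cvgrPdist_le => e e0; have := small _ e0; apply: filterS => h hh.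
rewrite sub0r normrN ger0_norm ?fine_ge0// -lee_fin fineK//.
by rewrite ge0_fin_numE//; apply: le_lt_trans hh (ltry _).
Unshelve. all: by end_near. Qed.

End occupation_generator.

(** * Dynkin's formula almost everywhere, for compactly supported functions *)

Section transmission_dynkin.
Context {R : realType} {d : nat}.
Context {dO : measure_display} {Omega : measurableType dO}.
Variables (P : 'rV[R]_d -> probability Omega R) (X : R -> Omega -> 'rV[R]_d).
Hypothesis hX : hunt_process P X.
Variable mu : {measure set 'rV[R]_d -> \bar R}.
Hypothesis hmu : is_lebesgue mu.
Variables (Dp Dm : set 'rV[R]_d) (hD : transmission_domains Dp Dm) (ep em : R).
Variable p : R -> 'rV[R]_d -> 'rV[R]_d -> R.
Hypothesis hp : transition_density mu (fun x => (diffusivity ep em Dp Dm x)%:M) p.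
Hypothesis hXp : has_transition_function P X mu p.
Local Notation leb := (@lebesgue_measure R).
Local Notation Tr := (transition P X).
Local Notation occ := (occupation P X).

Let cp := tdens_continuous hp.
Let ap := tdens_aronson hp.
Let sg := (tdens_kernel hp).1.

(** Symmetry holds at each fixed time and is carried to the time integral by Fubini's theorem; the
    integrability of [u] and [g] supplies the product majorants. *)
Lemma occupation_symmetric t (M N : R) (u g : 'rV[R]_d -> R) : 0 < t ->
  in_L2 mu u -> in_L2 mu g -> (forall z, `|u z| <= M) -> (forall z, `|g z| <= N) ->
  mu.-integrable setT (EFin \o u) -> mu.-integrable setT (EFin \o g) ->
  \int[mu]_x (occ 0 t u x * g x) = \int[mu]_x (u x * occ 0 t g x).
Proof.
move=> t0 hu hg uM gN iu ig; have mu' := in_L2_measurable hu; have mg := in_L2_measurable hg.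
have mGH (v w : 'rV[R]_d -> R) : measurable_fun setT v ->
    measurable_fun setT (fun q : R * 'rV[R]_d => positive_transition P X w q.1 q.2) ->
    measurable_fun setT (fun z : 'rV[R]_d * measurableTypeR R =>
      v z.1 * (\1_(`]0, t]%classic) z.2 * positive_transition P X w z.2 z.1)).
  move=> mv mw; apply: measurable_funM; first exact: measurableT_comp.
  apply: measurable_funM.
    by apply: measurableT_comp => //; exact: measurable_indic.
  exact: (measurableT_comp mw (measurable_fun_pair measurable_snd measurable_fst)).
have fub (v w : 'rV[R]_d -> R) (K : R) : measurable_fun setT v -> measurable_fun setT w ->
    (forall z, `|w z| <= K) -> mu.-integrable setT (EFin \o v) ->
    \int[mu]_x (v x * occ 0 t w x) =
    \int[leb]_s (\int[mu]_x (v x * (\1_(`]0, t]%classic) s * positive_transition P X w s x))).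
  move=> mv mw wK iv.
  have mPw := positive_transition_measurable hX hmu cp ap hXp mw wK.
  have bPw s x := positive_transition_bound hX s x mw wK.
  rewrite -(@fubini_Rintegral _ _ 'rV[R]_d (measurableTypeR R) R mu leb
     (fun x s => v x * (\1_(`]0, t]%classic) s * positive_transition P X w s x)) (fun x => `|v x|)
     (fun s => K * \1_(`]0, t]%classic) s) (lebesgue_rV_sigma_finite hmu)
     lebesgue_R_sigma_finite (mGH _ _ mv mPw)).
  - apply: eq_Rintegral => x _; rewrite occupationE// RintegralZl//.
    exact: (interval_mul_integrable (positive_transition_section_measurable hX hmu cp ap hXp x mw wK) (bPw^~ x)).
  - exact: integrable_norm.
  - exact: (integrableZl measurableT K (interval_indic_integrable 0 t)).
  - move=> x s; rewrite normrM ler_wpM2l// normrM mulrC; apply: ler_pM => //.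
    by rewrite ger0_norm// indicE.
transitivity (\int[mu]_x (g x * occ 0 t u x)).
  by apply: eq_Rintegral => x _; rewrite mulrC.
rewrite (fub g u M mg mu' uM ig) (fub u g N mu' mg gN iu); apply: eq_Rintegral => s _.
rewrite indicE; have [|_] := boolP (s \in _); last first.
  by under eq_Rintegral do rewrite mul0r mulr0; under [RHS]eq_Rintegral do rewrite mul0r mulr0.
rewrite inE/= in_itv/= => /andP[s0 _].
under eq_Rintegral do rewrite mul1r /positive_transition s0 mulrC.
under [RHS]eq_Rintegral do rewrite mul1r /positive_transition s0.
exact: (transition_symmetric hX hp hXp).
Qed.

Lemma transmission_dynkin_ae psip psim (N M t : R) :
  transmission_pair Dp Dm ep em psip psim N -> 0 < t ->
  (forall x, `|glue Dp Dm psip psim x| <= M) ->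
  (forall x, `|transmission_laplacian Dp Dm ep em psip psim x| <= M) ->
  {ae mu, forall x, Tr t (glue Dp Dm psip psim) x - glue Dp Dm psip psim x =
    occ 0 t (transmission_laplacian Dp Dm ep em psip psim) x}.
Proof.
move=> tp t0; set psi := glue _ _ _ _; set La := transmission_laplacian _ _ _ _ _ _.
move=> psiM LaM.
have hpsi : in_L2 mu psi by exact: (transmission_in_L2 hmu hD tp).
have hLa : in_L2 mu La by exact: (transmission_laplacian_in_L2 hmu hD tp).
have mpsi := in_L2_measurable hpsi; have mLa := in_L2_measurable hLa.
have mTpsi := transition_measurable hX (ltW t0) mpsi psiM.
have moLa := occupation_measurable hX hmu cp ap hXp t (lexx 0) mLa LaM.
have iLa : mu.-integrable setT (EFin \o La).
  have sl (h : 'rV[R]_d -> R) : has_support N h -> has_support N (laplacian h).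
    move=> hN x xN; rewrite /laplacian big1// => j _.
    exact: (partial_support j (partial_support j hN)).
  apply: (integrable_bounded_support hmu mLa LaM (N := N)); apply: glue_support.
  - by move=> x xN; rewrite (sl _ (tp_suppp tp))// mulr0.
  - by move=> x xN; rewrite (sl _ (tp_suppm tp))// mulr0.
suff H : {ae mu, forall x, (Tr t psi x - psi x) - occ 0 t La x = 0}.
  by apply: filterS H => x /eqP; rewrite subr_eq0 => /eqP.
have hT : in_L2 mu (Tr t psi) by exact: (transition_in_L2 hX hp hXp).
have ho : in_L2 mu (occ 0 t La) by exact: (occupation_in_L2 hX hmu hp hXp t0 hLa LaM).
apply: ae_eq0_box_pairing.
  exact: in_L2_locally_integrable (in_L2_sub (in_L2_sub hT hpsi) ho).
move=> l r; set u : 'rV[R]_d -> R := \1_(box l r).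
have mu' : measurable_fun setT u by exact: box_indic_measurable.
have uM := box_indic_bound l r; have [K uK] := @box_indic_support R d l r.
have hu : in_L2 mu u by exact: (in_L2_bounded_support hmu mu' uM uK).
have iu : mu.-integrable setT (EFin \o u) by exact: (integrable_bounded_support hmu mu' uM uK).
have G := generator_occupation hX hmu hp hXp t0 hu uM.
have [hH1 EN] := (tdens_kernel hp).2 _ _ G.
(* The energy identity for the time integral of [u], tested against [psi]; its minus sign cancels
   the one of Green's formula. *)
have := EN _ (transmission_in_H1 hmu hD tp).
rewrite (energy_transmission hmu hD tp hH1) => /oppr_inj.
rewrite (occupation_symmetric t0 hu hLa uM LaM iu iLa) /inner2 => E.
have S := transition_symmetric hX hp hXp t0 hu hpsi.
have J1 := in_L2_mul hu hT; have J2 := in_L2_mul hu hpsi; have J3 := in_L2_mul hu ho.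
have J4 := in_L2_mul (transition_in_L2 hX hp hXp t0 hu) hpsi.
transitivity (\int[mu]_x (u x * Tr t psi x - u x * psi x - u x * occ 0 t La x)).
  by apply: eq_Rintegral => x _; rewrite -/(u x); ring.
rewrite RintegralB//; last exact: (integrableB measurableT J1 J2).
rewrite RintegralB// -S E.
rewrite -RintegralB//.
apply/eqP; rewrite subr_eq0; apply/eqP.
by apply: eq_Rintegral => x _; rewrite -/psi mulrBl.
Qed.

End transmission_dynkin.

(** * Cutoff and Dynkin's formula *)

Section cutoff.
Context {R : realType} {d : nat}.
Implicit Types (f g h : 'rV[R]_d -> R) (U D : set 'rV[R]_d).

Lemma laplacian_in_open U f g x : open U -> U x -> (forall z, U z -> f z = g z) ->
  laplacian f x = laplacian g x.
Proof.
move=> oU Ux fg; apply: eq_bigr => i _; apply: (partial_in_open i oU Ux) => z Uz.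
exact: (partial_in_open i oU Uz).
Qed.

Lemma laplacian_mul f g x : classC 2 f -> classC 2 g ->
  laplacian (fun z => f z * g z) x =
  \sum_i (f x * partial i (partial i g) x + 2 * (partial i f x * partial i g x)
          + g x * partial i (partial i f) x).
Proof.
move=> cf cg; apply: eq_bigr => i _.
have df z : derivable f z (basis_vec i) by exact: classC_derivable cf.
have dg z : derivable g z (basis_vec i) by exact: classC_derivable cg.
have cf' := classC_partial i cf; have cg' := classC_partial i cg.
have df' z : derivable (partial i f) z (basis_vec i) by exact: classC_derivable cf'.
have dg' z : derivable (partial i g) z (basis_vec i) by exact: classC_derivable cg'.
have d1 z : derivable (fun z => f z * partial i g z) z (basis_vec i) by exact: derivableM.
have d2 z : derivable (fun z => g z * partial i f z) z (basis_vec i) by exact: derivableM.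
rewrite (partialM df dg) (partialD d1 d2) (partialM df dg') (partialM dg df').
move: (partial i (partial i f) x) (partial i (partial i g) x) (partial i f x) (partial i g x) (f x) (g x) => *.
by ring.
Qed.

Lemma derivs_bound D g : derivs_bounded_on D 2 g -> exists2 M : R, 0 <= M & forall x, D x ->
  [/\ `|g x| <= M, forall i, `|partial i g x| <= M
    & forall i, `|partial i (partial i g) x| <= M].
Proof.
move=> [[M0 h0] h].
have /choice [M1 h1] : forall i, exists M, forall x, D x -> `|partial i g x| <= M.
  by move=> i; have [[M hM] _] := h i; exists M.
have /choice [M2 h2] : forall i, exists M, forall x, D x -> `|partial i (partial i g) x| <= M.
  by move=> i; have [_ /(_ i) [[M hM] _]] := h i; exists M.
have S0 (F : 'I_d -> R) : 0 <= \sum_i `|F i| by exact: sumr_ge0.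
have Si (F : 'I_d -> R) i : F i <= \sum_i `|F i|.
  rewrite (bigD1 i)//=; apply: le_trans (ler_norm _) _; rewrite lerDl; exact: sumr_ge0.
exists (`|M0| + \sum_i `|M1 i| + \sum_i `|M2 i|); first by rewrite !addr_ge0.
move=> x Dx; split=> [|i|i].
- by apply: le_trans (h0 _ Dx) _; rewrite -addrA; apply: ler_wpDr; [exact: addr_ge0|exact: ler_norm].
- apply: le_trans (h1 i _ Dx) _; rewrite [_ + \sum_i `|M1 i|]addrC -addrA.
  by apply: ler_wpDr (Si M1 i); exact: addr_ge0.
- apply: le_trans (h2 i _ Dx) _; rewrite addrC.
  by apply: ler_wpDr (Si M2 i); exact: addr_ge0.
Qed.

Lemma compact_support_derivs_bounded n f (N : R) : classC n f -> has_support N f ->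
  derivs_bounded_on setT n f.
Proof.
elim: n f => [|n ih] f cf fN; have [K _ hK] := continuous_bounded_support (classC_continuous cf) fN.
  by split => //; exists K.
split=> [|i]; first by exists K.
by apply: ih; [exact: classC_partial|exact: partial_support].
Qed.

Lemma ball_norm_lt_open (s : R) : open [set z : 'rV[R]_d | `|z| < s].
Proof.
rewrite (_ : [set z | _] = (fun z => `|z|) @^-1` [set t | t < s])//.
by apply: open_comp; [move=> z _; exact: norm_continuous|exact: open_lt].
Qed.

Variable (chi : 'rV[R]_d -> R) (r K : R).
Hypotheses (cchi : classC 2 chi) (r0 : 0 < r) (chi1 : forall x, `|x| <= r -> chi x = 1)
  (chi01 : forall x, 0 <= chi x <= 1) (K0 : 0 <= K)
  (chiK : forall i x, `|partial i chi x| <= K)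
  (chiKK : forall i x, `|partial i (partial i chi) x| <= K).

(** Each derivative brings a factor [1/(n+1) <= 1], so the bound [K] on the derivatives of [chi]
    serves all [n]. The term [+ 0] gives the affine form treated by [classC_affine]. *)
Definition dilated_cutoff (n : nat) (x : 'rV[R]_d) : R := chi (n.+1%:R^-1 *: x + 0).

Lemma dilated_cutoff_C2 n : classC 2 (dilated_cutoff n).
Proof. exact: classC_affine. Qed.

Lemma dilation_norm (n : nat) (x : 'rV[R]_d) : `|n.+1%:R^-1 *: x + 0| = n.+1%:R^-1 * `|x|.
Proof. by rewrite addr0 normrZ ger0_norm// invr_ge0. Qed.

Lemma dilated_cutoff1 n x : `|x| <= r * n.+1%:R -> dilated_cutoff n x = 1.
Proof. by move=> xr; rewrite /dilated_cutoff chi1// dilation_norm mulrC ler_pdivrMr// ltr0n. Qed.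

Lemma dilated_cutoff_bound n x :
  [/\ `|dilated_cutoff n x| <= 1, forall i, `|partial i (dilated_cutoff n) x| <= K
    & forall i, `|partial i (partial i (dilated_cutoff n)) x| <= K].
Proof.
have c0 : 0 <= n.+1%:R^-1 :> R by rewrite invr_ge0.
have c1 : n.+1%:R^-1 <= 1 :> R by rewrite invf_le1 ?ler1n ?ltr0n.
have E i : partial i (dilated_cutoff n) = fun z => n.+1%:R^-1 * partial i chi (n.+1%:R^-1 *: z + 0).
  by rewrite /dilated_cutoff partial_affine// => z; exact: classC_derivable cchi.
have cp i := classC_partial i cchi.
split=> [|i|i].
- by have /andP[a b] := chi01 (n.+1%:R^-1 *: x + 0); rewrite ger0_norm.
- rewrite E normrM (ger0_norm c0); apply: le_trans (chiK i (n.+1%:R^-1 *: x + 0)).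
  by rewrite ler_piMl.
- rewrite E partialZ; last first.
    by move=> z; apply: classC_derivable (classC_affine n.+1%:R^-1 0 (cp i)).
  rewrite partial_affine; last by move=> z; exact: classC_derivable (cp i).
  rewrite !normrM (ger0_norm c0); apply: le_trans (chiKK i (n.+1%:R^-1 *: x + 0)).
  by rewrite mulrA ler_piMl// -[leRHS]mulr1 ler_pM.
Qed.

(** Leibniz rule in each coordinate: [M] from the second derivative of [g], [2 K M] from the cross
    term and [K M] from the second derivative of the cutoff. *)
Lemma laplacian_cutoff_bound n g M x : classC 2 g -> 0 <= M -> `|g x| <= M ->
  (forall i, `|partial i g x| <= M) -> (forall i, `|partial i (partial i g) x| <= M) ->
  `|laplacian (fun z => dilated_cutoff n z * g z) x| <= d%:R * (M + 3 * K * M).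
Proof.
move=> cg M0 gM gM1 gM2; rewrite (laplacian_mul x (dilated_cutoff_C2 n) cg).
apply: le_trans (ler_norm_sum _ _ _) _.
apply: (@le_trans _ _ (\sum_(i < d) (M + 3 * K * M))); last by rewrite sumr_const card_ord -[X in X <= _]mulr_natl.
apply: ler_sum => i _; have [b0 b1 b2] := dilated_cutoff_bound n x.
apply: le_trans (ler_normD _ _) _; apply: (@le_trans _ _ ((M + 2 * (K * M)) + M * K)); last by nra.
apply: lerD; last by rewrite normrM; apply: ler_pM.
apply: le_trans (ler_normD _ _) _; apply: lerD.
  by rewrite normrM -[leRHS]mul1r; apply: ler_pM.
by rewrite normrM [`|2|]ger0_norm// ler_pM2l// normrM; apply: ler_pM.
Qed.

Lemma norm_lt_eventually (x : 'rV[R]_d) : \forall n \near \oo, `|x| < r * n.+1%:R.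
Proof.
have h : 0 < r / (`|x| + 1) by rewrite divr_gt0// ltr_wpDl.
have /cvgrPdist_lt/(_ _ h) := @invnS_cvg0 R; apply: filterS => n.
rewrite sub0r normrN ger0_norm ?invr_ge0// ltr_pdivlMr ?ltr_wpDl// mulrC.
rewrite ltr_pdivrMr ?ltr0n//; apply: le_lt_trans; by rewrite lerDl.
Qed.

Lemma cutoff_eventually g x : \forall n \near \oo,
  dilated_cutoff n x * g x = g x /\ laplacian (fun z => dilated_cutoff n z * g z) x = laplacian g x.
Proof.
have := norm_lt_eventually x; apply: filterS => n xn; split.
  by rewrite dilated_cutoff1 ?mul1r// ltW.
apply: (laplacian_in_open (@ball_norm_lt_open (r * n.+1%:R))) => //.
by move=> z /ltW zn; rewrite dilated_cutoff1// mul1r.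
Qed.

End cutoff.

(** * Approximation in the transmission domain by compactly supported functions *)

Section transmission_approximation.
Context {R : realType} {d : nat}.
Variable mu : {measure set 'rV[R]_d -> \bar R}.
Hypothesis hmu : is_lebesgue mu.
Variables (Dp Dm : set 'rV[R]_d) (hD : transmission_domains Dp Dm) (ep em : R).
Local Notation Gamma := (interface Dp Dm).
Implicit Types (f g phi gp gm : 'rV[R]_d -> R).

Lemma continuous_eq_closure (D : set 'rV[R]_d) f g : continuous f -> continuous g ->
  (forall x, D x -> f x = g x) -> forall x, closure D x -> f x = g x.
Proof.
move=> cf cg fg x Dx; have : closed [set z | f z - g z = 0].
  rewrite (_ : [set z | _] = (fun z => f z - g z) @^-1` [set 0])//.
  apply: closed_comp; last exact: closed_eq.
  by move=> z _; apply: continuousB; [exact: cf|exact: cg].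
move=> /closure_id E; apply/eqP; rewrite -subr_eq0; apply/eqP.
have : [set z | f z - g z = 0] x; last by [].
rewrite E; apply: closureS Dx => z /= /fg ->; exact: subrr.
Qed.

(** Within the open set [D] the partial derivatives of [f] are those of the extension, which are
    continuous at [y]; the limit is well defined because [y] is in the closure of [D]. *)
Lemma grad_from_extension (D : set 'rV[R]_d) f g y j : open D -> classC 1 g ->
  (forall x, D x -> f x = g x) -> closure D y ->
  grad_from D f y ord0 j = partial j g y.
Proof.
move=> oD cg fg Dy; rewrite mxE.
have pf : ProperFilter (within D (nbhs y)) by exact: within_nbhs_proper.
apply: cvg_lim => //.
have c : partial j g x @[x --> within D (nbhs y)] --> partial j g y.
  have c0 : continuous (partial j g) := classC_continuous (classC_partial j cg).
  have cy : {for y, continuous (partial j g)} by exact: c0.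
  apply/cvgrPdist_lt => e e0; have := continuous_near_dist cy e0.
  by apply: filterS => z ze _.
apply: cvg_trans c; apply: near_eq_cvg; near=> z.
apply/esym; apply: (partial_in_open j oD _ fg).
by near: z; exact: withinT.
Unshelve. all: by end_near. Qed.

(** Both extensions are multiplied by the same cutoff, equal to 1 near the interface: continuity and
    flux condition are untouched, and the bounds are uniform in [n]. The extensions are bounded only
    on their own side, hence the estimates after gluing. *)
Lemma transmission_approximation phi : transmission_domain Dp Dm ep em phi ->
  exists gp gm (gpn gmn : nat -> 'rV[R]_d -> R) (N : nat -> R) (M : R),
  [/\ [/\ classC 2 gp, classC 2 gm, forall x, Dp x -> phi x = gp x & forall x, Dm x -> phi x = gm x],
      forall n, transmission_pair Dp Dm ep em (gpn n) (gmn n) (N n),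
      forall n x, `|glue Dp Dm (gpn n) (gmn n) x| <= M,
      forall n x, `|transmission_laplacian Dp Dm ep em (gpn n) (gmn n) x| <= M
    & forall x, \forall n \near \oo,
        glue Dp Dm (gpn n) (gmn n) x = glue Dp Dm gp gm x /\
        transmission_laplacian Dp Dm ep em (gpn n) (gmn n) x =
          transmission_laplacian Dp Dm ep em gp gm x].
Proof.
move=> [cphi _ [gp [cgp bgp gpE]] [gm [cgm bgm gmE]] flux].
have [r0 r00 hr0] : exists2 r0, 0 < r0 & forall x, closure Dp x -> `|x| <= r0.
  have [B [_ hB]] := td_bounded hD; exists (`|B| + 1); first by rewrite ltr_wpDl.
  have cl : closed [set z : 'rV[R]_d | `|z| <= `|B| + 1].
    exact: compact_closed (@norm_hausdorff _ _) (@compact_closed_ball R d (`|B| + 1)).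
  move=> x xD; have : [set z : 'rV[R]_d | `|z| <= `|B| + 1] x; last by [].
  rewrite ((closure_id _).1 cl); apply: closureS xD => z; apply: hB.
  by apply: le_lt_trans (ler_norm B) _; rewrite ltrDl.
(* The margin 1 beyond the radius [r0] of [Dp] puts the interface inside an open ball where every
   dilated cutoff is 1. *)
have r1 : 0 < r0 + 1 by rewrite addr_gt0.
have [chi [cchi chi1 chi0 chi01]] := plateau_exists hmu 0 r1 (@ltr01 R).
have {}chi1 x : `|x| <= r0 + 1 -> chi x = 1 by move=> xr; apply: chi1; rewrite subr0.
have {}chi0 : has_support (r0 + 1 + 2 * 1) chi by move=> x xr; apply: chi0; rewrite subr0.
have c2 := cchi 2%N.
have [K K0 hK] := derivs_bound (compact_support_derivs_bounded c2 chi0).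
have chiK i x : `|partial i chi x| <= K by have [] := hK x I.
have chiKK i x : `|partial i (partial i chi) x| <= K by have [] := hK x I.
have [Mp Mp0 hMp] := derivs_bound bgp; have [Mm Mm0 hMm] := derivs_bound bgm.
pose x_ n := dilated_cutoff chi n.
have cx n : classC 2 (x_ n) by exact: dilated_cutoff_C2.
pose L (e B : R) := `|e| * (d%:R * (B + 3 * K * B)).
have L0 e B : 0 <= B -> 0 <= L e B.
  by move=> B0; rewrite /L mulr_ge0// mulr_ge0// addr_ge0// mulr_ge0// mulr_ge0.
have lap n e g B x : classC 2 g -> 0 <= B -> [/\ `|g x| <= B, forall i, `|partial i g x| <= B
    & forall i, `|partial i (partial i g) x| <= B] ->
    `|e * laplacian (fun z => x_ n z * g z) x| <= L e B.
  move=> cg B0 [b0 b1 b2]; rewrite normrM ler_wpM2l//.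
  exact: (laplacian_cutoff_bound c2 chi01 chiK chiKK n cg B0 b0 b1 b2).
exists gp, gm, (fun n z => x_ n z * gp z), (fun n z => x_ n z * gm z),
  (fun n => (r0 + 1 + 2 * 1) * n.+1%:R), (Mp + Mm + L ep Mp + L em Mm).
have [Lp Lm] := (L0 ep _ Mp0, L0 em _ Mm0).
have x_le1 n x : `|x_ n x| <= 1 by have [] := dilated_cutoff_bound c2 chi01 chiK chiKK n x.
split; first by split.
- move=> n; have xN : has_support ((r0 + 1 + 2 * 1) * n.+1%:R) (x_ n).
    move=> x xN; rewrite /x_ /dilated_cutoff chi0// dilation_norm mulrC.
    by rewrite [X in _ < X]mulrC ltr_pdivlMr ?ltr0n// mulrC.
  have pE g y j : classC 2 g -> Gamma y -> partial j (fun z => x_ n z * g z) y = partial j g y.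
    move=> cg [yp _]; apply: (partial_in_open j (@ball_norm_lt_open R d ((r0 + 1) * n.+1%:R))).
      rewrite /=; apply: le_lt_trans (hr0 _ yp) _; apply: (@lt_le_trans _ _ (r0 + 1)).
        by rewrite ltrDl.
      by rewrite ler_peMr ?(ltW r1)// ler1n.
    by move=> z /ltW zn; rewrite /x_ (dilated_cutoff1 chi1)// mul1r.
  split.
  + exact: (classC_mul (cx n) cgp).
  + exact: (classC_mul (cx n) cgm).
  + by move=> x /xN ->; rewrite mul0r.
  + by move=> x /xN ->; rewrite mul0r.
  + move=> y [yp ym]; congr (_ * _).
    rewrite -(continuous_eq_closure cphi (classC_continuous cgp) gpE yp).
    exact: (continuous_eq_closure cphi (classC_continuous cgm) gmE ym).
  + move=> y v Gy nv; rewrite -(flux y v Gy nv); congr dotrv; apply/rowP => j.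
    rewrite mxE (pE gp y j cgp Gy) (pE gm y j cgm Gy).
    have Ep := grad_from_extension j (td_openp hD) (classCS cgp) gpE Gy.1.
    have Em := grad_from_extension j (td_openm hD) (classCS cgm) gmE Gy.2.
    by rewrite -Ep -Em !mxE.
- move=> n x; apply: (glue_bound hD) => [xp|xm|]; last by rewrite !addr_ge0.
    have [b _ _] := hMp x xp; apply: (@le_trans _ _ Mp); last by lra.
    by rewrite normrM -[leRHS]mul1r; apply: ler_pM.
  have [b _ _] := hMm x xm; apply: (@le_trans _ _ Mm); last by lra.
  by rewrite normrM -[leRHS]mul1r; apply: ler_pM.
- move=> n x; apply: (glue_bound hD) => [xp|xm|]; last by rewrite !addr_ge0.
    by apply: le_trans (lap n ep gp Mp x cgp Mp0 (hMp x xp)) _; lra.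
  by apply: le_trans (lap n em gm Mm x cgm Mm0 (hMm x xm)) _; lra.
- move=> x; have := cutoff_eventually r1 chi1 gm x; have := cutoff_eventually r1 chi1 gp x.
  apply: filterS2 => n [p1 p2] [m1 m2].
  split; first exact: (congr2 (fun a b => indp Dp x * a + indm Dm x * b) p1 m1).
  exact: (congr2 (fun a b => indp Dp x * (ep * a) + indm Dm x * (em * b)) p2 m2).
Qed.

End transmission_approximation.

Section dynkin_formula.
Context {R : realType} {d : nat}.
Context {dO : measure_display} {Omega : measurableType dO}.
Variables (P : 'rV[R]_d -> probability Omega R) (X : R -> Omega -> 'rV[R]_d).
Hypothesis hX : hunt_process P X.
Variable mu : {measure set 'rV[R]_d -> \bar R}.
Hypothesis hmu : is_lebesgue mu.
Variables (Dp Dm : set 'rV[R]_d) (hD : transmission_domains Dp Dm) (ep em : R).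
Variable p : R -> 'rV[R]_d -> 'rV[R]_d -> R.
Hypothesis hp : transition_density mu (fun x => (diffusivity ep em Dp Dm x)%:M) p.
Hypothesis hXp : has_transition_function P X mu p.
Variable delta : 'rV[R]_d -> R.
Hypotheses (hdelta : measurable_fun (interface Dp Dm) delta)
  (hdeltab : bounded_on (interface Dp Dm) delta).
Local Notation leb := (@lebesgue_measure R).
Local Notation Tr := (transition P X).
Local Notation occ := (occupation P X).
Local Notation Gamma := (interface Dp Dm).
Local Notation L := (transmission_operator Dp Dm ep em delta).

Let cp := tdens_continuous hp.
Let ap := tdens_aronson hp.

Lemma transition_cvg (t M : R) (f_ : nat -> 'rV[R]_d -> R)
    (f : 'rV[R]_d -> R) x : 0 <= t ->
  (forall n, measurable_fun setT (f_ n)) -> measurable_fun setT f ->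
  (forall n z, `|f_ n z| <= M) -> (forall z, f_ n z @[n --> \oo] --> f z) ->
  Tr t (f_ n) x @[n --> \oo] --> Tr t f x.
Proof.
move=> t0 mf_ mf fM cf; have mX := hunt_measurable hX t0.
apply: (@Rintegral_dominated _ _ _ (P x) setT (fun n w => f_ n (X t w)) (fun w => f (X t w)) (cst M)) => //.
- by move=> n; exact: measurableT_comp.
- exact: measurableT_comp.
- by apply: aeW => w _; exact: cf.
- by apply: (@integrable_bounded _ _ _ _ _ _ `|M|) => //; rewrite [X in (X < _)%E]probability_setT ltry.
Qed.

Lemma occupation_cvg (t M : R) (f_ : nat -> 'rV[R]_d -> R)
    (f : 'rV[R]_d -> R) x :
  (forall n, measurable_fun setT (f_ n)) -> measurable_fun setT f ->
  (forall n z, `|f_ n z| <= M) -> (forall z, `|f z| <= M) ->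
  (forall z, f_ n z @[n --> \oo] --> f z) ->
  occ 0 t (f_ n) x @[n --> \oo] --> occ 0 t f x.
Proof.
move=> mf_ mf fnM fM cf.
under eq_fun do rewrite occupationE//; rewrite occupationE//.
apply: (@Rintegral_dominated _ _ _ leb setT
   (fun n s => \1_(`]0, t]%classic) s * positive_transition P X (f_ n) s x)
   (fun s => \1_(`]0, t]%classic) s * positive_transition P X f s x)
   (fun s => M * \1_(`]0, t]%classic) s)) => //.
- move=> n; apply: measurable_funM; first exact: measurable_indic.
  exact: (positive_transition_section_measurable hX hmu cp ap hXp x (mf_ n) (fnM n)).
- apply: measurable_funM; first exact: measurable_indic.
  exact: (positive_transition_section_measurable hX hmu cp ap hXp x mf fM).
- apply: aeW => s _; apply: cvgMl_tmp; rewrite /positive_transition.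
  case: ifPn => s0; last exact: cvg_cst.
  exact: (@transition_cvg s M f_ f x (ltW s0) mf_ mf fnM cf).
- exact: (integrableZl measurableT M (interval_indic_integrable 0 t)).
- move=> n s _; rewrite normrM mulrC; apply: ler_pM => //.
    exact: (positive_transition_bound hX s x (mf_ n) (fnM n)).
  by rewrite ger0_norm// indicE.
Qed.

Lemma transition_at0 (f : 'rV[R]_d -> R) x : measurable_fun setT f -> Tr 0 f x = f x.
Proof.
move=> mf; have mX := hunt_measurable hX (lexx 0).
have m0 : measurable [set w | X 0 w = x].
  rewrite (_ : [set w | _] = X 0 @^-1` [set x])//.
  rewrite -[X in measurable X]setTI; apply: mX => //.
  apply: closed_measurable_rV; apply: compact_closed; first exact: norm_hausdorff.
  exact: compact_set1.
rewrite /transition -[RHS]mulr1 -[X in _ * X](_ : fine (P x setT) = 1); last by rewrite probability_setT.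
rewrite -Rintegral_cst//; apply: ae_eq_Rintegral => //.
  exact: measurableT_comp.
exists (~` [set w | X 0 w = x]); split; first exact: measurableC.
  by rewrite [LHS](probability_setC (P x) m0) (hunt_normal hX) subee.
by move=> w /= h e; apply: h => _; rewrite /= e.
Qed.

Lemma inverse_cvg_right (t : R) : t + n.+1%:R^-1 @[n --> \oo] --> t^'+.
Proof.
move=> A [e /= e0 H]; have /cvgrPdist_lt/(_ _ e0) := @invnS_cvg0 R.
apply: filterS => n hn; apply: H => /=; last by rewrite ltrDl.
by rewrite opprD addrA subrr.
Qed.

Lemma transition_right_continuous (t : R) (phi : 'rV[R]_d -> R) (M : R) x : 0 <= t -> continuous phi ->
  (forall z, `|phi z| <= M) ->
  Tr (t + n.+1%:R^-1) phi x @[n --> \oo] --> Tr t phi x.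
Proof.
move=> t0 cphi phiM; have mphi := continuous_measurable_rV cphi.
apply: (@Rintegral_dominated _ _ _ (P x) setT
  (fun n w => phi (X (t + n.+1%:R^-1) w)) (fun w => phi (X t w)) (cst M)) => //.
- by move=> n; apply: measurableT_comp => //; apply: (hunt_measurable hX); rewrite addr_ge0.
- by apply: measurableT_comp => //; exact: (hunt_measurable hX).
- apply: aeW => w _; apply: continuous_cvg; first exact: cphi.
  have h : X^~ w s @[s --> t^'+] --> X t w := hunt_right_continuous hX t0.
  exact: (cvg_comp (fun n : nat => t + n.+1%:R^-1) (X^~ w) (@inverse_cvg_right t) h).
- by apply: (@integrable_bounded _ _ _ _ _ _ `|M|) => //; rewrite [X in (X < _)%E]probability_setT ltry.
Qed.

Variable phi : 'rV[R]_d -> R.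
Hypothesis hphi : transmission_domain Dp Dm ep em phi.

Lemma transmission_operator_extension gp gm x :
  (forall x, Dp x -> phi x = gp x) -> (forall x, Dm x -> phi x = gm x) ->
  ~ Gamma x -> L phi x = transmission_laplacian Dp Dm ep em gp gm x /\
    phi x = glue Dp Dm gp gm x.
Proof.
move=> Ep Em nG; rewrite /transmission_operator memNset//.
have lE (c : R) D g : open D -> D x -> (forall z, D z -> phi z = g z) ->
    \sum_i c * partial i (partial i phi) x = c * laplacian g x.
  move=> oD Dx E; rewrite -(laplacian_in_open oD Dx E) /laplacian mulr_sumr.
  by [].
case: (domains_cover hD x) => [xp|[xm|//]].
  have xm := Dp_not_Dm hD xp.
  rewrite /transmission_laplacian !glue_p// Ep// -(lE ep _ _ (td_openp hD) xp Ep).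
  split=> //; apply: eq_bigr => i _; congr (_ * _).
  by rewrite /diffusivity !indicE (mem_set (subset_closure xp)) (memNset xm) mulr1 mulr0 addr0.
have nc := Dm_not_closureDp hD xm.
rewrite /transmission_laplacian !glue_m// Em// -(lE em _ _ (td_openm hD) xm Em).
split=> //; apply: eq_bigr => i _; congr (_ * _).
by rewrite /diffusivity !indicE (memNset nc) (mem_set xm) mulr1 mulr0 add0r.
Qed.

(** At each point the approximations are eventually constant, so limits, bounds and measurability
    pass to [f] and [g]. Off the interface these are [phi] and [L phi]. *)
Lemma transmission_approximation_limit : exists (f_ g_ : nat -> 'rV[R]_d -> R) f g M,
  [/\ forall n, measurable_fun setT (f_ n) /\ measurable_fun setT (g_ n),
      forall n x, `|f_ n x| <= M /\ `|g_ n x| <= M,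
      forall x, \forall n \near \oo, f_ n x = f x /\ g_ n x = g x,
      forall x, ~ Gamma x -> L phi x = g x /\ phi x = f x
    & forall t n, 0 < t -> {ae mu, forall x, Tr t (f_ n) x - f_ n x = occ 0 t (g_ n) x}].
Proof.
have [gp [gm [gpn [gmn [N [M [[cgp cgm Ep Em] tp fM gM ev]]]]]]] := transmission_approximation hmu hD hphi.
exists (fun n => glue Dp Dm (gpn n) (gmn n)), (fun n => transmission_laplacian Dp Dm ep em (gpn n) (gmn n)).
exists (glue Dp Dm gp gm), (transmission_laplacian Dp Dm ep em gp gm), M; split=> //.
- move=> n; split.
    exact: in_L2_measurable (transmission_in_L2 hmu hD (tp n)).
  exact: in_L2_measurable (transmission_laplacian_in_L2 hmu hD (tp n)).
- by move=> x nG; exact: transmission_operator_extension.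
- by move=> t n t0; exact: (transmission_dynkin_ae hX hmu hD hp hXp (tp n) t0).
Qed.

Lemma transmission_operator_bounded_measurable :
  measurable_fun setT (L phi) /\ exists M, forall x, `|L phi x| <= M.
Proof.
have [f_ [g_ [f [g [M [mfg fgM ev E _]]]]]] := transmission_approximation_limit.
have mG : measurable Gamma by exact: interface_measurable.
have mg : measurable_fun setT g.
  apply: (@measurable_fun_cvg _ _ _ _ g_) => [n|x _]; first exact: (mfg n).2.
  by apply: cvg_near_cst; apply: filterS (ev x) => n [].
split.
  rewrite -(setUv Gamma); apply/measurable_funU; [by []|exact: measurableC|split].
    apply: eq_measurable_fun hdelta => x; rewrite inE => xG.
    by rewrite /transmission_operator mem_set.
  apply: (eq_measurable_fun g) => [x|]; last exact: measurable_funTS.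
  by rewrite inE => /E[->].
have [B hB] := hdeltab; exists (Num.max M B) => x; rewrite le_max.
have [xG|xG] := pselect (Gamma x).
  by rewrite /transmission_operator mem_set// hB// orbT.
rewrite (E _ xG).1; apply/orP; left.
have [n _ /(_ n (leqnn n)) [_ <-]] := ev x; exact: (fgM n x).2.
Qed.

Lemma dynkin_ae t : 0 < t ->
  {ae mu, forall x, Tr t phi x - phi x = occ 0 t (L phi) x}.
Proof.
move=> t0; have [f_ [g_ [f [g [M [mfg fgM ev E hae]]]]]] := transmission_approximation_limit.
have [mL [B LB]] := transmission_operator_bounded_measurable.
have cphi : continuous phi by case: hphi.
have mphi := continuous_measurable_rV cphi.
have cf z : f_ n z @[n --> \oo] --> f z.
  by apply: cvg_near_cst; apply: filterS (ev z) => n [].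
have cg z : g_ n z @[n --> \oo] --> g z.
  by apply: cvg_near_cst; apply: filterS (ev z) => n [].
have mf : measurable_fun setT f by apply: (@measurable_fun_cvg _ _ _ _ f_) => [n|x _]; [exact: (mfg n).1|exact: cf].
have mg : measurable_fun setT g by apply: (@measurable_fun_cvg _ _ _ _ g_) => [n|x _]; [exact: (mfg n).2|exact: cg].
have fM z : `|f z| <= M by have [n _ /(_ n (leqnn n)) [<- _]] := ev z; exact: (fgM n z).1.
have gM z : `|g z| <= M by have [n _ /(_ n (leqnn n)) [_ <-]] := ev z; exact: (fgM n z).2.
have aef : {ae mu, forall x, phi x = f x} by apply: (interface_ae hmu hD) => x /E[].
have aeg : {ae mu, forall x, L phi x = g x} by apply: (interface_ae hmu hD) => x /E[].
have H : {ae mu, forall x, forall n, Tr t (f_ n) x - f_ n x = occ 0 t (g_ n) x}.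
  by apply: ae_foralln => n; exact: hae.
apply: filterS2 (aef) (H) => x ex hx.
rewrite (transition_ae_eq hX cp ap hXp x t0 mphi mf aef) ex.
(* The time integral does not see the values of [L phi] on the interface, since it involves positive
   times only. *)
have -> : occ 0 t (L phi) x = occ 0 t g x.
  apply: eq_Rintegral => s _; rewrite indicE; have [|_] := boolP (s \in _); last by rewrite !mul0r.
  rewrite inE/= in_itv/= => /andP[s0 _].
  by rewrite (transition_ae_eq hX cp ap hXp x s0 mL mg aeg).
have c1 : Tr t (f_ n) x - f_ n x @[n --> \oo] --> Tr t f x - f x.
  apply: cvgB; last exact: cf.
  exact: (@transition_cvg t M f_ f x (ltW t0) (fun n => (mfg n).1) mf (fun n z => (fgM n z).1) cf).
have c2 : occ 0 t (g_ n) x @[n --> \oo] --> occ 0 t g x.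
  exact: (@occupation_cvg t M g_ g x (fun n => (mfg n).2) mg (fun n z => (fgM n z).2) gM cg).
rewrite (_ : (fun n => _) = fun n => occ 0 t (g_ n) x) in c1; last by apply/funext => n.
exact: (cvg_unique (@norm_hausdorff _ _) c1 c2).
Qed.

Lemma dynkin_formula t x : 0 <= t -> Tr t phi x - phi x = occ 0 t (L phi) x.
Proof.
have [mL [B LB]] := transmission_operator_bounded_measurable.
have [cphi [M phiM] _ _ _] := hphi; have {}phiM z : `|phi z| <= M by exact: phiM.
have mphi := continuous_measurable_rV cphi.
rewrite le_eqVlt => /predU1P[<-|t0].
  rewrite transition_at0// subrr; apply/esym/eqP; rewrite -normr_le0.
  apply: le_trans (occupation_bound hX hmu cp ap hXp x (_ : 0 <= 0 <= 0) mL LB) _.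
    by rewrite lexx.
  by rewrite subrr mulr0.
pose r n : R := n.+1%:R^-1.
have r0 n : 0 < r n by rewrite invr_gt0.
have TM z : `|Tr t phi z| <= M by apply: (transition_bound hX) => //; exact: ltW.
have mT := transition_measurable hX (ltW t0) mphi phiM.
have mo := occupation_measurable hX hmu cp ap hXp t (lexx 0) mL LB.
(* The operator at time [r n] is applied to the almost everywhere identity at time [t]; its density
   makes the result exact at the given [x]. *)
have E n : Tr (t + r n) phi x - Tr (0 + r n) phi x = occ (r n) (t + r n) (L phi) x.
  have /(transition_ae_eq hX cp ap hXp x (r0 n)) := dynkin_ae t0.
  rewrite (transition_sub hX x (ltW (r0 n)) mT mphi TM phiM).
  rewrite (transition_occupation hX hmu cp ap hXp t x (lexx 0) (r0 n) mL LB).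
  rewrite (occupation_transition hX hmu cp ap hXp t x (lexx 0) (ltW (r0 n)) mL LB) add0r.
  rewrite [t + r n]addrC (transition_semigroup hX x (ltW (r0 n)) (ltW t0) mphi phiM) ?add0r; apply => //.
  exact: measurable_funB.
have c1 : Tr (t + r n) phi x - Tr (0 + r n) phi x @[n --> \oo] --> Tr t phi x - phi x.
  apply: cvgB; first exact: (transition_right_continuous (ltW t0) cphi phiM).
  by rewrite -[X in _ --> X](transition_at0 x mphi); exact: (transition_right_continuous (lexx 0) cphi phiM).
rewrite (_ : (fun n => _) = fun n => occ (r n) (t + r n) (L phi) x) in c1; last by apply/funext => n.
suff c2 : occ (r n) (t + r n) (L phi) x @[n --> \oo] --> occ 0 t (L phi) x.
  exact: (cvg_unique (@norm_hausdorff _ _) c1 c2).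
have B0 : 0 <= B by exact: le_trans (normr_ge0 _) (LB 0).
have ocB a b : 0 <= a <= b -> `|occ a b (L phi) x| <= B * (b - a).
  by move=> ab; exact: (occupation_bound hX hmu cp ap hXp x ab mL LB).
(* The two time integrals differ by those over []0, r n]] and []t, t + r n]], each at most
   [B * r n]. *)
have H n : `|occ 0 t (L phi) x - occ (r n) (t + r n) (L phi) x| <= 2 * B * r n.
  have rn0 := ltW (r0 n).
  have tr : t <= t + r n by rewrite lerDl.
  have rt : r n <= t + r n by rewrite lerDr ltW.
  have A1 := occupation_cat hX hmu cp ap hXp x (lexx 0) (ltW t0) tr mL LB.
  have A2 := occupation_cat hX hmu cp ap hXp x (lexx 0) rn0 rt mL LB.
  have -> : occ 0 t (L phi) x - occ (r n) (t + r n) (L phi) x =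
      occ 0 (r n) (L phi) x - occ t (t + r n) (L phi) x.
    move: A1; rewrite A2; move: (occ 0 t _ x) (occ 0 (r n) _ x) (occ t _ _ x) (occ (r n) _ _ x) => *.
    by lra.
  apply: le_trans (ler_normB _ _) _.
  have := ocB 0 (r n); rewrite lexx rn0 subr0 => /(_ isT) b1.
  have := ocB t (t + r n); rewrite (ltW t0) tr => /(_ isT) b2.
  have : t + r n - t = r n by rewrite addrC addKr.
  move=> e; rewrite e in b2; apply: le_trans (lerD b1 b2) _.
  by rewrite -mulrA [2 * _]mulr_natl mulr2n.
apply/cvgrPdist_le => e e0.
have e1 : 0 < e / (2 * B + 1) by rewrite divr_gt0// ltr_wpDl// mulr_ge0.
have := invnS_near_le e1; apply: filterS => n hn.
apply: le_trans (H n) _; move: hn; rewrite ler_pdivlMr ?ltr_wpDl// ?mulr_ge0// => hn.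
by apply: le_trans hn; rewrite -/(r n); have := r0 n; nra.
Qed.

End dynkin_formula.

(** * The canonical filtration and the law on path space *)

Section path_measurability.
Context {R : realType} {d : nat}.
Local Notation leb := (@lebesgue_measure R).
Implicit Types (w : path_space R d) (g : 'rV[R]_d -> R).

Lemma to_halfline_continuous : continuous (@to_halfline R).
Proof.
apply: continuous_comp_initial => t; rewrite /comp/=.
apply: (@continuous_max _ _ (fun=> 0) id); [exact: cvg_cst|exact: cvg_id].
Qed.

Lemma evaluation_path_continuous w : continuous (fun t => evaluation t w).
Proof.
move=> t; apply: (continuous_comp (@to_halfline_continuous t)).
exact: (@cts_fun _ _ w).
Qed.

Lemma evaluation_clamp (t : R) : @evaluation R d (Num.max 0 t) = evaluation t.
Proof.
apply/funext => w; rewrite /evaluation; congr (w _).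
apply: val_inj => /=; by rewrite maxA maxxx.
Qed.

Lemma evaluation_open (t : R) (O : set 'rV[R]_d) : open O ->
  open (@evaluation R d t @^-1` O).
Proof.
move=> oO; exists [set g | g @` [set to_halfline t] `<=` O].
  by apply: compact_open_open => //; exact: compact_set1.
apply/seteqP; split => w /=; first by apply; exists (to_halfline t).
by move=> Ow _ [_ -> <-].
Qed.

Lemma evaluation_measurable (t : R) : measurable_fun setT (@evaluation R d t).
Proof.
apply: (measurability (@open 'rV[R]_d)) => // _ [U oU <-]; rewrite setTI.
by apply: sub_sigma_algebra; exact: evaluation_open.
Qed.

Definition cylinders (t : R) : set (set (path_space R d)) :=
  [set A | exists (s : R) (B : set 'rV[R]_d), [/\ 0 <= s, s <= t, measurable B
                             & A = evaluation s @^-1` B]].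

(* [path_space] with the sigma-algebra of the canonical filtration at time t *)
Definition past (t : R) := g_sigma_algebraType (cylinders t).

Lemma past_evaluation (t s : R) : 0 <= t -> s <= t ->
  measurable_fun setT (evaluation s : past t -> 'rV[R]_d).
Proof.
move=> t0 st _ B mB; rewrite setTI; apply: sub_sigma_algebra.
exists (Num.max 0 s), B; rewrite evaluation_clamp; split => //.
- by rewrite le_max lexx.
- by rewrite ge_max t0.
Qed.

Lemma past_le (s t : R) : s <= t -> <<s cylinders s>> `<=` <<s cylinders t>>.
Proof.
move=> st; apply: sub_sigma_algebra2 => A [u [B [u0 us mB ->]]].
by exists u, B; split => //; exact: le_trans st.
Qed.

Lemma past_borel (t : R) : <<s cylinders t>> `<=` @measurable _ (path_space R d).
Proof.
apply: smallest_sub; first exact: sigma_algebra_measurable.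
move=> _ [s [B [_ _ mB ->]]]; rewrite -[X in measurable X]setTI.
exact: evaluation_measurable.
Qed.

Lemma past_id_measurable (t : R) :
  measurable_fun setT (id : path_space R d -> past t).
Proof. by move=> _ B mB; rewrite setTI; exact: past_borel mB. Qed.

(** Continuity of the paths allows time to be discretized, and [Num.min t] brings the rounded times
    before [t], so that each evaluation is measurable in the past of [t]. *)
Lemma past_joint_measurable (t : R) : 0 <= t ->
  measurable_fun setT (fun z : R * past t => evaluation (Num.min t z.1) z.2).
Proof.
move=> t0; apply: measurable_funTs_rV => i.
pose q (n : nat) (s : R) : int := Num.floor (n.+1%:R * s).
pose e (n : nat) (k : int) : R := k%:~R / n.+1%:R.
rewrite -[setT]setXTT.
apply: (@measurable_fun_discretization _ _ _ _ _ _ setT q e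
  (fun s (w : past t) => evaluation (Num.min t s) w ord0 i)) => //.
- move=> n k; rewrite setTI.
  rewrite (_ : [set s | _] = (fun s : R => n.+1%:R * s) @^-1` `[k%:~R, (k + 1)%:~R[%classic).
    have m : measurable_fun setT (fun s : R => n.+1%:R * s) by exact: measurable_funM.
    by rewrite -[X in measurable X]setTI; exact: m.
  apply/seteqP; split => s /=; rewrite in_itv/=.
    by move=> <-; exact: floor_itv.
  by move=> h; apply: floor_def.
- move=> n s _; apply: (measurableT_comp (measurable_coord i)).
  by apply: past_evaluation => //; rewrite ge_min lexx.
- move=> s w _.
  have c : e n (q n s) @[n --> \oo] --> s.
    apply/cvgrPdist_le => eps eps0; have := invnS_near_le eps0; apply: filterS => n hn.
    have n0 : 0 < n.+1%:R :> R by rewrite ltr0n.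
    have /andP[h1 h2] := floor_itv (n.+1%:R * s).
    rewrite ger0_norm; last by rewrite subr_ge0 ler_pdivrMr// mulrC.
    apply: le_trans hn; rewrite lerBlDr /e /q -[X in X + _]mul1r -mulrDl.
    by rewrite ler_pdivlMr// mulrC; move/ltW: h2; rewrite intrD addrC.
  have cm : {for s, continuous (fun s => evaluation (Num.min t s) w)}.
    apply: (@continuous_comp _ _ _ (fun s => Num.min t s) (fun u => evaluation u w)).
      by apply: (@continuous_min _ _ (fun=> t) id); [exact: cvg_cst|exact: cvg_id].
    exact: evaluation_path_continuous.
  have c2 := cvg_comp (fun n => e n (q n s)) (fun s => evaluation (Num.min t s) w) c cm.
  exact: (cvg_comp _ (fun x : 'rV[R]_d => x ord0 i) c2 (@continuous_coord R d i _)).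
Qed.

Section additive_functional.
Variables (g : 'rV[R]_d -> R) (B : R).
Hypotheses (mg : measurable_fun setT g) (gB : forall z, `|g z| <= B).

(** On the interval the clamp is invisible; elsewhere it replaces evaluations after [t], which the
    past of [t] does not measure. *)
Lemma interval_clamp (s t u : R) w :
  \1_(`]s, t]%classic) u * g (evaluation u w) =
  \1_(`]s, t]%classic) u * g (evaluation (Num.min t u) w).
Proof.
rewrite indicE; have [|_] := boolP (u \in _); last by rewrite !mul0r.
by rewrite inE/= in_itv/= => /andP[_ ut]; rewrite min_r.
Qed.

Lemma past_joint_functional (t : R) : 0 <= t ->
  measurable_fun setT (fun z : R * past t => g (evaluation (Num.min t z.1) z.2)).
Proof. by move=> t0; apply: measurableT_comp => //; exact: past_joint_measurable. Qed.

Lemma path_section_measurable (t : R) w : 0 <= t ->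
  measurable_fun setT (fun u => g (evaluation (Num.min t u) w)).
Proof.
move=> t0; exact: (measurableT_comp (past_joint_functional t0) (pair2_measurable (w : past t))).
Qed.

Lemma path_integrable (s t : R) w : 0 <= t ->
  leb.-integrable setT (EFin \o (fun u => \1_(`]s, t]%classic) u * g (evaluation u w))).
Proof.
move=> t0; under eq_fun do rewrite /= interval_clamp.
by apply: (interval_mul_integrable (path_section_measurable w t0)) => u.
Qed.

(** The left end is a null set; half-open intervals concatenate and match [occupation]. *)
Lemma path_integral_closed (t : R) w : 0 <= t ->
  \int[leb]_(u in `[0, t]) g (evaluation u w) =
  \int[leb]_u (\1_(`]0, t]%classic) u * g (evaluation u w)).
Proof.
move=> t0; have mI : measurable (`]0, t]%classic : set R) by [].
have E : (fun u => \1_(`]0, t]%classic) u * g (evaluation u w)) =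
    (fun u => g (evaluation u w)) \_ `]0, t].
  apply/funext => u; rewrite indicE /patch; case: ifP => _; rewrite ?mul1r ?mul0r//.
have I := path_integrable 0 w t0; rewrite E in I.
rewrite E -Rintegral_mkcond Rintegral_itv_obnd_cbnd//.
apply: (iffRL (@integrable_mkcond _ (measurableTypeR R) R leb _ (EFin \o (fun u => g (evaluation u w))) mI)).
by apply: eq_integrable I => // u _; rewrite /= /patch; case: ifP.
Qed.

Lemma past_integral_measurable (s t : R) : 0 <= t ->
  measurable_fun setT (fun w : past t => \int[leb]_u (\1_(`]s, t]%classic) u * g (evaluation u w))).
Proof.
move=> t0; rewrite (_ : (fun w => _) = fun w : past t =>
   \int[leb]_u (\1_(`]s, t]%classic) u * g (evaluation (Num.min t u) w))); last first.
  by apply/funext => w; apply: eq_Rintegral => u _; exact: interval_clamp.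
exact: (interval_integral_measurable s t (past_joint_functional t0) (fun u w => gB (evaluation (Num.min t u) w))).
Qed.

Lemma path_integral_bound (s t : R) w : 0 <= s <= t ->
  `|\int[leb]_u (\1_(`]s, t]%classic) u * g (evaluation u w))| <= B * (t - s).
Proof.
move=> /andP[s0 st]; have t0 := le_trans s0 st; have I := path_integrable s w t0.
apply: le_trans (le_normr_Rintegral measurableT I) _.
rewrite -Rintegral_interval_indic// -RintegralZl//; last exact: interval_indic_integrable.
apply: le_Rintegral => //.
- exact: integrable_norm.
- exact: (integrableZl measurableT B (interval_indic_integrable s t)).
- move=> u _; rewrite normrM mulrC; apply: ler_pM => //.
  by rewrite ger0_norm// indicE.
Qed.

Lemma path_integral_cat (s t : R) w : 0 <= s -> s <= t ->
  \int[leb]_u (\1_(`]0, t]%classic) u * g (evaluation u w)) =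
  \int[leb]_u (\1_(`]0, s]%classic) u * g (evaluation u w)) +
  \int[leb]_u (\1_(`]s, t]%classic) u * g (evaluation u w)).
Proof.
move=> s0 st; have t0 := le_trans s0 st.
rewrite -RintegralD//; last 2 first.
- exact: path_integrable.
- exact: path_integrable.
apply: eq_Rintegral => u _; rewrite -mulrDl; congr (_ * _).
have E a b : (u \in `]a, b]%classic) = (a < u <= b) by apply/idP/idP; rewrite inE/= in_itv.
rewrite !indicE !E; case: (leP u s) => us; first by rewrite (le_trans us st) !andbT addr0.
by rewrite (le_lt_trans s0 us) add0r.
Qed.

End additive_functional.

End path_measurability.

(** * The Markov property transported to path space *)

Section law_on_path_space.
Context {R : realType} {d : nat}.
Context {dO : measure_display} {Omega : measurableType dO}.
Variables (P : 'rV[R]_d -> probability Omega R) (X : R -> Omega -> 'rV[R]_d).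
Hypothesis hX : hunt_process P X.
Variable Z : Omega -> path_space R d.
Hypothesis hZ : forall w (t : R), 0 <= t -> evaluation t (Z w) = X t w.
Variable PP : 'rV[R]_d -> probability (path_space R d) R.
Hypothesis hPP : forall x (A : set (path_space R d)), measurable A ->
  PP x A = pushforward (P x) Z A.
Local Notation leb := (@lebesgue_measure R).
Local Notation Tr := (transition P X).
Local Notation occ := (occupation P X).

(** Stated for the cylinders up to time [t], whose generators pull back to events about a single
    [X s]. *)
Lemma realization_measurable (t : R) : measurable_fun setT (Z : Omega -> past t).
Proof.
apply: (@measurability _ _ Omega (past t) setT Z (cylinders t)) => // _ [_ [s [B [s0 st mB ->]]] <-]; rewrite setTI.
rewrite (_ : Z @^-1` _ = X s @^-1` B).
  by rewrite -[X in measurable X]setTI; apply: (hunt_measurable hX).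
by apply/seteqP; split => w /=; rewrite hZ.
Qed.

Lemma realization_filtration F (s : R) (A : set (path_space R d)) :
  filtration F -> adapted F X -> 0 <= s -> canonical_filtration s A -> F s (Z @^-1` A).
Proof.
move=> hF aF s0; pose C : set (set (path_space R d)) := [set A | F s (Z @^-1` A)].
apply: (@smallest_sub _ _ _ C).
  have [F0 FC FU] := filt_sigma hF s0; rewrite /C; split => /=.
  - by rewrite preimage_set0.
  - by move=> D FD; rewrite setTD preimage_setC -setTD; exact: FC.
  - by move=> D FD; rewrite preimage_bigcup; exact: FU.
move=> _ [u [B [u0 us mB ->]]]; rewrite /C/=.
rewrite (_ : Z @^-1` _ = X u @^-1` B); first exact: (filt_mono hF u0 us (aF u B u0 mB)).
by apply/seteqP; split => w /=; rewrite hZ.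
Qed.

(** Both integrals are computed on [past t]: the identity of laws is used on cylinder events only,
    for which [Z] is measurable. *)
Lemma Rintegral_realization (t : R) x (G : path_space R d -> R) :
  measurable_fun setT (G : past t -> R) ->
  \int[PP x]_w G w = \int[P x]_w G (Z w).
Proof.
move=> mG; have mid := @past_id_measurable R d t; have mZ := @realization_measurable t.
pose nu0 : {measure set (past t) -> \bar R} := pushforward (PP x) (id : path_space R d -> past t).
pose nu := nu0 mid.
transitivity (\int[nu]_w (G : past t -> R) w).
  by symmetry; apply: (@Rintegral_image _ _ (path_space R d) (past t) R id mid).
apply: (@Rintegral_image _ _ Omega (past t) R Z mZ) => // A mA.
rewrite -[LHS]/(PP x A) hPP//; exact: past_borel mA.
Qed.

Lemma Rintegral_realization_in (t : R) x (A : set (path_space R d)) (G : path_space R d -> R) :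
  canonical_filtration t A -> measurable_fun setT (G : past t -> R) ->
  \int[PP x]_(w in A) G w = \int[P x]_(w in Z @^-1` A) G (Z w).
Proof.
move=> mA mG; rewrite Rintegral_mkcond [RHS]Rintegral_mkcond.
have -> : ((fun w => G (Z w)) \_ (Z @^-1` A)) = fun w => (G \_ A) (Z w).
  by apply/funext => w; rewrite /patch; congr (if _ then _ else _); apply/idP/idP; rewrite !inE.
apply: (@Rintegral_realization t).
exact: (iffLR (@measurable_restrictT _ _ (past t) _ A G mA) (measurable_funTS mG)).
Qed.

Lemma past_measurable_le (s t : R) (G : path_space R d -> R) : s <= t ->
  measurable_fun setT (G : past s -> R) -> measurable_fun setT (G : past t -> R).
Proof. by move=> st mG mT U mU; apply: (past_le st); exact: mG. Qed.

Section markov_integral.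
Variables (g : 'rV[R]_d -> R) (B : R).
Hypotheses (mg : measurable_fun setT g) (gB : forall z, `|g z| <= B).
Hypothesis mpos : measurable_fun setT
  (fun q : R * 'rV[R]_d => positive_transition P X g q.1 q.2).
Variable F : R -> set (set Omega).
Hypotheses (hF : filtration F) (hS : strong_markov P X F).

Lemma realization_joint_measurable (t : R) : 0 <= t ->
  measurable_fun setT (fun z : Omega * measurableTypeR R => g (evaluation (Num.min t z.2) (Z z.1))).
Proof.
move=> t0.
have m : measurable_fun setT (fun z : Omega * measurableTypeR R => (z.2, Z z.1) : measurableTypeR R * past t).
  apply: measurable_fun_pair; first exact: measurable_snd.
  exact: (measurableT_comp (@realization_measurable t) measurable_fst).
exact: (measurableT_comp (past_joint_functional mg t0) m).
Qed.

(** Fubini's theorem moves the time integral outside. At each [u] in []s, t]] the Markov property at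
    [s] replaces [g (X u)] by the transition of length [u - s] at [X s], and a translation of time
    by [s] gives the integral over []0, t - s]]. *)
Lemma markov_integral (s t : R) x A : 0 <= s -> s <= t -> F s A ->
  \int[P x]_(w in A) (\int[leb]_u (\1_(`]s, t]%classic) u * g (evaluation u (Z w)))) =
  \int[P x]_(w in A) occ 0 (t - s) g (X s w).
Proof.
move=> s0 st sA; have t0 := le_trans s0 st.
have mA : measurable A by exact: (filt_measurable hF s0).
(* The measure restricted to [A] turns integrals over [A] into integrals over the whole space, the
   form in which the Fubini lemma is stated. *)
pose m : {measure set Omega -> \bar R} := mrestr (P x) mA.
have Ptop : (P x setT < +oo)%E by rewrite probability_setT ltry.
have mtop : (m setT < +oo)%E.
  by rewrite /m /= /mrestr setTI; exact: le_lt_trans (probability_le1 _ mA) (ltry 1).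
have msf : sigma_finite setT m by exists (fun=> setT) => [|n]; rewrite ?bigcup_const.
have mpath u0 : measurable_fun setT (fun w => \int[leb]_u (\1_(`]u0, t]%classic) u * g (evaluation u (Z w)))).
  exact: (measurableT_comp (past_integral_measurable mg gB u0 t0) (@realization_measurable t)).
have mocc : measurable_fun setT (fun w => occ 0 (t - s) g (X s w)).
  apply: (measurableT_comp _ (hunt_measurable hX s0)).
  rewrite (_ : occ 0 (t - s) g = fun x =>
    \int[leb]_u (\1_(`]0, (t - s)]%classic) u * positive_transition P X g u x)); last first.
    by apply/funext => y; exact: occupationE.
  by apply: interval_integral_measurable mpos _ => u y; exact: (positive_transition_bound hX u y mg gB).
rewrite -(@Rintegral_restricted _ _ _ (P x) A mA _ (mpath s)) -(@Rintegral_restricted _ _ _ (P x) A mA _ mocc).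
rewrite -/m.
(* [Num.min] in [G1] and [positive_transition] in [G2] give joint measurability over all times; both
   modifications disappear on []s, t]]. *)
pose G1 (w : Omega) (u : measurableTypeR R) := \1_(`]s, t]%classic) u * g (evaluation (Num.min t u) (Z w)).
pose G2 (w : Omega) (u : measurableTypeR R) := \1_(`]s, t]%classic) u * positive_transition P X g (u - s) (X s w).
have ind : measurable_fun setT (fun z : Omega * measurableTypeR R => \1_(`]s, t]%classic) z.2 : R).
  by apply: measurableT_comp => //; exact: measurable_indic.
have mG1 : measurable_fun setT (fun z => G1 z.1 z.2).
  by apply: measurable_funM => //; exact: realization_joint_measurable.
have mG2 : measurable_fun setT (fun z => G2 z.1 z.2).
  apply: measurable_funM => //.
  have mm : measurable_fun setT (fun z : Omega * measurableTypeR R => (z.2 - s, X s z.1) : R * 'rV[R]_d).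
    apply: measurable_fun_pair.
      by apply: measurable_funB => //; exact: measurable_snd.
    exact: (measurableT_comp (hunt_measurable hX s0) measurable_fst).
  exact: (measurableT_comp mpos mm).
have bnd (h : R) (u : measurableTypeR R) : `|h| <= B ->
    `|\1_(`]s, t]%classic) u * h| <= 1 * (B * \1_(`]s, t]%classic) u).
  move=> hB; rewrite mul1r normrM mulrC; apply: ler_pM => //.
  by rewrite ger0_norm// indicE.
have i1 : m.-integrable setT (EFin \o (fun=> 1)).
  by apply: (@integrable_bounded _ _ _ _ _ _ `|1|).
have i2 := integrableZl measurableT B (interval_indic_integrable s t).
transitivity (\int[m]_w (\int[leb]_u G1 w u)).
  by apply: eq_Rintegral => w _; apply: eq_Rintegral => u _; exact: (@interval_clamp R d g s t u (Z w)).
rewrite (@fubini_Rintegral _ _ Omega (measurableTypeR R) R m leb G1 (fun=> 1)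
   (fun u => B * \1_(`]s, t]%classic) u) msf lebesgue_R_sigma_finite mG1 i1 i2); last first.
  by move=> w u; exact: bnd.
transitivity (\int[leb]_u (\int[m]_w G2 w u)); last first.
  rewrite -(@fubini_Rintegral _ _ Omega (measurableTypeR R) R m leb G2 (fun=> 1)
     (fun u => B * \1_(`]s, t]%classic) u) msf lebesgue_R_sigma_finite mG2 i1 i2); last first.
    by move=> w u; apply: bnd; exact: (positive_transition_bound hX _ _ mg gB).
  apply: eq_Rintegral => w _; rewrite occupationE//.
  rewrite -(@Rintegral_shift1 R s (G2 w)).
    apply: eq_Rintegral => u _; rewrite /G2 addrK; congr (_ * _).
    rewrite !indicE; congr (_%:R); congr nat_of_bool; apply/idP/idP; rewrite !inE/= !in_itv/=.
      by rewrite ltrDr lerBrDr.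
    by rewrite ltrDr lerBrDr.
  exact: (measurableT_comp mG2 (pair1_measurable w)).
apply: eq_Rintegral => u _; rewrite /G1 /G2 indicE; have [|_] := boolP (u \in _); last first.
  by under eq_Rintegral do rewrite mul0r; under [RHS]eq_Rintegral do rewrite mul0r.
rewrite inE/= in_itv/= => /andP[su ut]; have u0 : 0 <= u by exact: le_trans s0 (ltW su).
have us0 : 0 < u - s by rewrite subr_gt0.
under eq_Rintegral do rewrite mul1r min_r// hZ//.
under [RHS]eq_Rintegral do rewrite mul1r /positive_transition us0.
have m1 : measurable_fun setT (fun w => g (X u w)).
  by apply: measurableT_comp => //; exact: (hunt_measurable hX).
have m2 : measurable_fun setT (fun w => Tr (u - s) g (X s w)).
  apply: (measurableT_comp (transition_measurable hX (ltW us0) mg gB)).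
  exact: (hunt_measurable hX).
rewrite (@Rintegral_restricted _ _ _ (P x) A mA _ m1) (@Rintegral_restricted _ _ _ (P x) A mA _ m2).
rewrite -(simple_markov hX hF hS x s0 (ltW us0) sA mg gB).
by rewrite addrC subrK.
Qed.

End markov_integral.

End law_on_path_space.

(** The compensated process [N] is bounded at each time and measurable in the past, so what remains
    is that its increment has integral 0 over every event of the past of [s]. Such an event pulls
    back to the filtration of the Hunt process, and the Markov property turns the increment into
    Dynkin's formula over the duration [t - s], started at [X s]. *)
Theorem theorem4 (R : realType) (d : nat) (hd : (0 < d)%N)
    (mu : {measure set 'rV[R]_d -> \bar R}) (hmu : is_lebesgue mu)
    (Dp Dm : set 'rV[R]_d) (hD : transmission_domains Dp Dm)
    (ep em : R) (hep : 0 < ep) (hem : 0 < em) (hne : ep != em)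
    (p : R -> 'rV[R]_d -> 'rV[R]_d -> R)
    (hp : transition_density mu (fun x => (diffusivity ep em Dp Dm x)%:M) p)
    (dO : measure_display) (Omega : measurableType dO)
    (P : 'rV[R]_d -> probability Omega R) (X : R -> Omega -> 'rV[R]_d)
    (hX : hunt_process P X) (hXp : has_transition_function P X mu p)
    (Z : Omega -> path_space R d)
    (hZ : forall w (t : R), 0 <= t -> evaluation t (Z w) = X t w)
    (PP : 'rV[R]_d -> probability (path_space R d) R)
    (hPP : forall x (A : set (path_space R d)), measurable A -> PP x A = pushforward (P x) Z A)
    (delta : 'rV[R]_d -> R)
    (hdelta : measurable_fun (interface Dp Dm) delta)
    (hdeltab : bounded_on (interface Dp Dm) delta) :
  solves_martingale_problem Dp Dm ep em delta PP.
Proof.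
move=> x; split.
  rewrite -(hunt_normal hX x).
  have m0 : measurable (@evaluation R d 0 @^-1` [set x]).
    rewrite -[X in measurable X]setTI; apply: evaluation_measurable => //.
    apply: closed_measurable_rV; apply: compact_closed; first exact: norm_hausdorff.
    exact: compact_set1.
  rewrite (hPP x _ m0) /pushforward; congr (P x _).
  by apply/seteqP; split => w /=; rewrite hZ.
move=> phi hphi; set L := transmission_operator Dp Dm ep em delta phi.
have [mL [B LB]] := transmission_operator_bounded_measurable hX hmu hD hp hXp hdelta hdeltab hphi.
have dynkin := dynkin_formula hX hmu hD hp hXp hdelta hdeltab hphi.
have [cphi [M phiM] _ _ _] := hphi; have {}phiM z : `|phi z| <= M by exact: phiM.
have mphi := continuous_measurable_rV cphi.
have [F [hF _ aF hS _]] := hunt_filtration hX.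
have mpos := positive_transition_measurable hX hmu (tdens_continuous hp) (tdens_aronson hp) hXp mL LB.
have B0 : 0 <= B by exact: le_trans (normr_ge0 _) (LB 0).
pose I (s t : R) (w : path_space R d) :=
  \int[lebesgue_measure]_u (\1_(`]s, t]%classic) u * L (evaluation u w)).
pose N (t : R) w := phi (evaluation t w) - phi (evaluation 0 w) - I 0 t w.
have NE t w : 0 <= t -> phi (evaluation t w) - phi (evaluation 0 w)
    - \int[lebesgue_measure]_(s in `[0, t]) L (evaluation s w) = N t w.
  by move=> t0; rewrite (path_integral_closed mL LB).
(* Measurability is stated at a later time too, so that [N s] and [N t] are both transported through
   the same [past t]. *)
have mN (s t : R) : 0 <= s -> s <= t -> measurable_fun setT (N s : past t -> R).
  move=> s0 st; have t0 := le_trans s0 st; apply: (past_measurable_le st).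
  apply: measurable_funB; last exact: (past_integral_measurable mL LB 0 s0).
  by apply: measurable_funB; apply: measurableT_comp => //; exact: past_evaluation.
have NB t w : 0 <= t -> `|N t w| <= M + M + B * (t - 0).
  move=> t0; apply: le_trans (ler_normB _ _) _; apply: lerD.
    by apply: le_trans (ler_normB _ _) _; exact: lerD.
  by apply: (path_integral_bound mL LB); rewrite lexx.
split.
- move=> t U t0 mU.
  rewrite (_ : _ @^-1` U = N t @^-1` U); last by apply/seteqP; split => w /=; rewrite NE.
  by have := mN t t t0 (lexx t) measurableT U mU; rewrite setTI.
- move=> t t0; rewrite (_ : EFin \o _ = EFin \o N t); last by apply/funext => w /=; rewrite NE.
  apply: (@integrable_bounded _ _ _ _ _ _ (M + M + B * (t - 0))) => //.
  + by rewrite [X in (X < _)%E]probability_setT ltry.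
  + exact: (measurableT_comp (mN t t t0 (lexx t)) (@past_id_measurable R d t)).
  + by move=> w _; exact: NB.
move=> s t A s0 st sA; have t0 := le_trans s0 st.
have tA : canonical_filtration t A by exact: (past_le st).
transitivity (\int[PP x]_(w in A) N t w); first by apply: eq_Rintegral => w _; exact: NE.
transitivity (\int[PP x]_(w in A) N s w); last by apply: eq_Rintegral => w _; rewrite NE.
rewrite (Rintegral_realization_in hX hZ hPP x tA (mN t t t0 (lexx t))).
rewrite (Rintegral_realization_in hX hZ hPP x tA (mN s t s0 st)).
have FA := realization_filtration hZ hF aF s0 sA; set A' := Z @^-1` A in FA *.
have mA' : measurable A' by exact: (filt_measurable hF s0).
have ibd (f : Omega -> R) (K : R) : measurable_fun setT f -> (forall w, `|f w| <= K) ->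
    (P x).-integrable A' (EFin \o f).
  move=> mf fK; apply: (@integrable_bounded _ _ _ _ _ _ K) => //.
    exact: le_lt_trans (probability_le1 _ mA') (ltry 1).
  exact: measurable_funTS.
have mX u : 0 <= u -> measurable_fun setT (X u) by exact: (hunt_measurable hX).
have ts0 : 0 <= t - s by rewrite subr_ge0.
have mZ := realization_measurable hX hZ (t := t).
have mphiX u : 0 <= u -> measurable_fun setT (fun w => phi (X u w)).
  by move=> u0; apply: measurableT_comp => //; exact: mX.
have mIZ : measurable_fun setT (fun w => I s t (Z w)).
  exact: (measurableT_comp (past_integral_measurable mL LB s t0) mZ).
have IB w : `|I s t (Z w)| <= B * (t - s) by apply: (path_integral_bound mL LB); rewrite s0.
have mNZ : measurable_fun setT (fun w => N s (Z w)).
  exact: (measurableT_comp (mN s t s0 st) mZ).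
have iN := ibd _ _ mNZ (fun w => NB s (Z w) s0).
have iI := ibd _ _ mIZ IB.
have it := ibd _ _ (mphiX t t0) (fun w => phiM (X t w)).
have is' := ibd _ _ (mphiX s s0) (fun w => phiM (X s w)).
(* The value at time [t] is split into the one at time [s] and an increment, in which the time
   integral runs over []s, t]]. *)
transitivity (\int[P x]_(w in A') (N s (Z w) + ((phi (X t w) - phi (X s w)) - I s t (Z w)))).
  apply: eq_Rintegral => w _; rewrite /N -(hZ w t t0) -(hZ w s s0).
  have := path_integral_cat mL LB (Z w) s0 st; rewrite -/(I 0 t (Z w)) -/(I 0 s (Z w)) -/(I s t (Z w)) => ->.
  move: (I 0 s _) (I s t _) (phi _) (phi _) (phi _) => *; ring.
have i1 := integrableB mA' it is'; have i2 := integrableB mA' i1 iI.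
rewrite (RintegralD mA' iN i2) (RintegralB mA' i1 iI) (RintegralB mA' it is').
suff : \int[P x]_(w in A') phi (X t w) - \int[P x]_(w in A') phi (X s w) =
    \int[P x]_(w in A') I s t (Z w) by move=> ->; rewrite subrr addr0.
rewrite (markov_integral hX hZ mL LB mpos hF hS x s0 st FA).
have -> : \int[P x]_(w in A') phi (X t w) = \int[P x]_(w in A') transition P X (t - s) phi (X s w).
  by rewrite -(simple_markov hX hF hS x s0 ts0 FA mphi phiM) addrC subrK.
have mTr : measurable_fun setT (fun w => transition P X (t - s) phi (X s w)).
  exact: (measurableT_comp (transition_measurable hX ts0 mphi phiM) (mX s s0)).
rewrite -RintegralB//; last first.
  by apply: (ibd _ M mTr) => w; exact: (transition_bound hX _ ts0 mphi phiM).
by apply: eq_Rintegral => w _; exact: dynkin.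
Qed.
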